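(* Let $\widetilde{S}_5$ be the covering group of the symmetric group $S_5$ which contains a unique conjugacy class of involutions, that is, the group given by the presentation $$\widetilde{S}_{5}=\langle\, g_1,g_2,g_3,g_4,z \;|\; g_i^2=(g_jg_{j+1})^3=(g_kg_l)^2=z,\ z^2=[z,g_i]=1 \ \text{ for } 1\le i\le 4,\ 1\le j\le 3,\ 1\le k\le l-2\le 2\,\rangle .$$ Then every torsion unit $u$ of the integral group ring $\mathbb{Z}\widetilde{S}_5$ is conjugate to an element of $\pm\widetilde{S}_5$ in the unit group of $\mathbb{Q}\widetilde{S}_5$; i.e., there exist a unit $x$ of $\mathbb{Q}\widetilde{S}_5$ and an element $g\in\widetilde{S}_5$ such that $x^{-1}ux=g$ or $x^{-1}ux=-g$.
   Context: For a finite group $G$, a torsion unit of $\mathbb{Z}G$ is a unit of the ring $\mathbb{Z}G$ of finite multiplicative order, and $\pm G=\{g,-g : g\in G\}\subset\mathbb{Z}G\subset\mathbb{Q}G$. The group $\widetilde{S}_5$ has order $240$; the element $z$ is a central involution with $\widetilde{S}_5/\langle z\rangle\cong S_5$. It is the group with catalogue number $89$ among the groups of order $240$ in the Small Groups Library of GAP. An involution is an element of order $2$. *)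

(* Defs.v *)
From HB Require Import structures.
From mathcomp Require Import all_boot all_order all_algebra all_fingroup.

Set Implicit Arguments.
Unset Strict Implicit.
Unset Printing Implicit Defensive.

Import GRing.Theory.
Local Open Scope ring_scope.

(* A wrapper is needed, since {ffun gT -> R} already carries the pointwise    *)
(* product.                                                                   *)
Record gring (R : Type) (gT : finGroupType) :=
  GRingElt { gcoef : {ffun gT -> R} }.

HB.instance Definition _ (R : Type) (gT : finGroupType) :=
  [isNew for @gcoef R gT].
HB.instance Definition _ (R : eqType) (gT : finGroupType) :=
  [Equality of gring R gT by <:].
HB.instance Definition _ (R : choiceType) (gT : finGroupType) :=
  [Choice of gring R gT by <:].

Definition gring_fun (R : Type) (gT : finGroupType) (u : gring R gT) : gT -> R :=
  gcoef u.
Coercion gring_fun : gring >-> Funclass.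

Definition mkgring (R : Type) (gT : finGroupType) (f : gT -> R) : gring R gT :=
  GRingElt (finfun f).

Lemma mkgringE (R : Type) (gT : finGroupType) (f : gT -> R) g :
  mkgring f g = f g.
Proof. by rewrite /gring_fun /= ffunE. Qed.

Lemma gringP (R : Type) (gT : finGroupType) (u v : gring R gT) :
  (forall g, u g = v g) -> u = v.
Proof. by case: u v => [u] [v] /ffunP /= ->. Qed.

Section GroupRingTheory.

Variables (R : nzRingType) (gT : finGroupType).
Implicit Types (u v w : gring R gT) (g h : gT).

Definition gring_zero : gring R gT := mkgring (fun=> 0).
Definition gring_opp u : gring R gT := mkgring (fun g => - u g).
Definition gring_add u v : gring R gT := mkgring (fun g => u g + v g).

Fact gring_addA : associative gring_add.
Proof. by move=> u v w; apply: gringP => g; rewrite !mkgringE addrA. Qed.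
Fact gring_addC : commutative gring_add.
Proof. by move=> u v; apply: gringP => g; rewrite !mkgringE addrC. Qed.
Fact gring_add0 : left_id gring_zero gring_add.
Proof. by move=> u; apply: gringP => g; rewrite !mkgringE add0r. Qed.
Fact gring_addN : left_inverse gring_zero gring_opp gring_add.
Proof. by move=> u; apply: gringP => g; rewrite !mkgringE addNr. Qed.

HB.instance Definition _ := GRing.isZmodule.Build (gring R gT)
  gring_addA gring_addC gring_add0 gring_addN.

Lemma gring0E g : (0 : gring R gT) g = 0. Proof. exact: mkgringE. Qed.
Lemma gringNE u g : (- u) g = - u g. Proof. exact: mkgringE. Qed.
Lemma gringDE u v g : (u + v) g = u g + v g. Proof. exact: mkgringE. Qed.

(* The image of a group element in the group ring. *)
Definition gelt (a : gT) : gring R gT := mkgring (fun g => (g == a)%:R).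

(* Convolution: (u * v)(g) is the sum of u(h) v(k) over all h, k with h k = g *)
Definition gring_mul u v : gring R gT :=
  mkgring (fun g => \sum_(h : gT) u h * v (h^-1 * g)%g).

Fact gring_mulA : associative gring_mul.
Proof.
move=> u v w; apply: gringP => g; rewrite !mkgringE.
under eq_bigr => h _ do rewrite mkgringE big_distrr /=.
under [RHS]eq_bigr => k _ do rewrite mkgringE big_distrl /=.
rewrite [RHS]exchange_big /=; apply: eq_bigr => h _.
rewrite [RHS](reindex_inj (mulgI h)) /=; apply: eq_bigr => k _.
by rewrite mulrA mulKg invMg mulgA.
Qed.

Fact gring_mul1l : left_id (gelt 1%g) gring_mul.
Proof.
move=> u; apply: gringP => g; rewrite mkgringE (bigD1 1%g) //= mkgringE eqxx.
rewrite mul1r invg1 mul1g big1 ?addr0 // => h /negbTE h1.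
by rewrite mkgringE h1 mul0r.
Qed.

Fact gring_mul1r : right_id (gelt 1%g) gring_mul.
Proof.
move=> u; apply: gringP => g; rewrite mkgringE (bigD1 g) //= mkgringE mulVg.
rewrite eqxx mulr1 big1 ?addr0 // => h /negbTE hg.
by rewrite mkgringE -eq_mulVg1 hg mulr0.
Qed.

Fact gring_mulDl : left_distributive gring_mul +%R.
Proof.
move=> u v w; apply: gringP => g; rewrite gringDE !mkgringE -big_split /=.
by apply: eq_bigr => h _; rewrite gringDE mulrDl.
Qed.

Fact gring_mulDr : right_distributive gring_mul +%R.
Proof.
move=> u v w; apply: gringP => g; rewrite gringDE !mkgringE -big_split /=.
by apply: eq_bigr => h _; rewrite gringDE mulrDr.
Qed.

Fact gring_one_neq0 : gelt 1%g != 0.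
Proof.
apply/eqP=> /(congr1 (fun u : gring R gT => u 1%g))/eqP.
by rewrite gring0E mkgringE eqxx oner_eq0.
Qed.

HB.instance Definition _ := GRing.Zmodule_isNzRing.Build (gring R gT)
  gring_mulA gring_mul1l gring_mul1r gring_mulDl gring_mulDr gring_one_neq0.

Lemma gring1E g : (1 : gring R gT) g = (g == 1%g)%:R.
Proof. exact: mkgringE. Qed.

Lemma gringME u v g : (u * v) g = \sum_(h : gT) u h * v (h^-1 * g)%g.
Proof. exact: mkgringE. Qed.

Lemma gelt1 : gelt 1%g = 1. Proof. by []. Qed.

Lemma geltM : {morph gelt : a b / (a * b)%g >-> a * b}.
Proof.
move=> a b; apply: gringP => g; rewrite gringME (bigD1 a) //= !mkgringE eqxx.
rewrite mul1r big1 ?addr0 => [|h /negbTE ha]; last by rewrite mkgringE ha mul0r.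
by rewrite -[in RHS](inj_eq (mulgI a)) mulKVg.
Qed.

End GroupRingTheory.

Arguments gelt {R gT} a.

(* Over a commutative R, the group ring is a free module of finite rank, so   *)
(* units are detected by the matrix of right multiplication.                  *)
Section GroupRingUnits.

Variables (R : comUnitRingType) (gT : finGroupType).
Implicit Types (u v w : gring R gT).

Definition gvec u : 'rV[R]_#|gT| := \row_i u (enum_val i).
Definition gunvec (r : 'rV[R]_#|gT|) : gring R gT :=
  mkgring (fun g => r 0 (enum_rank g)).

Lemma gvecK : cancel gvec gunvec.
Proof. by move=> u; apply: gringP => g; rewrite mkgringE mxE enum_rankK. Qed.
Lemma gunvecK : cancel gunvec gvec.
Proof. by move=> r; apply/rowP=> i; rewrite mxE mkgringE enum_valK. Qed.

Definition gmx u : 'M[R]_#|gT| :=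
  \matrix_(i, j) u ((enum_val i)^-1 * enum_val j)%g.

Lemma gvecM u v : gvec (u * v) = gvec u *m gmx v.
Proof.
apply/rowP=> j; rewrite !mxE gringME (reindex_onto _ _ (in1W enum_rankK)) /=.
rewrite (eq_bigl xpredT) => [|i]; last by rewrite enum_valK eqxx.
by apply: eq_bigr => i _; rewrite !mxE.
Qed.

Lemma gmx_inj : injective gmx.
Proof.
move=> u v eq_uv; rewrite -[u]mul1r -[v]mul1r.
by apply: (can_inj gvecK); rewrite !gvecM eq_uv.
Qed.

Lemma gmx1 : gmx 1 = 1%:M.
Proof.
apply/matrixP=> i j; rewrite !mxE gring1E -eq_mulVg1.
by rewrite (inj_eq enum_val_inj).
Qed.

Lemma gmxM u v : gmx (u * v) = gmx u *m gmx v.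
Proof.
have mxP (A B : 'M[R]_#|gT|) : (forall w, gvec w *m A = gvec w *m B) -> A = B.
  move=> eqAB; apply/row_matrixP=> i.
  by rewrite !rowE -[delta_mx 0 i]gunvecK eqAB.
by apply: mxP => w; rewrite mulmxA -!gvecM mulrA.
Qed.

Definition gring_unit : {pred gring R gT} := [pred u | gmx u \in unitmx].
Definition gring_inv u : gring R gT :=
  if u \in gring_unit then gunvec (gvec 1 *m invmx (gmx u)) else u.

Fact gring_mulVr : {in gring_unit, left_inverse 1 gring_inv *%R}.
Proof.
move=> u Uu; rewrite /gring_inv Uu; apply: (can_inj gvecK).
by rewrite gvecM gunvecK mulmxKV.
Qed.

Fact gring_divrr : {in gring_unit, right_inverse 1 gring_inv *%R}.
Proof.
move=> u Uu; apply: gmx_inj; rewrite gmxM gmx1.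
by apply: mulmx1C; rewrite -gmxM gring_mulVr // gmx1.
Qed.

Fact gring_unitP u v : v * u = 1 /\ u * v = 1 -> u \in gring_unit.
Proof.
case=> _ uv1; have: gmx u *m gmx v = 1%:M by rewrite -gmxM uv1 gmx1.
by rewrite inE => /mulmx1_unit[].
Qed.

Fact gring_inv_out : {in [predC gring_unit], gring_inv =1 id}.
Proof. by move=> u /negbTE Uu; rewrite /gring_inv Uu. Qed.

HB.instance Definition _ := GRing.NzRing_hasMulInverse.Build (gring R gT)
  gring_mulVr gring_divrr gring_unitP gring_inv_out.

End GroupRingUnits.

(* The inclusion of Z[G] into Q[G]. *)
Definition gring_ZtoQ (gT : finGroupType) (u : gring int gT) : gring rat gT :=
  mkgring (fun g => (u g)%:~R).

Section Inclusion.

Variable gT : finGroupType.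

Lemma gring_ZtoQE (u : gring int gT) g : gring_ZtoQ u g = (u g)%:~R.
Proof. exact: mkgringE. Qed.

Fact gring_ZtoQ_is_zmod_morphism : zmod_morphism (@gring_ZtoQ gT).
Proof.
move=> u v; apply: gringP => g.
by rewrite gringDE gringNE !gring_ZtoQE gringDE gringNE rmorphB.
Qed.

Fact gring_ZtoQ_is_monoid_morphism : monoid_morphism (@gring_ZtoQ gT).
Proof.
split=> [|u v]; apply: gringP => g.
  by rewrite gring_ZtoQE !gring1E; case: eqP.
rewrite gringME gring_ZtoQE gringME rmorph_sum /=.
by apply: eq_bigr => h _; rewrite !gring_ZtoQE rmorphM.
Qed.

HB.instance Definition _ := GRing.isZmodMorphism.Build (gring int gT)
  (gring rat gT) (@gring_ZtoQ gT) gring_ZtoQ_is_zmod_morphism.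
HB.instance Definition _ := GRing.isMonoidMorphism.Build (gring int gT)
  (gring rat gT) (@gring_ZtoQ gT) gring_ZtoQ_is_monoid_morphism.

Lemma gring_ZtoQ_inj : injective (@gring_ZtoQ gT).
Proof.
move=> u v eq_uv; apply: gringP => g; apply: (@intr_inj rat).
by rewrite -!gring_ZtoQE eq_uv.
Qed.

Lemma gring_ZtoQ_gelt (a : gT) : gring_ZtoQ (gelt a) = gelt a.
Proof. by apply: gringP => g; rewrite gring_ZtoQE !mkgringE; case: eqP. Qed.

End Inclusion.

Definition torsion_unit (A : unitRingType) (u : A) : Prop :=
  u \is a GRing.unit /\ exists2 n : nat, (0 < n)%N & u ^+ n = 1.

(* \isog Grp says that gT is the largest finite quotient of the presented     *)
(* group; as the latter is finite (of order 240), gT is that group itself.    *)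
Definition is_cover_S5 (gT : finGroupType) : Prop :=
  ([set: gT] \isog Grp (g1 : g2 : g3 : g4 : z :
    g1 ^+ 2 = z, g2 ^+ 2 = z, g3 ^+ 2 = z, g4 ^+ 2 = z,
    (g1 * g2) ^+ 3 = z, (g2 * g3) ^+ 3 = z, (g3 * g4) ^+ 3 = z,
    (g1 * g3) ^+ 2 = z, (g1 * g4) ^+ 2 = z, (g2 * g4) ^+ 2 = z,
    z ^+ 2 = 1,
    [~ z, g1] = 1, [~ z, g2] = 1, [~ z, g3] = 1, [~ z, g4] = 1))%g.

(* Main.v *)
(** For a conjugacy class C let eps_C(u) be the sum of the coefficients of u    *)
(** over C.  Two torsion units whose powers have the same class sums are        *)
(** conjugate in QG, so it suffices to show, by induction on the order n of a   *)
(** unit u of augmentation 1, that eps_C(u) is 1 for one class and 0 for the    *)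
(** others.  Counting necklaces gives eps_C(u^p) modulo p and shows that        *)
(** eps_C(u) = 0 on p-singular classes when p does not divide n.  The trace of  *)
(** m |-> u m u^-1 on the eigenspaces of the central involution z bounds two    *)
(** quadratic forms in the eps_C(u).  This settles all n except 4, 8 and 12.    *)
(** For n = 4, the map m |-> u m x^-1 with x of order 8 becomes unipotent       *)
(** modulo 2; comparing ranks modulo 2 and over Q shows that the eps_C(u) on    *)
(** the classes of order 8 vanish.  For n = 8 and 12, an embedding of G in      *)
(** SL(2, 25) provides representations of degrees 2 and 3 in characteristic 5,  *)
(** and the identities between det A and the traces of A, A^-1, A^2, A^3 for    *)
(** A the image of u exclude the remaining solutions modulo 5.                  *)

From HB Require Import structures.
Require Import Defs.
From mathcomp Require Import all_boot all_order all_algebra all_fingroup.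
From mathcomp Require Import cyclic zmodp algC cyclotomic mxrepresentation classfun character.
From mathcomp Require Import ssrAC ring zify.

Set Implicit Arguments.
Unset Strict Implicit.
Unset Printing Implicit Defensive.

(** * The order of the group *)

(** Write [eps k u] for the sum of the coefficients of u over the k-th of the twelve conjugacy
    classes. If every power of u has the same class sums as that power of a group element g, then a
    cyclic group times G acts on the complex group algebra by m |-> u^i m h and by m |-> g^i m h
    with equal characters. An intertwiner is left multiplication by an invertible element, and the
    intertwining equations are linear with rational coefficients, so a rational invertible solution
    exists ([rational_conjugacy]). A torsion unit has augmentation 1 or -1; up to sign it remains to
    prove [torsion_trivial], that the class sums of u are those of some group element. [trivial_pow]
    then makes the choices for the powers of u compatible.

    Two constraints hold for every order. Counting words up to rotation ([necklace]) gives the class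
    sums of u^p modulo p, and gives them exactly when p is prime to the order; hence the p-singular
    classes contribute nothing in that case ([eps_singular]). Conjugation by u on either eigenspace
    of the central involution z has finite order, so its trace is at most the dimension: two
    quadratic inequalities ([conj_quadratic_bound]), which force u to be 1 or z unless [eps 0 u] and
    [eps 1 u] vanish ([eps01_dichotomy]) and bound the other class sums.

    The induction knows u^2. The congruence modulo 2 places u^2 in a class of squares, which leaves,
    besides odd orders, u^2 = 1, u^6 = 1, u^10 = 1 and orders 4, 8, 12. The first three reduce to
    odd order by multiplying with z. Order 4 needs a comparison of ranks modulo 2 and over Q
    ([order4_unit_conj_count]). Orders 8 and 12 use representations of degree 2 and 3 in
    characteristic 5: every class is closed under inversion, so the images of u and of its inverse
    have equal traces, and Newton's identities restrict these modulo 5 ([lift_mx2_trace],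
    [lift_mx3_trace]).

    All facts about classes are finite computations, because [cover_model] identifies G with an
    explicit list of 240 matrices. *)

Section RightStabilizer.
Import GroupScope.
Variable gT : finGroupType.
Implicit Types (A : {set gT}) (s : seq gT).

(** Coset enumeration in disguise: a set that contains 1 and is stable under right multiplication by
    all generators is the whole group. *)
Definition right_stab A := [set x | [forall a in A, a * x \in A]].

Lemma right_stabP A x : reflect (forall a, a \in A -> a * x \in A) (x \in right_stab A).
Proof. by rewrite inE; apply: (iffP forall_inP). Qed.

Lemma right_stab_group_set A : group_set (right_stab A).
Proof.
apply/group_setP; split=> [|x y /right_stabP Ax /right_stabP Ay].
  by apply/right_stabP=> a; rewrite mulg1.
by apply/right_stabP=> a Aa; rewrite mulgA Ay ?Ax.
Qed.
Canonical right_stab_group A := Group (right_stab_group_set A).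

(** One layer of the enumeration: multiplying a representative by g may leave a factor on its left,
    which A absorbs. *)
Lemma right_stab_mulset A s g :
    (forall r, r \in s -> exists w r', [/\ w \in right_stab A, r' \in s & r * g = w * r']) ->
  g \in right_stab (A * [set:: s]).
Proof.
move=> sg; apply/right_stabP=> _ /mulsgP[a r Aa sr ->].
have [|w [r' [Aw s_r' rg]]] := sg r; first by rewrite inE in sr.
rewrite -mulgA rg mulgA; apply: mem_mulg; last by rewrite inE.
by move/right_stabP: Aw; apply.
Qed.

Lemma card_mulset_seq A s : #|A * [set:: s]| <= #|A| * size s.
Proof.
have -> : A * [set:: s] = [set p.1 * p.2 | p in setX A [set:: s]].
  apply/setP=> x; apply/mulsgP/imsetP=> [[a r Aa sr ->]|[[a r]]].
    by exists (a, r); rewrite ?inE ?Aa //; rewrite inE in sr.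
  by rewrite !inE /= => /andP[Aa sr] ->; exists a r; rewrite ?inE.
apply: leq_trans (leq_imset_card _ _) _; rewrite cardsX leq_mul2l cardsE card_size.
exact: orbT.
Qed.

End RightStabilizer.

Section CosetBound.
Import GroupScope.
Variables (gT : finGroupType) (g1 g2 g3 g4 z : gT).
Hypotheses (gen : <[g1]> <*> <[g2]> <*> <[g3]> <*> <[g4]> <*> <[z]> = [set: gT]).
Hypotheses (s1 : g1 * g1 = z) (s2 : g2 * g2 = z) (s3 : g3 * g3 = z) (s4 : g4 * g4 = z).
Hypotheses (zz : z * z = 1) (zC : forall g, g * z = z * g).
Hypotheses (b12 : g2 * g1 * g2 = g1 * g2 * g1) (b23 : g3 * g2 * g3 = g2 * g3 * g2).
Hypotheses (b34 : g4 * g3 * g4 = g3 * g4 * g3).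
Hypotheses (c13 : g3 * g1 = z * g1 * g3) (c14 : g4 * g1 = z * g1 * g4).
Hypotheses (c24 : g4 * g2 = z * g2 * g4).

(* The normal forms are those of the Coxeter group S_5, up to the sign z. *)
Let A1 := [set 1; z] * [set:: [:: 1; g1]].
Let A2 := A1 * [set:: [:: 1; g2; g2 * g1]].
Let A3 := A2 * [set:: [:: 1; g3; g3 * g2; g3 * g2 * g1]].
Let A4 := A3 * [set:: [:: 1; g4; g4 * g3; g4 * g3 * g2; g4 * g3 * g2 * g1]].

Lemma right_stab_central A s : z \in right_stab A -> z \in right_stab (A * [set:: s]).
Proof. by move=> Az; apply: right_stab_mulset => r sr; exists z, r; rewrite zC. Qed.

Lemma mul_anticomm (a b x : gT) : a * b = z * b * a -> x * a * b = z * x * b * a.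
Proof. by move=> ab; rewrite -mulgA ab !mulgA zC. Qed.

Lemma mul_anticommV (a b x : gT) : b * a = z * a * b -> x * a * b = z * x * b * a.
Proof. by move=> ba; apply: mul_anticomm; rewrite -mulgA ba !mulgA zz mul1g. Qed.

Lemma mul_square (a x : gT) : a * a = z -> x * a * a = z * x.
Proof. by move=> aa; rewrite -mulgA aa zC. Qed.

Lemma mul_braid (a b x : gT) : a * b * a = b * a * b -> x * a * b * a = x * b * a * b.
Proof. by move=> br; rewrite -!mulgA [a * _]mulgA br !mulgA. Qed.

Ltac coset w r' := exists w, r'; split;
  [by rewrite ?groupM ?group1 | by rewrite !inE !eqxx ?orbT | ].

(** The layers follow the chain S_2 < S_3 < S_4 < S_5 and have at most 4, 12, 48 and 240 elements.
    Each product of a representative with a generator is brought back to normal form by the braid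
    and anticommutation rules. *)
Lemma cover_card_le : #|gT| <= 240.
Proof.
have z0 : z \in right_stab [set 1; z].
  by apply/right_stabP=> a /set2P[] ->; rewrite ?mul1g ?zz !inE eqxx ?orbT.
have z1 : z \in right_stab A1 by apply: right_stab_central.
have g1_1 : g1 \in right_stab A1.
  apply: right_stab_mulset => r; rewrite !inE => /orP[]/eqP->.
    by coset (1 : gT) g1; rewrite mul1g.
  by coset z (1 : gT); rewrite s1 mulg1.
have z2 : z \in right_stab A2 by apply: right_stab_central.
have g2_1 : g1 \in right_stab A2.
  apply: right_stab_mulset => r; rewrite !inE => /or3P[]/eqP->.
  - by coset g1 (1 : gT); rewrite mul1g mulg1.
  - by coset (1 : gT) (g2 * g1); rewrite mul1g.
  - by coset z g2; rewrite mul_square.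
have g2_2 : g2 \in right_stab A2.
  apply: right_stab_mulset => r; rewrite !inE => /or3P[]/eqP->.
  - by coset (1 : gT) g2; rewrite mul1g.
  - by coset z (1 : gT); rewrite s2 mulg1.
  - by coset g1 (g2 * g1); rewrite b12 mulgA.
have z3 : z \in right_stab A3 by apply: right_stab_central.
have g3_1 : g1 \in right_stab A3.
  apply: right_stab_mulset => r; rewrite !inE => /or4P[]/eqP->.
  - by coset g1 (1 : gT); rewrite mul1g mulg1.
  - by coset (z * g1) g3.
  - by coset (1 : gT) (g3 * g2 * g1); rewrite mul1g.
  - by coset z (g3 * g2); rewrite mul_square.
have g3_2 : g2 \in right_stab A3.
  apply: right_stab_mulset => r; rewrite !inE => /or4P[]/eqP->.
  - by coset g2 (1 : gT); rewrite mul1g mulg1.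
  - by coset (1 : gT) (g3 * g2); rewrite mul1g.
  - by coset z g3; rewrite mul_square.
  - coset (z * g1) (g3 * g2 * g1).
    by rewrite mul_braid // c13 ?mulgA.
have g3_3 : g3 \in right_stab A3.
  apply: right_stab_mulset => r; rewrite !inE => /or4P[]/eqP->.
  - by coset (1 : gT) g3; rewrite mul1g.
  - by coset z (1 : gT); rewrite s3 mulg1.
  - by coset g2 (g3 * g2); rewrite b23 mulgA.
  - coset (z * g2) (g3 * g2 * g1).
    by rewrite (mul_anticommV _ c13) ?mulgA mul_braid.
have z4 : z \in right_stab A4 by apply: right_stab_central.
have g4_1 : g1 \in right_stab A4.
  apply: right_stab_mulset => r; rewrite !inE => /or4P[/eqP->|/eqP->|/eqP->|/orP[]/eqP->].
  - by coset g1 (1 : gT); rewrite mul1g mulg1.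
  - by coset (z * g1) g4.
  - by coset g1 (g4 * g3); rewrite (mul_anticomm _ c13) ?mulgA (mul_anticomm _ c14) ?mulgA zz mul1g.
  - by coset (1 : gT) (g4 * g3 * g2 * g1); rewrite mul1g.
  - by coset z (g4 * g3 * g2); rewrite mul_square // ?mulgA.
have g4_2 : g2 \in right_stab A4.
  apply: right_stab_mulset => r; rewrite !inE => /or4P[/eqP->|/eqP->|/eqP->|/orP[]/eqP->].
  - by coset g2 (1 : gT); rewrite mul1g mulg1.
  - by coset (z * g2) g4.
  - by coset (1 : gT) (g4 * g3 * g2); rewrite mul1g.
  - by coset z (g4 * g3); rewrite mul_square // ?mulgA.
  - coset g1 (g4 * g3 * g2 * g1); rewrite mul_braid //.
    by rewrite (mul_anticomm _ c13) ?mulgA (mul_anticomm _ c14) ?mulgA zz mul1g.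
have g4_3 : g3 \in right_stab A4.
  apply: right_stab_mulset => r; rewrite !inE => /or4P[/eqP->|/eqP->|/eqP->|/orP[]/eqP->].
  - by coset g3 (1 : gT); rewrite mul1g mulg1.
  - by coset (1 : gT) (g4 * g3); rewrite mul1g.
  - by coset z g4; rewrite mul_square.
  - coset (z * g2) (g4 * g3 * g2); rewrite mul_braid // c24.
    by rewrite ?mulgA.
  - coset g2 (g4 * g3 * g2 * g1); rewrite (mul_anticommV _ c13) ?mulgA.
    by rewrite mul_braid // (mul_anticomm _ c24) ?mulgA zz mul1g.
have g4_4 : g4 \in right_stab A4.
  apply: right_stab_mulset => r; rewrite !inE => /or4P[/eqP->|/eqP->|/eqP->|/orP[]/eqP->].
  - by coset (1 : gT) g4; rewrite mul1g.
  - by coset z (1 : gT); rewrite s4 mulg1.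
  - by coset g3 (g4 * g3); rewrite b34 mulgA.
  - coset (z * g3) (g4 * g3 * g2); rewrite (mul_anticommV _ c24).
    by rewrite ?mulgA mul_braid.
  - coset g3 (g4 * g3 * g2 * g1); rewrite (mul_anticommV _ c14) ?mulgA.
    by rewrite (mul_anticommV _ c24) ?mulgA zz mul1g b34.
have sGA : [set: gT] \subset right_stab A4.
  by rewrite -gen !join_subG !cycle_subG g4_1 g4_2 g4_3 g4_4.
have A4T : [set: gT] \subset A4.
  apply/subsetP=> x Gx; have /right_stabP/(_ 1) := subsetP sGA x Gx.
  rewrite mul1g; apply.
  have one_mul (A : {set gT}) s : 1 \in A -> 1 \in A * [set:: 1 :: s].
    by move=> A_1; apply/mulsgP; exists 1 1; rewrite ?mulg1 // inE mem_head.
  by apply/one_mul/one_mul/one_mul/one_mul; rewrite !inE eqxx.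
rewrite -cardsT; apply: leq_trans (subset_leq_card A4T) _.
have c1 : #|A1| <= 4.
  by apply: leq_trans (card_mulset_seq _ _) _; rewrite cards2; case: (1 != z).
have c2 : #|A2| <= 12 by apply: leq_trans (card_mulset_seq _ _) _; rewrite (leq_mul c1 (leqnn 3)).
have c3 : #|A3| <= 48 by apply: leq_trans (card_mulset_seq _ _) _; rewrite (leq_mul c2 (leqnn 4)).
by apply: leq_trans (card_mulset_seq _ _) _; rewrite (leq_mul c3 (leqnn 5)).
Qed.
End CosetBound.

Import Order.TTheory GRing.Theory Num.Theory.
Local Open Scope ring_scope.

(** * Class sums of powers *)

Definition class_function (gT : finGroupType) (f : gT -> int) :=
  forall x y, f (x * y)%g = f (y * x)%g.

(** The additive extension of f to the group ring; for the indicator of a class it is a partial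
    augmentation. *)
Definition gpair (gT : finGroupType) (f : gT -> int) (u : gring int gT) : int :=
  \sum_g u g * f g.

Section Pairing.
Variable gT : finGroupType.
Implicit Types (f : gT -> int) (u v w : gring int gT).

Lemma gpair_is_zmod_morphism f : zmod_morphism (gpair f).
Proof.
move=> u v; rewrite /gpair -sumrB; apply: eq_bigr => g _.
by rewrite gringDE gringNE mulrBl.
Qed.

HB.instance Definition _ f :=
  GRing.isZmodMorphism.Build (gring int gT) int (gpair f) (gpair_is_zmod_morphism f).

Lemma gpair_gelt f x : gpair f (gelt x) = f x.
Proof.
rewrite /gpair (bigD1 x) //= mkgringE eqxx mul1r big1 ?addr0 // => g /negbTE gx.
by rewrite mkgringE gx mul0r.
Qed.

Lemma eq_gpair f1 f2 u : f1 =1 f2 -> gpair f1 u = gpair f2 u.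
Proof. by move=> eq_f; apply: eq_bigr => g _; rewrite eq_f. Qed.

Lemma gring_sum (R : nzRingType) (I : Type) (r : seq I) (P : pred I)
    (F : I -> gring R gT) g :
  (\sum_(i <- r | P i) F i) g = \sum_(i <- r | P i) F i g.
Proof.
by apply: (big_morph (fun u : gring R gT => u g)) => [u v|];
  rewrite ?gringDE ?gring0E.
Qed.

Lemma gringMn (R : nzRingType) (u : gring R gT) n g : (u *+ n) g = u g *+ n.
Proof. by elim: n => [|n IHn]; rewrite ?gring0E // !mulrS gringDE IHn. Qed.

Lemma gpair_mulE f u v : gpair f (u * v) = \sum_x \sum_y u x * v y * f (x * y)%g.
Proof.
rewrite /gpair; under eq_bigr do rewrite gringME mulr_suml.
rewrite exchange_big /=; apply: eq_bigr => x _.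
rewrite (reindex_inj (mulgI x)) /=; apply: eq_bigr => y _.
by rewrite mulKg.
Qed.

Lemma class_function_expg f n :
  class_function f -> class_function (fun g => f (g ^+ n)%g).
Proof.
move=> fC x y; case: n => [//|n].
have -> : ((x * y) ^+ n.+1 = x * ((y * x) ^+ n * y))%g.
  elim: n => [|n IHn]; first by rewrite expg0 mul1g expg1.
  by rewrite expgS IHn expgS !mulgA.
by rewrite fC -mulgA -expgSr.
Qed.

Lemma class_functionJ f x y : class_function f -> f (x ^ y)%g = f x.
Proof. by move=> fC; rewrite conjgE fC -mulgA mulgV mulg1. Qed.

End Pairing.

Lemma gelt_prod (R : nzRingType) (gT : finGroupType) (I : Type) (s : seq I)
    (x : I -> gT) :
  \prod_(i <- s) gelt (x i) = gelt (\prod_(i <- s) x i)%g :> gring R gT.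
Proof. by rewrite (big_morph _ (@geltM R gT) (gelt1 R gT)). Qed.

Lemma big_tuple_cons (R : nmodType) (J : finType) m (F : m.+1.-tuple J -> R) :
  \sum_t F t = \sum_j \sum_(t : m.-tuple J) F [tuple of j :: t].
Proof.
rewrite pair_bigA /=.
rewrite (reindex (fun p : J * m.-tuple J => [tuple of p.1 :: p.2])) //=.
exists (fun t => (thead t, [tuple of behead t])) => [[j t]|t] _ /=.
  by congr pair; apply: val_inj.
by rewrite [RHS]tuple_eta; apply: val_inj.
Qed.

Lemma exprn_sum_tuple (R : nzRingType) (J : finType) (a : J -> R) m :
  (\sum_j a j) ^+ m = \sum_(t : m.-tuple J) \prod_(j <- t) a j.
Proof.
elim: m => [|m IHm].
  rewrite expr0 (bigD1 [tuple]) //= big_nil big1 ?addr0 // => t.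
  by case/eqP; apply: tuple0.
rewrite exprS IHm big_tuple_cons mulr_suml; apply: eq_bigr => j _.
by rewrite mulr_sumr; apply: eq_bigr => t _; rewrite big_cons.
Qed.

(** * Words up to rotation *)

Section Rotation.
Variables (J : eqType).

Lemma rot_periodic k p (t : seq J) :
  size t = (p * k)%N -> rot k t = t -> t = flatten (nseq p (take k t)).
Proof.
elim: p t => [|[|p] IHp] t; first by move/size0nil.
  by rewrite mul1n => st _; rewrite /= cats0 take_oversize ?st.
move=> st rt; set a := take k t; set b := drop k t.
have sa : size a = k by rewrite size_takel // st leq_pmull.
have def_t : t = a ++ b by rewrite cat_take_drop.
have sb : size b = (p.+1 * k)%N by rewrite size_drop st mulSn addKn.
have ba : b ++ a = a ++ b by rewrite -def_t -[RHS]rt.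
have tb : take k b = a.
  have := congr1 (take k) ba; rewrite takel_cat; last by rewrite sb leq_pmull.
  by rewrite take_size_cat.
have db : b = a ++ drop k b by rewrite -{1}(cat_take_drop k b) tb.
have rb : rot k b = b.
  rewrite /rot tb; move: ba; rewrite {1}db -catA => /eqP.
  by rewrite eqseq_cat // => /andP[_ /eqP].
by rewrite {1}def_t [b in LHS](IHp b sb rb) tb.
Qed.

Lemma rot_flatten_nseq k p (s : seq J) :
  size s = k -> rot k (flatten (nseq p s)) = flatten (nseq p s).
Proof.
move=> <-; case: p => [|p]; first by rewrite /rot.
rewrite /= rot_size_cat; elim: p => [|p IHp] /=; first by rewrite cats0.
by rewrite -catA IHp.
Qed.

End Rotation.

Section FreeRotation.
Variables (T : finType) (r : {perm T}) (p N : nat) (F : T -> int).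
Hypotheses (p_pr : prime p) (rF : forall t, F (r t) = F t).
Hypothesis r_ord : forall t, iter (p ^ N.+1) r t = t.

Lemma dvdn_card_porbit m t : iter m r t = t -> (#|porbit r t| %| m)%N.
Proof.
move=> rm; set k := #|porbit r t|.
have k_gt0 : (0 < k)%N by rewrite lt0n card_porbit_neq0.
have iterk q : iter (q * k) r t = t.
  by elim: q => // q IHq; rewrite mulSn iterD IHq iter_porbit.
have: iter (m %% k) r t = t.
  by rewrite -[RHS]rm {2}(divn_eq m k) addnC iterD iterk.
have := uniq_traject_porbit r t; rewrite -/k => Uk rmk.
have ltk : (m %% k < k)%N by rewrite ltn_mod.
apply/eqP; apply: contraTeq Uk => nz; apply/(uniqPn t).
exists 0%N, (m %% k)%N; split; rewrite ?lt0n ?size_traject //.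
by rewrite !nth_traject ?rmk.
Qed.

(* A rotation orbit not fixed by the p^N-th rotation has exactly p^(N+1) elements. *)
Lemma dvdn_sum_free_rotation :
  ((p ^ N.+1)%:Z %| \sum_(t | iter (p ^ N) r t != t) F t)%Z.
Proof.
rewrite (partition_big (porbit r) predT) //=.
apply: rpred_sum => O _.
have [t0 /andP[/andP[ne /eqP <-] _]|none] :=
    pickP [pred t | (iter (p ^ N) r t != t) && (porbit r t == O) & true]; last first.
  by rewrite big1 ?rpred0 // => t h; have := none t; rewrite /= h.
have cardO : #|porbit r t0| = (p ^ N.+1)%N.
  have /(dvdn_pfactor _ _ p_pr)[j le_j def_j] := dvdn_card_porbit (r_ord t0).
  rewrite def_j; move: le_j; rewrite leq_eqVlt => /predU1P[-> //|lt_jN].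
  case/eqP: ne; have: (#|porbit r t0| %| p ^ N)%N by rewrite def_j dvdn_exp2l.
  case/dvdnP=> q ->; elim: q => // q IHq.
  by rewrite mulSn iterD IHq iter_porbit.
have FO t : t \in porbit r t0 -> F t = F t0.
  case/porbitP=> i ->; elim: i => [|i IHi]; first by rewrite expg0 perm1.
  by rewrite expgSr permM rF.
have iterc i t : r (iter i r t) = iter i r (r t) by rewrite -iterS iterSr.
rewrite (eq_bigl (mem (porbit r t0))) => [|t /=].
  rewrite (eq_bigr (fun=> F t0)) => [|t /FO //].
  by rewrite sumr_const cardO -mulr_natr natz dvdz_mull.
rewrite -eq_porbit_mem; apply/andb_idl; rewrite eq_porbit_mem.
case/porbitP=> i ->; apply: contraNneq ne.
elim: i => [|i IHi]; first by rewrite expg0 perm1 => /eqP.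
by rewrite expgSr permM -iterc => /perm_inj.
Qed.

End FreeRotation.

Section Necklace.
Variables (gT : finGroupType) (p : nat) (p_pr : prime p).
Implicit Types (f : gT -> int) (u v w : gring int gT).

Lemma rot_prod (J : finType) (x : J -> gT) f k (t : seq J) :
  class_function f ->
  f (\prod_(j <- rot k t) x j)%g = f (\prod_(j <- t) x j)%g.
Proof. by move=> fC; rewrite /rot big_cat fC -big_cat cat_take_drop. Qed.

Lemma prod_flatten_nseq (J : finType) (x : J -> gT) q (s : seq J) :
  (\prod_(j <- flatten (nseq q s)) x j = (\prod_(j <- s) x j) ^+ q)%g.
Proof.
elim: q => [|q IHq] /=; first by rewrite big_nil expg0.
by rewrite big_cat IHq expgS.
Qed.

Lemma rot_tuple_inj (J : finType) m : injective (fun t : m.-tuple J => [tuple of rot 1 t]).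
Proof. by move=> t1 t2 /(congr1 val) /= /rot_inj /val_inj. Qed.

(** The power expands into words of length p^(N+1), on whose products f is invariant under rotation.
    Words fixed by the p^N-th rotation are p-fold repetitions and account for the second pairing;
    the others lie in orbits of size p^(N+1). *)
Lemma necklace_sum (J : finType) (x : J -> gT) f N :
  class_function f ->
  ((p ^ N.+1)%:Z %| gpair f ((\sum_j gelt (x j)) ^+ (p ^ N.+1))
        - gpair (fun g => f (g ^+ p)%g) ((\sum_j gelt (x j)) ^+ (p ^ N)))%Z.
Proof.
move=> fC; rewrite !exprn_sum_tuple.
pose m := (p ^ N.+1)%N; pose k := (p ^ N)%N.
have p_gt0 := prime_gt0 p_pr.
have k_gt0 : (0 < k)%N by rewrite expn_gt0 p_gt0.
pose r := perm (@rot_tuple_inj J m).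
have itr i (t : m.-tuple J) : (i <= m)%N -> val (iter i r t) = rot i t.
  elim: i => [|i IHi] le_i; first by rewrite rot0.
  by rewrite iterS permE /= IHi 1?ltnW // -rotS // size_tuple.
have r_ord (t : m.-tuple J) : iter (p ^ N.+1) r t = t.
  by apply: val_inj; rewrite itr //= -[X in rot X _](size_tuple t) rot_size.
have le_km : (k <= m)%N by rewrite leq_pexp2l.
have rF (t : m.-tuple J) :
    f (\prod_(j <- r t) x j)%g = f (\prod_(j <- t) x j)%g.
  by rewrite permE rot_prod.
have := dvdn_sum_free_rotation p_pr rF r_ord; congr (_ %| _)%Z.
set f' := fun g : gT => _; rewrite (raddf_sum (gpair f)) (raddf_sum (gpair f')) /=.
apply/eqP; rewrite eq_sym subr_eq addrC {}/f'.
rewrite (bigID (fun t => iter (p ^ N) r t == t)) /=; apply/eqP; congr (_ + _).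
  under [RHS]eq_bigr do rewrite gelt_prod gpair_gelt.
  under eq_bigr do rewrite gelt_prod gpair_gelt.
  have sz_rep (s : k.-tuple J) : size (flatten (nseq p (val s))) == m.
    by rewrite size_flatten /shape map_nseq sumn_nseq size_tuple mulnC -expnS.
  have sz_take (t : m.-tuple J) : size (take k t) == k.
    by rewrite size_takel ?size_tuple.
  rewrite (reindex_onto (fun s => Tuple (sz_rep s)) (fun t => Tuple (sz_take t))).
    apply: eq_big => [s|s _]; last by rewrite /= prod_flatten_nseq.
    apply/andP; split; apply/eqP; apply: val_inj; rewrite /= ?itr //=.
      by rewrite rot_flatten_nseq ?size_tuple.
    by rewrite -(prednK p_gt0) /= take_size_cat ?size_tuple.
  move=> t /eqP/(congr1 val); rewrite itr //= => rt; apply: val_inj => /=.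
  by rewrite -rot_periodic // size_tuple -expnS.
by apply: eq_bigr => t _; rewrite gelt_prod gpair_gelt.
Qed.

Lemma exprn_congr (R : pzRingType) (a b c : R) (q m : nat) :
  a = b + c *+ q -> exists d, a ^+ m = b ^+ m + d *+ q.
Proof.
move=> ->; elim: m => [|m [d IHm]]; first by exists 0; rewrite mul0rn addr0.
exists (b * d + c * b ^+ m + c * d *+ q); rewrite exprS IHm mulrDl mulrDr -exprS.
by rewrite mulrDr !mulrnAl !mulrnAr !mulrnDl !addrA.
Qed.

(** Changing w by multiples of p^(N+1) changes both terms by such multiples. So the coefficients of
    w may be reduced to non-negative residues, which makes w a sum of group elements. *)
Lemma necklace f N w : class_function f ->
  ((p ^ N.+1)%:Z %| gpair f (w ^+ (p ^ N.+1))
                    - gpair (fun g => f (g ^+ p)%g) (w ^+ (p ^ N)))%Z.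
Proof.
move=> fC; set q := (p ^ N.+1)%N.
have q_gt0 : (0 < q)%N by rewrite expn_gt0 prime_gt0.
pose c g := `|(w g %% q%:Z)%Z|%N.
pose w' : gring int gT := \sum_(j : {g : gT & 'I_(c g)}) gelt (tag j).
have [v def_w] : exists v, w = w' + v *+ q.
  exists (mkgring (fun g => (w g %/ q%:Z)%Z)).
  apply: gringP => g; rewrite gringDE gringMn mkgringE.
  rewrite [w g in LHS](divz_eq _ q%:Z) addrC -mulr_natr natz; congr (_ + _).
  have -> : w' = \sum_g \sum_(i < c g) gelt g by rewrite sig_big_dep.
  rewrite gring_sum /=.
  under eq_bigr do rewrite sumr_const gringMn card_ord mkgringE.
  rewrite (bigD1 g) //= eqxx big1 ?addr0 => [|h /negbTE]; last first.
    by rewrite eq_sym => ->; rewrite mul0rn.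
  by rewrite /c natz gez0_abs // modz_ge0 // eqz_nat -lt0n.
have [d1 ->] := exprn_congr q def_w.
have [d2 ->] := exprn_congr (p ^ N) def_w.
rewrite !raddfD /= 2!raddfMn /= addrACA -mulNrn -mulrnDl rpredD //.
  exact: necklace_sum.
by rewrite -mulr_natr natz dvdz_mull.
Qed.

End Necklace.

(** * Class sums of powers prime to the order *)

Section PowerMaps.
Variable gT : finGroupType.
Implicit Types (f : gT -> int) (u v w : gring int gT).

Lemma gpair_exp_prime_mod f w p : prime p -> class_function f ->
  (p%:Z %| gpair f (w ^+ p) - gpair (fun g => f (g ^+ p)%g) w)%Z.
Proof. by move=> p_pr fC; have := necklace p_pr 0 w fC; rewrite expn1 expr1. Qed.

(** For N a multiple of [totient n], u^(p^N) = u, so the necklace congruence holds modulo p^(N+1)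
    for one and the same difference d. Taking N at least |d| forces d = 0. *)
Lemma gpair_exp_prime f u n p : prime p -> class_function f ->
    (0 < n)%N -> coprime p n -> u ^+ n = 1 ->
  gpair f (u ^+ p) = gpair (fun g => f (g ^+ p)%g) u.
Proof.
move=> p_pr fC n_gt0 co_pn un1; apply/eqP; rewrite -subr_eq0.
set d := _ - _; pose N := (totient n * `|d|)%N.
have uN : u ^+ (p ^ N) = u.
  rewrite -(expr_mod _ un1) expnM -modnXm Euler_exp_totient // modnXm exp1n.
  by rewrite (expr_mod _ un1) expr1.
have := necklace p_pr N u fC; rewrite expnSr exprM uN -/d /dvdz /= -absz_eq0.
apply: contraTT; rewrite -lt0n => d_gt0; apply: contraTN isT => /dvdn_leq.
move/(_ d_gt0); rewrite leqNgt; case/negP.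
apply: leq_trans (ltn_expl _ (prime_gt1 p_pr)) _.
rewrite -expnSr leq_exp2l ?prime_gt1 // ltnW // ltnS leq_pmull //.
by rewrite totient_gt0.
Qed.

Lemma gpair_exp_coprime f u n t : class_function f ->
    (0 < n)%N -> (0 < t)%N -> coprime t n -> u ^+ n = 1 ->
  gpair f (u ^+ t) = gpair (fun g => f (g ^+ t)%g) u.
Proof.
elim: {t}_.+1 {-2}t (ltnSn t) => // m IHm t le_tm in f u *.
move=> fC n_gt0 t_gt0 co_tn un1.
have [t_le1|t_gt1] := leqP t 1.
  have -> : t = 1%N by apply/eqP; rewrite eqn_leq t_le1.
  by rewrite expr1; apply: eq_gpair => g; rewrite expg1.
have p_pr := pdiv_prime t_gt1; have p_dv := pdiv_dvd t.
move: co_tn; rewrite -(divnK p_dv); set s := (t %/ _)%N; set p := pdiv t.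
rewrite coprimeMl => /andP[co_sn co_pn].
have s_gt0 : (0 < s)%N by rewrite divn_gt0 ?pdiv_gt0 // pdiv_leq.
have lt_sm : (s < m)%N.
  by apply: (@leq_trans t) => //; rewrite ltn_Pdiv ?prime_gt1.
rewrite exprM (gpair_exp_prime p_pr fC n_gt0 co_pn); last first.
  by rewrite -exprM mulnC exprM un1 expr1n.
rewrite IHm //; last exact: class_function_expg.
by apply: eq_gpair => g; rewrite expgM.
Qed.

(** The inverse of u is u^t for t = n |G| - 1, which is prime to n and congruent to -1 modulo
    |G|. *)
Lemma gpair_inv f u v n : class_function f -> (0 < n)%N -> u ^+ n = 1 ->
  u * v = 1 -> gpair f v = gpair (fun g => f g^-1%g) u.
Proof.
move=> fC n_gt0 un1 uv1.
have c_gt0 : (0 < #|gT|)%N by apply/card_gt0P; exists 1%g.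
pose t := (n * #|gT|).-1.
have def_t : t.+1 = (n * #|gT|)%N by rewrite prednK // muln_gt0 n_gt0.
(* Here t would be 0, outside the reach of [gpair_exp_coprime]; the group is then trivial. *)
have [nG|nG] := leqP (n * #|gT|) 1.
  have /eqP: (n * #|gT| = 1)%N by apply/eqP; rewrite eqn_leq nG muln_gt0 n_gt0.
  rewrite muln_eq1 => /andP[/eqP n1 /eqP G1].
  have u1 : u = 1 by rewrite -un1 n1.
  have -> : v = u by rewrite -(mul1r v) -u1 uv1.
  apply: eq_gpair => g; congr f; have /fintype_le1P H : (#|gT| <= 1)%N by rewrite G1.
  exact: H.
have t_gt0 : (0 < t)%N by rewrite -ltnS def_t.
have co : coprime t n.
  have: coprime t t.+1 by rewrite coprimenS.
  by rewrite def_t coprimeMr => /andP[].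
have -> : v = u ^+ t.
  rewrite -[LHS]mul1r -(expr1n _ #|gT|) -un1 -exprM -def_t exprSr -mulrA uv1.
  by rewrite mulr1.
rewrite (gpair_exp_coprime fC n_gt0 t_gt0 co un1); apply: eq_gpair => g.
congr f; apply/eqP; rewrite eq_sym eq_mulVg1 invgK -expgS def_t mulnC expgM.
by rewrite -cardsT expg_cardG ?inE // expg1n.
Qed.

End PowerMaps.

(** * Traces of matrices of finite order *)

Lemma finite_order_diagonalizable n N (A : 'M[algC]_N) :
  (0 < n)%N -> A ^+ n = 1 ->
  exists P (d : 'rV[algC]_N), [/\ P \in unitmx,
    P *m A = diag_mx d *m P & forall i, d 0 i ^+ n = 1].
Proof.
case: N A => [|N] A n_gt0 An1.
  by exists 1%:M, 0; split; rewrite ?unitmx1 ?[LHS]flatmx0 ?[RHS]flatmx0 // => -[].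
have [z prim_z] := C_prim_root_exists n_gt0.
have /diagonalizableP[P Pu /diagonalizable_forPex[d /(simmxP Pu) PA]] :
    exists2 rs, uniq rs & mxminpoly A %| \prod_(x <- rs) ('X - x%:P).
  exists [seq z ^+ i | i <- index_iota 0 n].
    rewrite map_inj_in_uniq ?iota_uniq // => i j.
    rewrite !mem_index_iota /= => lt_in lt_jn /eqP.
    by rewrite (eq_prim_root_expr prim_z) !modn_small // => /eqP.
  rewrite big_map factor_Xn_sub_1 // mxminpoly_min // rmorphB rmorph1 rmorphXn /=.
  by rewrite horner_mx_X An1 subrr.
exists P, d; split=> // i.
have PAk k : P *m A ^+ k = diag_mx (\row_j d 0 j ^+ k) *m P.
  elim: k => [|k IHk].
    rewrite expr0 mulmx1 -[LHS]mul1mx; congr (_ *m _); apply/matrixP=> a b.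
    by rewrite !mxE expr0.
  rewrite exprS mulmxA PA -mulmxA IHk mulmxA mulmx_diag; congr (diag_mx _ *m _).
  by apply/rowP=> j; rewrite !mxE exprS.
have /(congr1 (mulmx^~ (invmx P))) := PAk n.
rewrite An1 mulmx1 mulmxK // mulmxV // => /matrixP/(_ i i).
by rewrite !mxE eqxx !mulr1n => <-.
Qed.

Lemma unity_normC (n : nat) (x : algC) : (0 < n)%N -> x ^+ n = 1 -> `|x| = 1.
Proof.
move=> n_gt0 xn1; apply/eqP; rewrite -(@pexpr_eq1 _ _ n) //.
by rewrite -normrX xn1 normr1.
Qed.

Lemma mxtrace_finite_order N (A : 'M[algC]_N) P (d : 'rV[algC]_N) :
  P \in unitmx -> P *m A = diag_mx d *m P -> \tr A = \sum_i d 0 i.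
Proof.
move=> Pu PA; have -> : A = invmx P *m (diag_mx d *m P) by rewrite -PA mulKmx.
by rewrite mxtrace_mulC mulmxK // mxtrace_diag.
Qed.

Lemma norm_mxtrace_finite_order n N (A : 'M[algC]_N) :
  (0 < n)%N -> A ^+ n = 1 -> `|\tr A| <= N%:R.
Proof.
move=> n_gt0 An1; have [P [d [Pu PA d1]]] := finite_order_diagonalizable n_gt0 An1.
rewrite (mxtrace_finite_order Pu PA); apply: le_trans (ler_norm_sum _ _ _) _.
rewrite (eq_bigr (fun=> 1)) => [|i _]; last exact: unity_normC (d1 i).
by rewrite sumr_const card_ord.
Qed.

(** Equality in the triangle inequality for N roots of unity makes each of them 1. *)
Lemma mxtrace_finite_order_eq n N (A : 'M[algC]_N) :
  (0 < n)%N -> A ^+ n = 1 -> \tr A = N%:R -> A = 1.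
Proof.
move=> n_gt0 An1; have [P [d [Pu PA d1]]] := finite_order_diagonalizable n_gt0 An1.
rewrite (mxtrace_finite_order Pu PA) => trA.
have d_le i : predT i -> `|d 0 i| <= 1 by rewrite (unity_normC n_gt0 (d1 i)).
have dE i : d 0 i = 1.
  apply: (normC_sum_upper d_le) => //.
  by rewrite trA sumr_const card_ord.
rewrite -[A](mulKmx Pu) PA; have -> : d = const_mx 1.
  by apply/rowP=> i; rewrite mxE.
by rewrite diag_const_mx mul1mx mulVmx.
Qed.

(** * Two-sided multiplication on the group ring *)

Section TwoSided.
Variables (R : comUnitRingType) (gT : finGroupType).
Implicit Types (a b u v : gring R gT).

(** The matrix of m |-> a m b on row vectors; hence the order of the left factors in [bimxM]. *)
Definition bimx a b : 'M[R]_#|gT| :=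
  \matrix_(i, j) (a * gelt (enum_val i) * b) (enum_val j).

Lemma gvec_bimx a b w : gvec w *m bimx a b = gvec (a * w * b).
Proof.
apply/rowP=> j; rewrite !mxE.
have wE : w = \sum_x mkgring (fun g => w x * (gelt x : gring R gT) g).
  apply: gringP => g; rewrite gring_sum (bigD1 g) //= !mkgringE eqxx mulr1.
  by rewrite big1 ?addr0 // => x /negbTE xg; rewrite !mkgringE eq_sym xg mulr0.
rewrite {2}wE mulr_sumr mulr_suml gring_sum.
rewrite [RHS](reindex_onto _ _ (in1W enum_rankK)) /=.
rewrite [RHS](eq_bigl xpredT) => [|i]; last by rewrite enum_valK eqxx.
apply: eq_bigr => i _; rewrite !mxE !gringME mulr_sumr; apply: eq_bigr => h _.
rewrite mulrA; congr (_ * _); rewrite !gringME mulr_sumr; apply: eq_bigr => k _.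
by rewrite !mkgringE mulrCA.
Qed.

Lemma bimxM a b c d : bimx a b *m bimx c d = bimx (c * a) (b * d).
Proof.
apply/row_matrixP=> i; rewrite !rowE mulmxA -[delta_mx 0 i]gunvecK !gvec_bimx.
by rewrite !mulrA.
Qed.

Lemma bimx1 : bimx 1 1 = 1%:M.
Proof.
apply/row_matrixP=> i; rewrite !rowE -[delta_mx 0 i]gunvecK !gvec_bimx.
by rewrite mul1r mulr1 gunvecK mulmx1.
Qed.

Lemma bimxX a b n : bimx a b ^+ n = bimx (a ^+ n) (b ^+ n).
Proof.
elim: n => [|n IHn]; first by rewrite !expr0 bimx1.
by rewrite exprS IHn [LHS]bimxM exprSr (exprS b).
Qed.

Lemma mxtrace_bimx a b :
  \tr (bimx a b) = \sum_x \sum_y a x * b y * #|[set g | (x * g * y == g)%g]|%:R.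
Proof.
rewrite /mxtrace; under eq_bigr do rewrite mxE.
transitivity (\sum_g (a * gelt g * b) g).
  rewrite [RHS](reindex_onto _ _ (in1W enum_rankK)) /=.
  by apply: eq_bigl => i; rewrite enum_valK eqxx.
pose F g x y : R := a x * b y * ((x * g * y)%g == g)%:R.
transitivity (\sum_g \sum_x \sum_y F g x y).
  apply: eq_bigr => g _; rewrite -mulrA gringME; apply: eq_bigr => x _.
  rewrite gringME mulr_sumr (bigD1 g) //= big1 ?addr0 => [|h /negbTE hg]; last first.
    by rewrite mkgringE hg mul0r mulr0.
  rewrite mkgringE eqxx mul1r (bigD1 (g^-1 * (x^-1 * g))%g) //= /F.
  have eq_y y : ((x * g * y)%g == g) = (y == (g^-1 * (x^-1 * g))%g).
    by rewrite -[RHS](inj_eq (mulgI (x * g)%g)) -(mulgA x g (_ * _)%g) !mulKVg.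
  by rewrite eq_y eqxx mulr1 big1 ?addr0 // => y /negbTE; rewrite eq_y => ->; rewrite mulr0.
rewrite exchange_big; apply: eq_bigr => x _; rewrite exchange_big /=.
apply: eq_bigr => y _; rewrite -mulr_sumr -natr_sum -sum1dep_card; congr (_ * _%:R).
by rewrite [RHS]big_mkcond; apply: eq_bigr => g _ /=; case: eqP.
Qed.

End TwoSided.

Lemma map_bimx (R S : comUnitRingType) (f : {rmorphism R -> S}) (gT : finGroupType)
    (a b : gring R gT) (a' b' : gring S gT) :
    (forall g, a' g = f (a g)) -> (forall g, b' g = f (b g)) ->
  map_mx f (bimx a b) = bimx a' b'.
Proof.
move=> ea eb; apply/matrixP=> i j; rewrite !mxE !gringME rmorph_sum /=.
apply: eq_bigr => x _; rewrite rmorphM eb !gringME rmorph_sum /=.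
congr (_ * _); apply: eq_bigr => y _; rewrite rmorphM ea !mkgringE.
by rewrite rmorph_nat.
Qed.

(** The element acts as A on the image of E and as the identity on the complement. *)
Lemma idempotent_finite_order (R : pzRingType) (E A : R) n :
    E * E = E -> A * E = E * A -> A ^+ n = 1 ->
  (E * A + (1 - E)) ^+ n = 1.
Proof.
move=> EE AE An1; suff Bk k : (E * A + (1 - E)) ^+ k = E * A ^+ k + (1 - E).
  by rewrite Bk An1 mulr1 addrC subrK.
have E1 : E * (1 - E) = 0 by rewrite mulrBr mulr1 EE subrr.
have E2 : (1 - E) * E = 0 by rewrite mulrBl mul1r EE subrr.
elim: k => [|k IHk]; first by rewrite !expr0 mulr1 addrC subrK.
have AkE : A ^+ k * E = E * A ^+ k.
  by elim: (k) => [|j IHj]; rewrite ?mulr1 ?mul1r // exprS -mulrA IHj !mulrA AE.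
set F := 1 - E in E1 E2 IHk *.
have FF : F * F = F by rewrite /F mulrBl mul1r E1 subr0.
clearbody F.
have t1 : E * A ^+ k * (E * A) = E * A ^+ k.+1.
  by rewrite -AkE -!mulrA [E * (E * A)]mulrA EE mulrA AkE -mulrA -exprSr.
have t2 : E * A ^+ k * F = 0 by rewrite -AkE -mulrA E1 mulr0.
by rewrite exprSr IHk mulrDl !mulrDr t1 t2 mulrA E2 mul0r FF addr0 add0r.
Qed.

Lemma scale_mulmxl (R : comPzRingType) N (a : R) (X Y : 'M[R]_N) :
  (a *: X) * Y = a *: (X * Y).
Proof. exact/esym/scalemxAl. Qed.

Lemma scale_mulmxr (R : comPzRingType) N (a : R) (X Y : 'M[R]_N) :
  X * (a *: Y) = a *: (X * Y).
Proof. exact/esym/scalemxAr. Qed.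

(* The trace bound for E A + (1 - E), with E = (1 + Z) / 2 the projection on the  *)
(* fixed space of Z.                                                             *)
Lemma mxtrace_twisted_finite_order n N (A Z : 'M[algC]_N) :
    (0 < n)%N -> A ^+ n = 1 -> A * Z = Z * A -> Z * Z = 1 ->
    \tr A + \tr (Z * A) - \tr Z \is Num.real ->
  \tr A + \tr (Z * A) - \tr Z <= N%:R.
Proof.
move=> n_gt0 An1 AZ ZZ trR; pose E := 2^-1 *: (1 + Z).
have c2 : (2 : algC) != 0 by rewrite pnatr_eq0.
have EE : E * E = E.
  rewrite /E scale_mulmxl scale_mulmxr mulrDl mulrDr mulr1 mul1r mulrDr mulr1 ZZ.
  rewrite [Z + 1]addrC -mulr2n -scaler_nat !scalerA -mulrA.
  by rewrite mulVf ?mulr1.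
have AE : A * E = E * A.
  by rewrite /E scale_mulmxr scale_mulmxl mulrDr mulrDl mulr1 mul1r AZ.
have := norm_mxtrace_finite_order n_gt0 (idempotent_finite_order EE AE An1).
have -> : \tr (E * A + (1 - E)) = 2^-1 * (\tr A + \tr (Z * A) - \tr Z + N%:R).
  rewrite mxtraceD linearB /= mxtrace1 /E scale_mulmxl !mxtraceZ mulrDl mul1r.
  by rewrite !mxtraceD mxtrace1; field.
rewrite normrM ger0_norm ?invr_ge0 ?ler0n // ler_pdivrMl ?ltr0n // => le_tr.
have: \tr A + \tr (Z * A) - \tr Z + N%:R <= 2 * N%:R.
  by apply: le_trans le_tr; rewrite real_ler_norm // rpredD // realn.
by rewrite mulr_natl mulr2n lerD2r.
Qed.

Lemma gelt_mulE (R : nzRingType) (gT : finGroupType) (a : gT) (u : gring R gT) g :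
  (gelt a * u) g = u (a^-1 * g)%g.
Proof.
rewrite gringME (bigD1 a) //= mkgringE eqxx mul1r big1 ?addr0 // => h /negbTE ha.
by rewrite mkgringE ha mul0r.
Qed.

Lemma mul_geltE (R : nzRingType) (gT : finGroupType) (a : gT) (u : gring R gT) g :
  (u * gelt a) g = u (g * a^-1)%g.
Proof.
rewrite gringME (bigD1 (g * a^-1)%g) //= mkgringE invMg invgK mulgKV eqxx mulr1.
rewrite big1 ?addr0 // => h /negbTE ha; rewrite mkgringE.
by rewrite -(inj_eq (mulgI h)) mulKVg eq_sym (canF_eq (mulgK a)) ha mulr0.
Qed.

Lemma gelt_central (R : nzRingType) (gT : finGroupType) (a : gT) (u : gring R gT) :
  (forall g, (a * g = g * a)%g) -> gelt a * u = u * gelt a.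
Proof.
move=> aC; apply: gringP => g; rewrite gelt_mulE mul_geltE; congr (u _).
by apply: (mulgI a); rewrite mulKVg aC mulgKV.
Qed.

Section ConjugationTrace.
Variables (gT : finGroupType) (z : gT).
Hypotheses (z_central : forall g, (z * g = g * z)%g) (z_ord : (z * z = 1)%g) (z1 : z != 1%g).
Implicit Types (u v w : gring int gT).

(** The trace is a class function of v, so [gpair_inv] trades the coefficients of the inverse v for
    those of u. *)
Lemma mxtrace_bimx_inv u v w n : (0 < n)%N -> u ^+ n = 1 -> u * v = 1 ->
  \tr (bimx w v) = \sum_x w x * \sum_g u (x ^ g)%g.
Proof.
move=> n_gt0 un1 uv1; rewrite mxtrace_bimx; apply: eq_bigr => x _.
pose f y : int := #|[set g | (x * g * y == g)%g]|%:R.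
have fC : class_function f.
  move=> y1 y2; rewrite /f; congr (_%:R).
  rewrite -(card_imset _ (mulIg y1)); apply: eq_card => g; rewrite !inE.
  apply/imsetP/eqP => [[h]|eg].
    by rewrite inE => /eqP eh ->; rewrite -[in RHS]eh !mulgA.
  exists (g * y1^-1)%g; rewrite ?mulgKV // inE mulgA mulgA mulgKV.
  by rewrite -{2}eg !mulgA mulgK.
transitivity (w x * gpair f v).
  by rewrite mulr_sumr; apply: eq_bigr => y _; rewrite mulrA.
rewrite (gpair_inv fC n_gt0 un1 uv1); congr (_ * _).
transitivity (\sum_y \sum_g u y * (x ^ g == y)%g%:R).
  apply: eq_bigr => y _; rewrite -mulr_sumr /f -natr_sum -sum1dep_card; congr (_ * _%:R).
  rewrite big_mkcond; apply: eq_bigr => g _ /=.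
  have -> : (x ^ g == y)%g = (x * g * y^-1 == g)%g.
    by rewrite conjgE -(inj_eq (mulgI g)) mulKVg -[RHS](inj_eq (mulIg y)) mulgKV.
  by case: eqP.
rewrite exchange_big; apply: eq_bigr => g _; rewrite (bigD1 (x ^ g)%g) //= eqxx mulr1.
by rewrite big1 ?addr0 // => y /negbTE; rewrite eq_sym => ->; rewrite mulr0.
Qed.

(** [mxtrace_twisted_finite_order] is applied to conjugation by u and to s times multiplication by
    z. The sign s selects the eigenspace of z on which the trace is bounded. *)
Lemma conjugation_trace_bound (s : int) u v n :
    s * s = 1 -> (0 < n)%N -> u ^+ n = 1 -> u * v = 1 -> v * u = 1 ->
  \sum_x u x * (\sum_g u (x ^ g)%g) + s * (\sum_x u x * (\sum_g u ((z * x) ^ g)%g))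
    <= #|gT|%:R.
Proof.
move=> ss n_gt0 un1 uv1 vu1.
have vn1 : v ^+ n = 1.
  by rewrite -[LHS]mul1r -un1 -exprMn_comm ?uv1 ?expr1n // /GRing.comm uv1 vu1.
pose A := bimx u v; pose Z := s *: bimx (gelt z : gring int gT) 1.
have AZ : A * Z = Z * A.
  rewrite /A /Z scale_mulmxr scale_mulmxl; congr (_ *: _); rewrite [LHS]bimxM [RHS]bimxM.
  by rewrite mul1r mulr1 gelt_central.
have ZZ : Z * Z = 1.
  rewrite /Z scale_mulmxr scale_mulmxl scalerA ss scale1r [LHS]bimxM -geltM z_ord mulr1.
  by rewrite gelt1 bimx1.
have An1 : A ^+ n = 1 by rewrite bimxX un1 vn1 bimx1.
(* Multiplication by z fixes no group element. *)
have trZ : \tr Z = 0.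
  rewrite /Z mxtraceZ mxtrace_bimx (bigD1 z) //= [X in X + _]big1 => [|y _].
    rewrite add0r big1 ?mulr0 // => x /negbTE xz.
    by rewrite big1 // => y _; rewrite mkgringE xz !mul0r.
  rewrite gring1E; have [->|] := eqVneq y 1%g; last by rewrite mulr0 mul0r.
  rewrite eq_card0 ?mulr0 // => g; rewrite !inE mulg1; apply: contraNF z1.
  by rewrite -{2}(mul1g g) => /eqP/mulIg ->.
pose phi := map_mx (intr : int -> algC).
have phiM m (X Y : 'M[int]_m) : phi _ _ (X * Y) = phi _ _ X * phi _ _ Y.
  exact: map_mxM.
have phi1 m : phi m m 1 = 1 by exact: map_mx1.
have phiX m (X : 'M[int]_m) k : phi _ _ (X ^+ k) = phi _ _ X ^+ k.
  by elim: k => [|k IHk]; rewrite ?phi1 // !exprS phiM IHk.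
have phitr m (X : 'M[int]_m) : \tr (phi _ _ X) = (\tr X)%:~R by rewrite trace_map_mx.
have := @mxtrace_twisted_finite_order n _ (phi _ _ A) (phi _ _ Z).
rewrite -phiX An1 phi1 -!phiM AZ ZZ phi1 !phitr trZ subr0 -rmorphD /=.
move/(_ n_gt0 erefl erefl erefl (rpred_int _ _)).
rewrite [leRHS]pmulrn ler_int natz; congr (is_true (_ <= _)).
rewrite (mxtrace_bimx_inv u n_gt0 un1 uv1); congr (_ + _).
rewrite /Z scale_mulmxl mxtraceZ; congr (_ * _).
have -> : bimx (gelt z) 1 * A = bimx (u * gelt z) v by rewrite [LHS]bimxM mul1r.
rewrite (mxtrace_bimx_inv _ n_gt0 un1 uv1) (reindex_inj (mulgI z)) /=.
by apply: eq_bigr => x _; rewrite mul_geltE z_central mulgK.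
Qed.
End ConjugationTrace.

(** The Berman-Higman argument: multiplication by w has trace |G| times the coefficient at 1, here
    the full dimension. *)
Lemma gring_finite_order_eq1 (gT : finGroupType) (w : gring int gT) n :
  (0 < n)%N -> w ^+ n = 1 -> w 1%g = 1 -> w = 1.
Proof.
move=> n_gt0 wn1 w1; pose A := bimx w 1.
have trA : \tr A = #|gT|%:R.
  rewrite /mxtrace (eq_bigr (fun=> 1)) ?sumr_const ?card_ord // => i _.
  by rewrite mxE mulr1 mul_geltE mulgV.
have An1 : A ^+ n = 1 by rewrite bimxX wn1 expr1n bimx1.
pose phi m := map_mx (intr : int -> algC) : 'M_m -> 'M_m.
have phiX m (X : 'M[int]_m) k : phi _ (X ^+ k) = phi _ X ^+ k.
  elim: k => [|k IHk]; first exact: map_mx1.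
  by rewrite !exprS -IHk; apply: map_mxM.
have /= := @mxtrace_finite_order_eq n _ (phi _ A) n_gt0.
rewrite -phiX An1 trace_map_mx trA rmorph_nat => /(_ (map_mx1 _ _) erefl) /matrixP A1.
have {}A1 : A = 1%:M.
  by apply/matrixP=> i j; have := A1 i j; rewrite !mxE [RHS]pmulrn => /intr_inj ->; rewrite natz.
have := gvec_bimx w 1 (1 : gring int gT); rewrite -/A A1 mulmx1 !mulr1.
by move/(can_inj (@gvecK _ _)).
Qed.

(** * Units of order four *)

Lemma mxtrace_idempotent (F : fieldType) N (E : 'M[F]_N) :
  E *m E = E -> \tr E = (\rank E)%:R.
Proof.
move=> EE; rewrite -{1}(mulmx_base E) mxtrace_mulC.
suff -> : row_base E *m col_base E = 1%:M by rewrite mxtrace1.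
have /row_fullP[B BC] := col_base_full E; have /row_freeP[D RD] := row_base_free E.
move: (col_base E) (row_base E) (mulmx_base E) BC RD => C R CR BC RD.
have : B *m (C *m R *m (C *m R)) *m D = B *m (C *m R) *m D by rewrite CR EE.
rewrite -!mulmxA RD mulmx1 [B *m (_ *m (_ *m _))]mulmxA BC.
by rewrite mul1mx.
Qed.

Lemma interleave (V : nmodType) (a b c d a' b' c' d' : V) :
  a + b + c + d + (a' + b' + c' + d') = a' + a + b' + b + c' + c + d' + d.
Proof. by rewrite (AC (4*4) (5*1*6*2*7*3*8*4)). Qed.

Section RankModTwo.

Local Notation mod2 X := (map_mx (intr : int -> 'F_2) X).
Local Notation toQ X := (map_mx (intr : int -> rat) X).

(** One-sided inverses of the factors of a rank factorization modulo 2 lift to integer matrices;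
    they cut X down to an r by r matrix of odd determinant, invertible over Q. *)
Lemma mxrank_mod2_le m n (X : 'M[int]_(m, n)) :
  (\rank (mod2 X) <= \rank (toQ X))%N.
Proof.
set r := \rank _.
have /row_fullP[B BC] := col_base_full (mod2 X).
have /row_freeP[D RD] := row_base_free (mod2 X).
pose lift m' n' (Y : 'M['F_2]_(m', n')) : 'M[int]_(m', n') := \matrix_(i, j) (Y i j : nat)%:Z.
have liftK m' n' (Y : 'M['F_2]_(m', n')) : mod2 (lift _ _ Y) = Y.
  by apply/matrixP=> i j; rewrite !mxE -pmulrn natr_Zp.
pose Y := lift _ _ B *m X *m lift _ _ D.
have Y1 : mod2 Y = 1%:M.
  rewrite /Y !map_mxM !liftK.
  move: (col_base _) (row_base _) (mulmx_base (mod2 X)) BC RD => C R CR BC RD.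
  rewrite -[X in B *m X]CR; rewrite -!mulmxA RD mulmx1.
  exact: BC.
have detY : \det Y != 0.
  apply: contraTneq (oner_neq0 'F_2) => detY0; apply/negPn/eqP.
  by rewrite -(det1 _ r) -Y1 det_map_mx detY0 rmorph0.
have Yu : toQ Y \in unitmx by rewrite unitmxE det_map_mx unitfE intr_eq0.
rewrite -[r](mxrank_unit Yu) /Y !map_mxM.
by apply: leq_trans (mxrankM_maxl _ _) (mxrankM_maxr _ _).
Qed.

(** By Frobenius' inequality the ranks of the powers of D form a convex sequence. Its values 8m, 4m,
    0 at 0, 4, 8 lie on a line, so the sequence is linear. *)
Lemma mxrank_power_chain (F : fieldType) N m (D : 'M[F]_N) :
    N = (8 * m)%N -> D ^+ 8 = 0 -> \rank (D ^+ 4) = (4 * m)%N ->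
  \rank (D ^+ 7) = m /\ \rank (D ^+ 6) = (2 * m)%N.
Proof.
move=> defN D8 r4.
pose r i := \rank (D ^+ i).
have frob i : (2 * r i.+1 <= r i + r i.+2)%N.
  have : (\rank (D * D ^+ i)%R + \rank (D ^+ i * D)%R <=
          \rank (D ^+ i) + \rank (D * D ^+ i * D)%R)%N := mxrank_Frobenius D (D ^+ i) D.
  by rewrite -exprS -!exprSr mul2n -addnn.
have r0 : r 0%N = (8 * m)%N by rewrite /r expr0 mxrank1.
have r8 : r 8%N = 0%N by rewrite /r D8 mxrank0.
rewrite -/(r 4%N) in r4; rewrite -/(r 7%N) -/(r 6%N); clearbody r.
move: (frob 0%N) (frob 1%N) (frob 2%N) (frob 3%N) (frob 4%N) (frob 5%N) (frob 6%N).
by rewrite r0 r4 r8; lia.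
Qed.

Section OrderEight.
Variables (R : pzRingType) (S : R).
Hypothesis S8 : S ^+ 8 = 1.
(** For a matrix S over a field of characteristic 0, these are 8, 8, 4 and 2 times the projections
    onto the kernels of S - 1, S + 1, S^2 + 1 and S^4 + 1. *)
Let e1 := 1 + S + S ^+ 2 + S ^+ 3 + S ^+ 4 + S ^+ 5 + S ^+ 6 + S ^+ 7.
Let e2 := 1 - S + S ^+ 2 - S ^+ 3 + S ^+ 4 - S ^+ 5 + S ^+ 6 - S ^+ 7.
Let e3 := 1 - S ^+ 2 + S ^+ 4 - S ^+ 6.
Let e4 := 1 - S ^+ 4.

Lemma order8_e1 : e1 * e1 = e1 *+ 8.
Proof.
have Se : S * e1 = e1.
  rewrite /e1 !mulrDr -!exprS S8 mulr1 -expr2; set a := _ + S ^+ 7.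
  by rewrite addrC !addrA.
have Ste t : S ^+ t * e1 = e1.
  by elim: t => [|t IHt]; rewrite ?mul1r // exprSr -mulrA Se.
by rewrite {1}/e1 !mulrDl !Ste mul1r Se !mulrS mulr0n addr0 !addrA.
Qed.

Lemma order8_e2 : e2 * e2 = e2 *+ 8.
Proof.
have Se : S * e2 = - e2.
  rewrite /e2 !mulrDr !mulrN -!exprS S8 mulr1 -expr2 !opprD !opprK.
  by rewrite addrC !addrA.
have key E : S * E = - E -> e2 * E = E *+ 8.
  move=> SE; have S2 : S ^+ 2 * E = E by rewrite expr2 -mulrA SE mulrN SE opprK.
  have S3 : S ^+ 3 * E = - E by rewrite exprS -mulrA S2 SE.
  have S4 : S ^+ 4 * E = E by rewrite exprS -mulrA S3 mulrN SE opprK.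
  have S5 : S ^+ 5 * E = - E by rewrite exprS -mulrA S4 SE.
  have S6 : S ^+ 6 * E = E by rewrite exprS -mulrA S5 mulrN SE opprK.
  have S7 : S ^+ 7 * E = - E by rewrite exprS -mulrA S6 SE.
  rewrite /e2 !mulrDl !mulNr mul1r SE S2 S3 S4 S5 S6 S7 !opprK.
  by rewrite !mulrS mulr0n addr0 !addrA.
exact: key.
Qed.

Lemma order8_e3 : e3 * e3 = e3 *+ 4.
Proof.
have Se : S ^+ 2 * e3 = - e3.
  rewrite /e3 !mulrDr !mulrN -!exprD S8 mulr1 !opprD !opprK.
  by rewrite addrC !addrA.
have Se4 : S ^+ 4 * e3 = e3 by rewrite (exprD S 2 2) -mulrA Se mulrN Se opprK.
have Se6 : S ^+ 6 * e3 = - e3 by rewrite (exprD S 4 2) -mulrA Se mulrN Se4.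
by rewrite {1}/e3 !mulrDl !mulNr mul1r Se Se4 Se6 !opprK !mulrS mulr0n addr0 !addrA.
Qed.

Lemma order8_e4 : e4 * e4 = e4 *+ 2.
Proof.
by rewrite /e4 mulrBl mul1r mulrBr mulr1 -exprD S8 opprB mulr2n.
Qed.

End OrderEight.

Lemma mxtrace_scaled_idempotent N k (e : 'M[int]_N) :
  e * e = e *+ k.+1 -> \tr e = (\rank (toQ e))%:Z * k.+1%:Z.
Proof.
move=> ee; pose E := k.+1%:R^-1 *: toQ e.
have k0 : k.+1%:R != 0 :> rat by rewrite pnatr_eq0.
have EE : E *m E = E.
  rewrite /E -scalemxAl -scalemxAr scalerA -map_mxM -[e *m e]/(e * e) ee raddfMn /=.
  by rewrite -scaler_nat scalerA -mulrA mulVf ?mulr1.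
have := mxtrace_idempotent EE; rewrite mxtraceZ mxrank_scale_nz ?invr_eq0 //.
move/(congr1 ( *%R k.+1%:R)); rewrite mulrA mulfV // mul1r trace_map_mx => trE.
apply: (@intr_inj rat); by rewrite trE mulrC rmorphM.
Qed.

(** The trace equations give r1 + r2 + r3 + r4 = 8m, so all lower bounds are attained; the odd
    traces add up to 4 (r1 - r2) = 0. *)
Lemma odd_trace_arith (m r1 r2 r3 r4 : nat) (t0 t1 t2 t3 t4 t5 t6 t7 : int) :
    t0 = 8 * m%:Z ->
    (m <= r1)%N -> (m <= r2)%N -> (2 * m <= r3)%N -> (4 * m <= r4)%N ->
    t0 - t4 = r4%:Z * 2%:Z -> t0 - t2 + t4 - t6 = r3%:Z * 4%:Z ->
    t0 - t1 + t2 - t3 + t4 - t5 + t6 - t7 = r2%:Z * 8%:Z ->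
    t0 + t1 + t2 + t3 + t4 + t5 + t6 + t7 = r1%:Z * 8%:Z ->
  t1 + t3 + t5 + t7 = 0.
Proof. lia. Qed.

(* Modulo 2, D = S + 1 is nilpotent and e1, e2 reduce to D^7, e3 to D^6, e4 to  *)
(* D^4.  The ranks of these powers of D are lower bounds for the ranks of        *)
(* e1, ..., e4, which count the eigenvalues of S of order 1, 2, 4 and 8; the     *)
(* bounds add up to N, so they are attained.                                     *)
Lemma mxtrace_odd_powers N m (S : 'M[int]_N) :
    N = (8 * m)%N -> S ^+ 8 = 1 -> \rank (mod2 (S ^+ 4 - 1)) = (4 * m)%N ->
  \tr S + \tr (S ^+ 3) + \tr (S ^+ 5) + \tr (S ^+ 7) = 0.
Proof.
move=> defN S8 rS4; pose T := mod2 S; pose D := T + 1.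
have modX k : mod2 (S ^+ k) = T ^+ k.
  elim: k => [|k IHk]; first exact: map_mx1.
  by rewrite !exprS -IHk; apply: map_mxM.
have mod1 : mod2 1 = 1 :> 'M_N by exact: map_mx1.
have N2 (X : 'M['F_2]_N) : - X = X.
  apply/matrixP=> i j; rewrite !mxE; apply/eqP; rewrite eq_sym -addr_eq0 -mulr2n.
  by rewrite -mulr_natr pchar_Zp // mulr0.
have XX (X : 'M['F_2]_N) : X + X = 0 by rewrite -[X in X + _]N2 addNr.
have D2 : D ^+ 2 = T ^+ 2 + 1.
  rewrite !expr2 mulrDl !mulrDr !mulr1 mul1r addrA -(addrA _ T T).
  by rewrite -[X in _ + (X + T)]N2 addNr addr0.
have D4 : D ^+ 4 = T ^+ 4 + 1.
  rewrite (exprM D 2 2) D2 expr2 mulrDl !mulrDr !mulr1 mul1r -exprD.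
  by rewrite -addrA [T ^+ 2 + (_ + _)]addrA XX add0r.
have D6 : D ^+ 6 = 1 + T ^+ 2 + T ^+ 4 + T ^+ 6.
  rewrite (exprD D 2 4) D2 D4 mulrDl !mulrDr !mulr1 mul1r -exprD.
  by rewrite (AC (2*2) (4*2*3*1)).
have D7 : D ^+ 7 = 1 + T + T ^+ 2 + T ^+ 3 + T ^+ 4 + T ^+ 5 + T ^+ 6 + T ^+ 7.
  rewrite exprS D6 /D mulrDl mul1r !mulrDr mulr1 -!exprS.
  exact: interleave.
have D8 : D ^+ 8 = 0.
  rewrite (exprD D 4 4) D4 mulrDl !mulrDr !mulr1 mul1r -exprD -modX S8 mod1.
  by rewrite -addrA [T ^+ 4 + (_ + _)]addrA XX add0r XX.
have rD4 : \rank (D ^+ 4) = (4 * m)%N by rewrite D4 -rS4 raddfB /= modX mod1 -[X in _ + X]N2.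
have [rD7 rD6] := mxrank_power_chain defN D8 rD4.
pose e1 := 1 + S + S ^+ 2 + S ^+ 3 + S ^+ 4 + S ^+ 5 + S ^+ 6 + S ^+ 7.
pose e2 := 1 - S + S ^+ 2 - S ^+ 3 + S ^+ 4 - S ^+ 5 + S ^+ 6 - S ^+ 7.
pose e3 := 1 - S ^+ 2 + S ^+ 4 - S ^+ 6.
pose e4 := 1 - S ^+ 4.
have mod8 (P : nat -> 'M[int]_N) (Q : nat -> 'M['F_2]_N) : (forall k, mod2 (P k) = Q k) ->
    mod2 (P 0%N + P 1%N + P 2%N + P 3%N + P 4%N + P 5%N + P 6%N + P 7%N) =
    Q 0%N + Q 1%N + Q 2%N + Q 3%N + Q 4%N + Q 5%N + Q 6%N + Q 7%N.
  by move=> PQ; rewrite !raddfD /= !PQ.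
have mod8N (P : nat -> 'M[int]_N) (Q : nat -> 'M['F_2]_N) : (forall k, mod2 (P k) = Q k) ->
    mod2 (P 0%N - P 1%N + P 2%N - P 3%N + P 4%N - P 5%N + P 6%N - P 7%N) =
    Q 0%N + Q 1%N + Q 2%N + Q 3%N + Q 4%N + Q 5%N + Q 6%N + Q 7%N.
  by move=> PQ; rewrite !(raddfB, raddfD) /= !PQ !N2.
have mod4N (P : nat -> 'M[int]_N) (Q : nat -> 'M['F_2]_N) : (forall k, mod2 (P k) = Q k) ->
    mod2 (P 0%N - P 2%N + P 4%N - P 6%N) = Q 0%N + Q 2%N + Q 4%N + Q 6%N.
  by move=> PQ; rewrite !(raddfB, raddfD) /= !PQ !N2.
have mod_e1 : mod2 e1 = D ^+ 7.
  exact: etrans (mod8 (fun k => S ^+ k) (fun k => T ^+ k) modX) (esym D7).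
have mod_e2 : mod2 e2 = D ^+ 7.
  exact: etrans (mod8N (fun k => S ^+ k) (fun k => T ^+ k) modX) (esym D7).
have mod_e3 : mod2 e3 = D ^+ 6.
  exact: etrans (mod4N (fun k => S ^+ k) (fun k => T ^+ k) modX) (esym D6).
have mod_e4 : mod2 e4 = D ^+ 4 by rewrite D4 /e4 raddfB /= modX mod1 N2 addrC.
have r1 : (m <= \rank (toQ e1))%N by have := mxrank_mod2_le e1; rewrite mod_e1 rD7.
have r2 : (m <= \rank (toQ e2))%N by have := mxrank_mod2_le e2; rewrite mod_e2 rD7.
have r3 : (2 * m <= \rank (toQ e3))%N by have := mxrank_mod2_le e3; rewrite mod_e3 rD6.
have r4 : (4 * m <= \rank (toQ e4))%N by have := mxrank_mod2_le e4; rewrite mod_e4 rD4.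
have trI : \tr (1 : 'M[int]_N) = 8 * m%:Z by rewrite mxtrace1 natz defN PoszM.
have trD (a b : 'M[int]_N) : \tr (a + b) = \tr a + \tr b by rewrite mxtraceD.
have trB (a b : 'M[int]_N) : \tr (a - b) = \tr a - \tr b by rewrite raddfB.
have tr_e1 (a b c d e f g h : 'M[int]_N) : \tr (a + b + c + d + e + f + g + h) =
    \tr a + \tr b + \tr c + \tr d + \tr e + \tr f + \tr g + \tr h.
  by rewrite !trD.
have tr_e2 (a b c d e f g h : 'M[int]_N) : \tr (a - b + c - d + e - f + g - h) =
    \tr a - \tr b + \tr c - \tr d + \tr e - \tr f + \tr g - \tr h.
  by rewrite !(trB, trD).
have tr_e3 (a b c d : 'M[int]_N) : \tr (a - b + c - d) = \tr a - \tr b + \tr c - \tr d.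
  by rewrite !(trB, trD).
have h1 := etrans (esym (tr_e1 1 S (S ^+ 2) (S ^+ 3) (S ^+ 4) (S ^+ 5) (S ^+ 6) (S ^+ 7)))
  (mxtrace_scaled_idempotent (order8_e1 S8)).
have h2 := etrans (esym (tr_e2 1 S (S ^+ 2) (S ^+ 3) (S ^+ 4) (S ^+ 5) (S ^+ 6) (S ^+ 7)))
  (mxtrace_scaled_idempotent (order8_e2 S8)).
have h3 := etrans (esym (tr_e3 1 (S ^+ 2) (S ^+ 4) (S ^+ 6)))
  (mxtrace_scaled_idempotent (order8_e3 S8)).
have h4 := etrans (esym (trB 1 (S ^+ 4))) (mxtrace_scaled_idempotent (order8_e4 S8)).
exact: (odd_trace_arith trI r1 r2 r3 r4 h4 h3 h2 h1).
Qed.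
End RankModTwo.

(** Over F_2 the group algebra is free over that of the group generated by z, so kernel and image of
    multiplication by z - 1 coincide. *)
Lemma mxrank_free_involution (gT : finGroupType) (z : gT) :
    z != 1%g -> (z * z = 1)%g ->
  (2 * \rank (bimx 1 (gelt z : gring 'F_2 gT) - 1%:M)%R)%N = #|gT|.
Proof.
move=> z1 zz; set D := _ - _.
have N2 (x : 'F_2) : - x = x.
  by apply/eqP; rewrite eq_sym -addr_eq0 -mulr2n -mulr_natr pchar_Zp // mulr0.
have DE w : gvec w *m D = gvec (w * (gelt z - 1)).
  rewrite mulmxBr mulmx1 gvec_bimx mul1r mulrBr mulr1; apply/rowP=> i.
  by rewrite !mxE gringDE gringNE.
have NG (w : gring 'F_2 gT) : - w = w by apply: gringP => g; rewrite gringNE N2.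
have DD : D *m D = 0.
  apply/row_matrixP=> i; rewrite !rowE mulmxA -[delta_mx 0 i]gunvecK !DE mulmx0.
  have sq : (gelt z - 1) * (gelt z - 1) = 0 :> gring 'F_2 gT.
    rewrite mulrBl mulrBr mulr1 mul1r -geltM zz gelt1 !NG (addrC 1).
    by rewrite -{1}[_ + 1]NG addNr.
  rewrite -mulrA sq mulr0.
  by apply/rowP=> j; rewrite !mxE gring0E.
have le_r : (\rank D + \rank D <= #|gT|)%N by apply: mulmx0_rank_max.
have kerD : (kermx D <= D)%MS.
  apply/row_subP => i; have: row i (kermx D) *m D = 0 by rewrite -row_mul mulmx_ker row0.
  rewrite -[row i _]gunvecK; move: (gunvec _) => w; rewrite DE => wz.
  have wE g : w (g * z)%g = w g.
    have w0 : w * (gelt z - 1) = 0.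
      by apply: (can_inj (@gvecK _ _)); rewrite wz; apply/rowP=> j; rewrite !mxE gring0E.
    have /(congr1 (fun w' : gring 'F_2 gT => w' (g * z)%g)) := w0.
    rewrite mulrBr mulr1 gringDE gringNE N2 mul_geltE mulgK gring0E.
    by move/eqP; rewrite addr_eq0 N2 => /eqP.
  (* A preimage of w: keep the coefficient at one element of each pair {g, g z}, chosen by its rank
     in the enumeration. *)
  apply/submxP; pose v : gring 'F_2 gT :=
    mkgring (fun g => if (enum_rank g < enum_rank (g * z)%g)%N then w g else 0).
  exists (gvec v); rewrite DE; congr gvec; apply: gringP => g.
  have vg : v g = if (enum_rank g < enum_rank (g * z)%g)%N then w g else 0 by exact: mkgringE.
  have vgz : v (g * z)%g = if (enum_rank (g * z)%g < enum_rank g)%N then w g else 0.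
    by rewrite mkgringE -mulgA zz mulg1 wE.
  have zV : (z^-1 = z)%g by apply/eqP; rewrite eq_invg_mul zz.
  rewrite mulrBr mulr1 gringDE gringNE N2 mul_geltE zV vg vgz.
  have ne : enum_rank (g * z)%g != enum_rank g.
    by rewrite (inj_eq enum_rank_inj) -{2}(mulg1 g) (inj_eq (mulgI g)).
  by case: ltngtP ne => // [_|_|/val_inj ->]; rewrite ?eqxx ?addr0 ?add0r.
have := mxrankS kerD; rewrite mxrank_ker; lia.
Qed.

Section OrderFourUnits.
Variables (gT : finGroupType) (x : gT).
Hypotheses (oG : #|gT| = 240%N) (x4 : (x ^+ 4)%g != 1%g) (x8 : (x ^+ 8)%g = 1%g).

(** The order of the centralizer of h times the indicator of its class. *)
Definition conj_count (h y : gT) : int := #|[set g | (y ^ g == h)%g]|%:R.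

Lemma conj_count_class_function h : class_function (conj_count h).
Proof.
move=> y1 y2; congr (_%:R).
have def_J g : ((y2 * y1) ^ g = (y1 * y2) ^ (y1 * g))%g.
  by rewrite conjgM; congr (_ ^ _)%g; rewrite conjgE !mulgA mulVg mul1g.
rewrite -(card_imset _ (mulgI y1^-1)%g); apply: eq_card => g; rewrite !inE def_J.
apply/imsetP/idP => [[k]|eg]; first by rewrite inE => kh ->; rewrite mulKVg.
by exists (y1 * g)%g; rewrite ?mulKg // inE.
Qed.

Lemma mxtrace_bimx_gelt (a : gring int gT) h :
  \tr (bimx a (gelt h^-1)) = gpair (conj_count h) a.
Proof.
rewrite mxtrace_bimx; apply: eq_bigr => y _.
rewrite (bigD1 h^-1%g) //= big1 ?addr0 => [|k /negbTE kh]; last first.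
  by rewrite mkgringE kh mulr0 mul0r.
rewrite mkgringE eqxx mulr1; congr (_ * _%:R); apply: eq_card => g; rewrite !inE.
by rewrite conjgE -[RHS](inj_eq (mulgI g)) mulKVg -[LHS](inj_eq (mulIg h)) mulgKV.
Qed.

(** For S : m |-> u m x^-1, the fourth power is right multiplication by the involution x^4, so S^4 -
    1 has rank |G|/2 modulo 2 and [mxtrace_odd_powers] applies. The four odd traces all equal the
    pairing of u, which therefore vanishes. *)
Lemma order4_unit_conj_count (u : gring int gT) :
  u ^+ 4 = 1 -> gpair (conj_count x) u = 0.
Proof.
move=> u4; pose S := bimx u (gelt x^-1).
have SX t : S ^+ t = bimx (u ^+ t) (gelt (x ^+ t)^-1).
  rewrite bimxX; congr (bimx _ _); rewrite -expgVn.
  by elim: t => [|t IHt]; rewrite ?expg0 ?gelt1 // exprS expgS geltM IHt.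
have u8 : u ^+ 8 = 1 by rewrite (exprM u 4 2) u4 expr1n.
have S8 : S ^+ 8 = 1 by rewrite SX u8 x8 invg1 gelt1 bimx1.
have rS : \rank (map_mx (intr : int -> 'F_2) (S ^+ 4 - 1)) = (4 * 30)%N.
  have xx : (x ^+ 4 * x ^+ 4 = 1)%g by rewrite -expgD.
  have xV : ((x ^+ 4)^-1 = x ^+ 4)%g by apply/eqP; rewrite eq_invg_mul xx.
  have := etrans (mxrank_free_involution x4 xx) oG.
  have -> : bimx 1 (gelt (x ^+ 4)%g) - 1%:M =
            map_mx (intr : int -> 'F_2) (S ^+ 4 - 1) :> 'M['F_2]_#|gT|; last by lia.
  rewrite SX u4 xV [RHS]raddfB /=; congr (_ - _); last by rewrite map_mx1.
  apply/esym/map_bimx => g; first by rewrite !gring1E; case: eqP.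
  by rewrite !mkgringE; case: eqP.
have tr_odd t : coprime t 240 -> \tr (S ^+ t) = gpair (conj_count x) u.
  move=> co_t; have t_gt0 : (0 < t)%N by case: t co_t.
  have co4 : coprime t 4 by apply: coprime_dvdr co_t.
  rewrite SX mxtrace_bimx_gelt.
  rewrite (gpair_exp_coprime (conj_count_class_function _) _ t_gt0 co4 u4) //.
  apply: eq_gpair => y; congr (_%:R); apply: eq_card => g; rewrite !inE conjXg.
  apply/eqP/eqP => [|-> //].
  have Uinj : injective (fun h : gT => (h ^+ t)%g).
    move=> h k /= hk; have co : coprime #|[set: gT]| t by rewrite cardsT oG coprime_sym.
    by rewrite -(expgK co (in_setT h)) hk expgK ?in_setT.
  exact: Uinj.
(* The exponents 3 and 5 are not prime to 240; modulo 8 they may be replaced by 11 and 13. *)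
have S3 : S ^+ 3 = S ^+ 11 by rewrite (exprD S 8 3) S8 mul1r.
have S5 : S ^+ 5 = S ^+ 13 by rewrite (exprD S 8 5) S8 mul1r.
have t1 : \tr S = gpair (conj_count x) u by rewrite -(tr_odd 1%N isT) expr1.
have t3 : \tr (S ^+ 3) = gpair (conj_count x) u by rewrite S3 (tr_odd 11%N isT).
have t5 : \tr (S ^+ 5) = gpair (conj_count x) u by rewrite S5 (tr_odd 13%N isT).
have t7 := tr_odd 7%N isT.
have := mxtrace_odd_powers (m := 30) oG S8 rS.
by rewrite t1 t3 t5 t7; move: (gpair _ _) => c; lia.
Qed.
End OrderFourUnits.

(** * Rational conjugacy *)

(** The determinant is a non-zero polynomial in the parameter, so some natural number is not a
    root. *)
Lemma det_pencil_nat (F : numFieldType) N (A B : 'M[F]_N) (c : F) :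
  \det (A + c *: B) != 0 -> exists m : nat, \det (A + m%:R *: B) != 0.
Proof.
move=> detc; pose P : {poly F} := \det (map_mx polyC A + 'X *: map_mx polyC B).
have PE x : P.[x] = \det (A + x *: B).
  rewrite -horner_evalE -det_map_mx; congr (\det _); apply/matrixP=> i j.
  by rewrite !mxE /= !horner_evalE !hornerE.
have P0 : P != 0 by apply: contraNneq detc => P0; rewrite -PE P0 horner0.
case: (boolP [exists i : 'I_(size P), \det (A + (i : nat)%:R *: B) != 0]).
  by case/existsP=> i; exists i.
rewrite negb_exists => /forallP all0.
have := max_poly_roots P0 (rs := mkseq (fun i => i%:R) (size P)).
rewrite size_mkseq ltnn => max_P; suff: false by []; apply: max_P.
  apply/allP=> _ /mapP[i lt_i ->]; apply/rootP; rewrite PE.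
  rewrite mem_iota /= add0n in lt_i; have := all0 (Ordinal lt_i).
  by rewrite negbK => /eqP.
rewrite map_inj_uniq ?iota_uniq // => i j /eqP; rewrite eqr_nat => /eqP.
by [].
Qed.

Lemma det_span_nat (F : numFieldType) N (I : Type) (s : seq I) (c : I -> F)
    (B : I -> 'M[F]_N) (A : 'M[F]_N) :
    \det (A + \sum_(i <- s) c i *: B i) != 0 ->
  exists m : seq nat, \det (A + \sum_(p <- zip m s) p.1%:R *: B p.2) != 0.
Proof.
elim: s A => [|i s IHs] A; first by exists [::]; move: H; rewrite !big_nil.
rewrite big_cons addrA => /IHs[m].
rewrite addrAC => /det_pencil_nat[k]; rewrite addrAC => detk.
by exists (k :: m); rewrite /= big_cons addrA.
Qed.

Section Conjugacy.
Variable gT : finGroupType.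

Definition gring_map (R S : nzRingType) (f : R -> S) (u : gring R gT) : gring S gT :=
  mkgring (fun g => f (u g)).

Local Notation toC := (gring_map (intr : int -> algC)).

Local Notation toCQ := (ratr : rat -> algC).

Section Represent.
Variables (n : nat) (u : gring int gT).
Hypotheses (n_gt1 : (1 < n)%N) (un1 : u ^+ n = 1).

Definition two_sided_mx (p : 'Z_n * gT) : 'M[algC]_#|gT| :=
  map_mx intr (bimx (u ^+ p.1) (gelt p.2)).

Lemma two_sided_mx_repr : mx_repr [set: 'Z_n * gT] two_sided_mx.
Proof.
split=> [|[i g] [j h] _ _]; rewrite /two_sided_mx /=.
  by rewrite expr0 gelt1 bimx1 map_mx1.
rewrite -map_mxM bimxM -geltM -exprD; congr (map_mx _ (bimx _ _)).
rewrite -(expr_mod _ un1) -[in RHS](expr_mod _ un1) [(j + i)%N]addnC.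
have modZ k : (k %% (Zp_trunc n).+2)%N = (k %% n)%N by rewrite Zp_cast.
by rewrite /= modZ modn_mod.
Qed.

Definition two_sided_repr := MxRepresentation two_sided_mx_repr.

Lemma mxtrace_two_sided p :
  \tr (two_sided_mx p) = (gpair (conj_count p.2^-1%g) (u ^+ p.1))%:~R.
Proof. by rewrite trace_map_mx -mxtrace_bimx_gelt invgK. Qed.

End Represent.

Lemma rational_conjugacy (u v : gring int gT) n :
    (0 < n)%N -> u ^+ n = 1 -> v ^+ n = 1 ->
    (forall t f, class_function f -> gpair f (u ^+ t) = gpair f (v ^+ t)) ->
  exists2 x : gring rat gT, x \is a GRing.unit &
    x^-1 * gring_ZtoQ u * x = gring_ZtoQ v.
Proof.
(* Doubling ensures m > 1; the type ['Z_m] has m elements only then. *)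
move=> n_gt0 un1 vn1 eq_uv; pose m := (2 * n)%N.
have m_gt1 : (1 < m)%N by rewrite /m; lia.
have um1 : u ^+ m = 1 by rewrite /m mulnC exprM un1 expr1n.
have vm1 : v ^+ m = 1 by rewrite /m mulnC exprM vn1 expr1n.
clearbody m.
(* [Z_m x G] acts on the group ring by (i, g) : m |-> u^i m g; an intertwiner    *)
(* between the actions for u and v is multiplication by some x with x u = v x.   *)
have /cfRepr_rsimP[B _ freeB simB] :
    cfRepr (two_sided_repr m_gt1 um1) == cfRepr (two_sided_repr m_gt1 vm1).
  apply/eqP/cfunP=> p; rewrite !cfunE; congr (_ *+ _).
  by rewrite /= !mxtrace_two_sided eq_uv //; apply: conj_count_class_function.
have {}simB i g : map_mx intr (bimx (u ^+ i) (gelt g)) *m B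
                  = B *m map_mx intr (bimx (v ^+ i) (gelt g)).
  have := simB (inZp (i %% m) : 'Z_m, g) (in_setT _); rewrite /= /two_sided_mx /=.
  have modZ k : (k %% (Zp_trunc m).+2)%N = (k %% m)%N by rewrite Zp_cast.
  by rewrite modZ modn_mod !expr_mod.
pose x : gring algC gT := gunvec (gvec 1 *m B).
have map_bimxC a b : map_mx intr (bimx a b) = bimx (toC a) (toC b).
  by apply: map_bimx => g; rewrite mkgringE.
have toC_gelt g : toC (gelt g) = gelt g.
  by apply: gringP => h; rewrite !mkgringE; case: eqP.
have toC1 : toC 1 = 1 by rewrite -gelt1 toC_gelt.
(* The intertwiner commutes with right multiplication by G, so it is left multiplication by the
   image of 1. *)
have def_B : B = bimx x 1.
  apply/row_matrixP=> i; rewrite !rowE -[delta_mx 0 i]gunvecK.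
  have -> : gunvec (delta_mx 0 i) = gelt (enum_val i) :> gring algC gT.
    apply: gringP => g; rewrite !mkgringE mxE eqxx /=.
    by rewrite (can2_eq enum_rankK enum_valK).
  rewrite gvec_bimx mulr1 -[gelt _]mul1r -[_ * _]mul1r mulrA -gvec_bimx.
  have := simB 0%N (enum_val i); rewrite !expr0 map_bimxC toC1 toC_gelt => simBi.
  rewrite -mulmxA simBi mulmxA -/(gvec 1 *m B) -[gvec 1 *m B]gunvecK -/x.
  by rewrite gvec_bimx !mul1r.
have xu : x * toC u = toC v * x.
  have := simB 1%N 1%g; rewrite !expr1 !map_bimxC gelt1 toC1 def_B !bimxM mulr1.
  move/(congr1 (mulmx (gvec 1))); rewrite !gvec_bimx !mulr1.
  by move/(can_inj (@gvecK _ _)).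
have x_unit : gmx x \in unitmx.
  have Bu : B \in unitmx by rewrite -row_free_unit.
  pose y := gunvec (gvec 1 *m invmx B).
  have: gvec y *m B = gvec 1 by rewrite gunvecK mulmxKV.
  rewrite def_B gvec_bimx mulr1 => /(can_inj (@gvecK _ _)) /(congr1 (@gmx _ _)).
  by rewrite gmxM gmx1 => /mulmx1_unit[].
(* The linear system x u = v x is rational, so a solution that is invertible    *)
(* over [algC] can be moved to an invertible rational one.                       *)
pose M : 'M[rat]_#|gT| := bimx 1 (gring_ZtoQ u) - bimx (gring_ZtoQ v) 1.
have ME (y : gring rat gT) :
    gvec y *m M = gvec (y * gring_ZtoQ u - gring_ZtoQ v * y).
  rewrite mulmxBr !gvec_bimx mul1r mulr1; apply/rowP=> i.
  by rewrite !mxE gringDE gringNE.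
pose K := kermx M.
have ratrM a b : map_mx toCQ (bimx (gring_ZtoQ a) (gring_ZtoQ b)) = bimx (toC a) (toC b).
  by apply: map_bimx => g; rewrite gring_ZtoQE mkgringE /= ratr_int.
have Z1 : gring_ZtoQ (1 : gring int gT) = 1 by rewrite rmorph1.
have xM : gvec x *m map_mx toCQ M = 0.
  rewrite raddfB /= -Z1 !ratrM toC1 mulmxBr !gvec_bimx mul1r mulr1 xu.
  by rewrite subrr.
have /submxP[c def_x] : (gvec x <= map_mx toCQ K)%MS.
  by rewrite map_kermx sub_kermx xM.
pose k i : gring rat gT := gunvec (row i K).
have kM i : k i * gring_ZtoQ u = gring_ZtoQ v * k i.
  apply/eqP; rewrite -subr_eq0; apply/eqP/(can_inj (@gvecK _ _)).
  rewrite -ME gunvecK -row_mul mulmx_ker row0; apply/rowP=> j.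
  by rewrite !mxE gring0E.
have gmx_x : gmx x = 0 + \sum_i c 0 i *: map_mx toCQ (gmx (k i)).
  rewrite add0r; apply/matrixP=> a b; rewrite summxE !mxE.
  set h := (_ * _)%g; have -> : x h = (gvec x) 0 (enum_rank h) by rewrite mxE enum_rankK.
  rewrite def_x !mxE; apply: eq_bigr => i _; rewrite !mxE mkgringE; congr (_ * toCQ _).
  by rewrite ![RHS]mxE.
have: \det (gmx x) != 0 by rewrite -unitfE -unitmxE.
rewrite gmx_x => /det_span_nat[s]; rewrite add0r => dets.
pose y : gring rat gT := \sum_(p <- zip s (index_enum 'I_#|gT|)) k p.2 *+ p.1.
have yu : y * gring_ZtoQ u = gring_ZtoQ v * y.
  rewrite /y mulr_suml mulr_sumr; apply: eq_bigr => p _.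
  by rewrite mulrnAl mulrnAr kM.
have y_unit : y \is a GRing.unit.
  have gmx_y : map_mx toCQ (gmx y) =
      \sum_(p <- zip s (index_enum 'I_#|gT|)) p.1%:R *: map_mx toCQ (gmx (k p.2)).
    apply/matrixP=> a b; rewrite summxE !mxE /y gring_sum rmorph_sum.
    apply: eq_bigr => p _; rewrite !mxE gringMn rmorphMn /=.
    by rewrite mulr_natl.
  apply/idP; rewrite -[_ \is a _]/(gmx y \in unitmx) unitmxE unitfE.
  by move: dets; rewrite -gmx_y det_map_mx fmorph_eq0.
exists y^-1; first by rewrite unitrV.
by rewrite invrK yu mulrK.
Qed.
End Conjugacy.

(** * The covering group in SL(2, 25) *)

(* (s, (a, b, c, d)) encodes the matrix [[a, b], [c, d]] over F_5, multiplied  *)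
(* by the square root of 2 in F_25 when s = true.                              *)
Definition twmx : Type := (bool * ('F_5 * 'F_5 * 'F_5 * 'F_5))%type.

Definition twmx_mul (x y : twmx) : twmx :=
  let: (s, (a, b, c, d)) := x in let: (s', (a', b', c', d')) := y in
  let k : 'F_5 := if s && s' then 2 else 1 in
  (s (+) s', (k * (a * a' + b * c'), k * (a * b' + b * d'),
              k * (c * a' + d * c'), k * (c * b' + d * d'))).
Definition twmx_one : twmx := (false, (1, 0, 0, 1)).
Definition twmx_inv (x : twmx) : twmx :=
  let: (s, (a, b, c, d)) := x in (s, (d, - b, - c, a)).
(** With the factor root of 2 the determinant is 2 (ad - bc), and 2 times 3 is 1 in F_5. *)
Definition twmx_det1 (x : twmx) : bool :=
  let: (s, (a, b, c, d)) := x in a * d - b * c == (if s then 3 else 1).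

Lemma twmx_mulA : associative twmx_mul.
Proof.
move=> [s [[[a b] c] d]] [t [[[a' b'] c'] d']] [r [[[a'' b''] c''] d'']].
rewrite /twmx_mul addbA; case: s t r => [] [] [] /=; do ![congr pair]; ring.
Qed.

Lemma twmx_mul1 : left_id twmx_one twmx_mul.
Proof. by move=> [s [[[a b] c] d]] /=; do ![congr pair]; ring. Qed.

Lemma twmx_mulV x : twmx_det1 x -> twmx_mul (twmx_inv x) x = twmx_one.
Proof.
move: x => [s [[[a b] c] d]] /eqP det; rewrite /= addbb andbb.
have E : (if s then 2 else 1) * (a * d - b * c) = 1 :> 'F_5.
  by rewrite det; case: (s); apply/val_inj.
rewrite /twmx_one; move: (if s then _ else _) E => k E.
do ![congr pair]; [rewrite -E; ring | ring | ring | rewrite -E; ring].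
Qed.

Lemma twmx_det1M x y : twmx_det1 x -> twmx_det1 y -> twmx_det1 (twmx_mul x y).
Proof.
move: x y => [s [[[a b] c] d]] [t [[[a' b'] c'] d']] /= /eqP det /eqP det'.
set k := (if s && t then _ else _ : 'F_5).
have -> : k * (a * a' + b * c') * (k * (c * b' + d * d')) -
  k * (a * b' + b * d') * (k * (c * a' + d * c')) =
  k * k * (a * d - b * c) * (a' * d' - b' * c') by ring.
by rewrite det det' /k; case: (s) (t) => [] [].
Qed.

Lemma twmx_det1V x : twmx_det1 x -> twmx_det1 (twmx_inv x).
Proof.
move: x => [s [[[a b] c] d]] /= /eqP <-.
by have -> : d * a - (- b) * (- c) = a * d - b * c by ring.
Qed.

Definition twgroup : Type := {x : twmx | twmx_det1 x}.
HB.instance Definition _ := SubFinite.on twgroup.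

Definition twg_mul (x y : twgroup) : twgroup :=
  Sub (twmx_mul (val x) (val y)) (twmx_det1M (valP x) (valP y)).
Definition twg_one : twgroup := Sub twmx_one isT.
Definition twg_inv (x : twgroup) : twgroup := Sub (twmx_inv (val x)) (twmx_det1V (valP x)).

Fact twg_mulA : associative twg_mul.
Proof. by move=> x y z; apply: val_inj; apply: twmx_mulA. Qed.
Fact twg_mul1 : left_id twg_one twg_mul.
Proof. by move=> x; apply: val_inj; apply: twmx_mul1. Qed.
Fact twg_mulV : left_inverse twg_one twg_inv twg_mul.
Proof. by move=> x; apply: val_inj; apply: twmx_mulV; apply: valP. Qed.

HB.instance Definition _ := Finite_isGroup.Build twgroup twg_mulA twg_mul1 twg_mulV.

Definition gen1 : twmx := (true, (0, 1, 2, 0)).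
Definition gen2 : twmx := (true, (1, 1, 1, 4)).
Definition gen3 : twmx := (true, (0, 2, 1, 0)).
Definition gen4 : twmx := (true, (2, 4, 2, 3)).
Definition genz : twmx := (false, (4, 0, 0, 4)).

Definition extend (s t : seq twmx) : seq twmx := [seq twmx_mul x y | x <- s, y <- t].
Local Notation "x ** y" := (twmx_mul x y) (at level 40, left associativity).
(** The normal forms of [cover_card_le], evaluated in the matrix model. *)
Definition twmx_list : seq twmx :=
  extend (extend (extend (extend [:: twmx_one; genz] [:: twmx_one; gen1])
   [:: twmx_one; gen2; gen2 ** gen1])
   [:: twmx_one; gen3; gen3 ** gen2; gen3 ** gen2 ** gen1])
   [:: twmx_one; gen4; gen4 ** gen3; gen4 ** gen3 ** gen2; gen4 ** gen3 ** gen2 ** gen1].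

Lemma uniq_twmx_list : uniq twmx_list.
Proof. by vm_compute. Qed.
Lemma size_twmx_list : size twmx_list = 240%N.
Proof. by vm_compute. Qed.

Definition tw1 : twgroup := Sub gen1 isT.
Definition tw2 : twgroup := Sub gen2 isT.
Definition tw3 : twgroup := Sub gen3 isT.
Definition tw4 : twgroup := Sub gen4 isT.
Definition twz : twgroup := Sub genz isT.

Section Model.
Variable gT : finGroupType.
Hypothesis gT_S5 : is_cover_S5 gT.
Import GroupScope.

Lemma cover_relations : exists g1 g2 g3 g4 z : gT,
  [/\ <[g1]> <*> <[g2]> <*> <[g3]> <*> <[g4]> <*> <[z]> = [set: gT],
    [/\ g1 ^+ 2 = z, g2 ^+ 2 = z, g3 ^+ 2 = z & g4 ^+ 2 = z],
    [/\ (g1 * g2) ^+ 3 = z, (g2 * g3) ^+ 3 = z & (g3 * g4) ^+ 3 = z],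
    [/\ (g1 * g3) ^+ 2 = z, (g1 * g4) ^+ 2 = z & (g2 * g4) ^+ 2 = z] &
    [/\ z ^+ 2 = 1, [~ z, g1] = 1, [~ z, g2] = 1, [~ z, g3] = 1 & [~ z, g4] = 1]].
Proof.
case/existsP: (isoGrp_hom gT_S5) => [[[[[g1 g2] g3] g4] z]] /eqP /= h.
have e0 := congr1 (@fst _ _) h; move/(congr1 (@snd _ _)): h => h.
have e1 := congr1 (@fst _ _) h; move/(congr1 (@snd _ _)): h => h.
have e2 := congr1 (@fst _ _) h; move/(congr1 (@snd _ _)): h => h.
have e3 := congr1 (@fst _ _) h; move/(congr1 (@snd _ _)): h => h.
have e4 := congr1 (@fst _ _) h; move/(congr1 (@snd _ _)): h => h.
have e5 := congr1 (@fst _ _) h; move/(congr1 (@snd _ _)): h => h.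
have e6 := congr1 (@fst _ _) h; move/(congr1 (@snd _ _)): h => h.
have e7 := congr1 (@fst _ _) h; move/(congr1 (@snd _ _)): h => h.
have e8 := congr1 (@fst _ _) h; move/(congr1 (@snd _ _)): h => h.
have e9 := congr1 (@fst _ _) h; move/(congr1 (@snd _ _)): h => h.
have e10 := congr1 (@fst _ _) h; move/(congr1 (@snd _ _)): h => h.
have e11 := congr1 (@fst _ _) h; move/(congr1 (@snd _ _)): h => h.
have e12 := congr1 (@fst _ _) h; move/(congr1 (@snd _ _)): h => h.
have e13 := congr1 (@fst _ _) h; move/(congr1 (@snd _ _)): h => h.
have e14 := congr1 (@fst _ _) h; move/(congr1 (@snd _ _)): h => e15.
by exists g1, g2, g3, g4, z.
Qed.

Lemma cover_card_le240 : (#|gT| <= 240)%N.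
Proof.
have [g1 [g2 [g3 [g4 [z [gen [s1 s2 s3 s4] [e12 e23 e34] [e13 e14 e24] [zz z1 z2 z3 z4]]]]]]] :=
  cover_relations.
move: s1 s2 s3 s4 e12 e23 e34 e13 e14 e24 zz.
rewrite !expg2 !expgS expg0 !mulg1 !mulgA => s1 s2 s3 s4 e12 e23 e34 e13 e14 e24 zz.
have zC g : g * z = z * g.
  suff: [set: gT] \subset 'C[z] by move/subsetP/(_ g (in_setT g))/cent1P.
  have comm h : [~ z, h] = 1 -> h \in 'C[z].
    by move/eqP/commgP=> zh; apply/cent1P.
  by rewrite -gen !join_subG !cycle_subG cent1id !comm.
(* As the generators square to the central z, the relation (ab)^3 = z becomes the braid relation,
   and (ab)^2 = z becomes ba = zab. *)
have braid a b : a * a = z -> b * b = z -> a * b * a * b * a * b = z ->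
    b * a * b = a * b * a.
  move=> aa bb ab; have : a * b * a * (b * a * b) * (b * a * b) = z * (b * a * b).
    by rewrite !mulgA ab.
  have -> : a * b * a * (b * a * b) * (b * a * b) = a * b * a * z.
    have bab2 : b * a * b * (b * a * b) = z.
      rewrite !mulgA -(mulgA _ b b) bb -(mulgA (b * a)) -zC mulgA -(mulgA b a a) aa.
      by rewrite -(mulgA b z z) zz mulg1 bb.
    by rewrite -[LHS]mulgA bab2.
  by rewrite zC => /mulgI ->.
have anti a b : a * a = z -> b * b = z -> a * b * a * b = z -> b * a = z * a * b.
  move=> aa bb ab; have : a * (a * b * a * b) * b = a * z * b by rewrite ab.
  rewrite !mulgA aa -(mulgA _ b b) bb zC => ab'.
  have : z * b * a * z * z = z * a * b * z by rewrite ab' -zC.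
  rewrite -(mulgA _ z z) zz mulg1 -!mulgA => /mulgI ->.
  by rewrite !mulgA zC !mulgA.
apply: (@cover_card_le gT g1 g2 g3 g4 z gen s1 s2 s3 s4 zz zC); auto.
Qed.

Definition model_group : {group twgroup} :=
  [group of <[tw1]> <*> <[tw2]> <*> <[tw3]> <*> <[tw4]> <*> <[twz]>].

Lemma twgroup_rel (x y : twgroup) : val x = val y -> x = y.
Proof. exact: val_inj. Qed.

(** A group generated by elements satisfying the relations is a quotient of the presented group; the
    relations are checked by computation. *)
Lemma model_homg : model_group \homg [set: gT].
Proof.
have -> := gT_S5 model_group; apply/existsP; exists (tw1, tw2, tw3, tw4, twz).
apply/eqP; rewrite /=.
congr (_, (_, (_, (_, (_, (_, (_, (_, (_, (_, (_, (_, (_, (_, (_, _)))))))))))))));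
  by apply: twgroup_rel; apply/eqP; vm_compute.
Qed.
Lemma twmx_list_model : {in twmx_list, forall c, exists2 h, h \in model_group & val h = c}.
Proof.
pose inH c := exists2 h, h \in model_group & val h = c.
have H1 : inH twmx_one by exists 1; rewrite ?group1.
have HM c d : inH c -> inH d -> inH (twmx_mul c d).
  by move=> [x Hx <-] [y Hy <-]; exists (x * y); rewrite ?groupM.
have Hext s t : {in s, forall c, inH c} -> {in t, forall c, inH c} ->
    {in extend s t, forall c, inH c}.
  by move=> Hs Ht _ /allpairsP[[c d] /= [sc td ->]]; apply: HM; [apply: Hs | apply: Ht].
have subl (A B : {set twgroup}) : A \subset A <*> B by apply: joing_subl.
have mz : twz \in model_group by rewrite mem_gen // inE cycle_id orbT.
have m4 : tw4 \in model_group.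
  by apply: (subsetP (subl _ _)); rewrite mem_gen // inE cycle_id orbT.
have m3 : tw3 \in model_group.
  by do 2!apply: (subsetP (subl _ _)); rewrite mem_gen // inE cycle_id orbT.
have m2 : tw2 \in model_group.
  by do 3!apply: (subsetP (subl _ _)); rewrite mem_gen // inE cycle_id orbT.
have m1 : tw1 \in model_group by do 4!apply: (subsetP (subl _ _)); rewrite cycle_id.
have G1 : inH gen1 by exists tw1.
have G2 : inH gen2 by exists tw2.
have G3 : inH gen3 by exists tw3.
have G4 : inH gen4 by exists tw4.
have Gz : inH genz by exists twz.
have Hnil : {in [::], forall c, inH c} by [].
have Hcons c s : inH c -> {in s, forall c, inH c} -> {in c :: s, forall c, inH c}.
  by move=> Hc Hs d; rewrite inE => /predU1P[->|/Hs].
by apply: (Hext); [apply: (Hext); [apply: (Hext); [apply: (Hext) |] |] |];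
  do ![apply: (Hcons); first by do ?[apply: (HM)]].
Qed.

(** A homomorphism from a group of at most 240 elements whose image contains the 240 listed matrices
    is injective, with that list as image. *)
Lemma cover_model : exists code : gT -> twmx,
  [/\ {morph code : x y / x * y >-> twmx_mul x y}, injective code,
      forall x, code x \in twmx_list, {in twmx_list, forall c, exists x, code x = c}
    & #|gT| = 240].
Proof.
have /homgP[f fG] := model_homg; pose code x := val (f x).
have onto c : c \in twmx_list -> exists x, code x = c.
  case/twmx_list_model => h; rewrite -fG => /morphimP[x _ _ ->] <-; by exists x.
pose cl := codom code.
have sub_cl : {subset twmx_list <= cl}.
  by move=> c /onto[x <-]; apply: codom_f.
have le_cl : (size cl <= size twmx_list)%N.
  by rewrite size_codom size_twmx_list cover_card_le240.
have [sz_cl mem_cl] := uniq_min_size uniq_twmx_list sub_cl le_cl.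
have uniq_cl := leq_size_uniq uniq_twmx_list sub_cl le_cl.
exists code; split=> [x y | x y | x | //|].
- by rewrite /code morphM ?in_setT.
- by apply: (injectiveP _ uniq_cl).
- by rewrite mem_cl codom_f.
- by move: sz_cl; rewrite size_codom size_twmx_list => <-.
Qed.
End Model.

(** * Extending representations to the group ring, and the class tables *)

Section GroupRingLift.
Variables (gT : finGroupType) (S : nzRingType) (rho : gT -> S).
Hypotheses (rho1 : rho 1%g = 1) (rhoM : {morph rho : x y / (x * y)%g >-> x * y}).

Definition gring_lift (u : gring int gT) : S := \sum_g rho g *~ u g.

Lemma gring_lift1 : gring_lift 1 = 1.
Proof.
rewrite /gring_lift (bigD1 1%g) //= gring1E eqxx rho1 big1 ?addr0 // => g /negbTE g1.
by rewrite gring1E g1 mulr0z.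
Qed.

Lemma gring_lift_gelt x : gring_lift (gelt x) = rho x.
Proof.
rewrite /gring_lift (bigD1 x) //= mkgringE eqxx big1 ?addr0 // => g /negbTE gx.
by rewrite mkgringE gx mulr0z.
Qed.

Lemma gring_liftM u v : gring_lift (u * v) = gring_lift u * gring_lift v.
Proof.
rewrite /gring_lift mulr_suml.
under eq_bigr => g _ do rewrite gringME mulrz_sumr.
rewrite exchange_big /=; apply: eq_bigr => x _; rewrite mulr_sumr.
rewrite (reindex_inj (mulgI x)) /=; apply: eq_bigr => y _.
by rewrite mulKg rhoM mulrzAl mulrzAr mulrzA_C.
Qed.

Lemma gring_liftX u n : gring_lift (u ^+ n) = gring_lift u ^+ n.
Proof. by elim: n => [|n IHn]; rewrite ?gring_lift1 // !exprS gring_liftM IHn. Qed.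

End GroupRingLift.

(* The class index: 0: 1, 1: z, 2: order 3, 3: order 6, 4: order 5,            *)
(* 5: order 10, 6: order 4 over (12)(34), 7: order 4 over (12), 8 and 9: order *)
(* 8, 10 and 11: order 12.  It is read off the trace of the twisted matrix.    *)
Definition tw_class (x : twmx) : nat :=
  let: (s, (a, b, c, d)) := x in
  let t : nat := (a + d : 'F_5) in
  if s then nth 0%N [:: 7; 8; 10; 11; 9] t else
  let scalar := (b == 0) && (c == 0) in
  nth 0%N [:: 6; 3; if scalar then 0 else 4; if scalar then 1 else 5; 2]%N t.

Definition class_size := nth 0%N [:: 1; 1; 20; 20; 24; 24; 30; 20; 30; 30; 20; 20]%N.
Definition class_sq := nth 0%N [:: 0; 0; 2; 2; 4; 4; 1; 1; 6; 6; 3; 3]%N.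
Definition class_cube := nth 0%N [:: 0; 1; 0; 1; 4; 5; 6; 7; 9; 8; 7; 7]%N.
Definition class_pow5 := nth 0%N [:: 0; 1; 2; 3; 0; 1; 6; 7; 9; 8; 11; 10]%N.
Definition class_z := nth 0%N [:: 1; 0; 3; 2; 5; 4; 6; 7; 9; 8; 11; 10]%N.
Definition class_rep (k : nat) : twmx :=
  nth twmx_one twmx_list (find (fun x => tw_class x == k) twmx_list).

Definition tw_trace (x : twmx) : 'F_5 := let: (s, (a, b, c, d)) := x in a + d.

(** The class index in terms of data visibly invariant under conjugation; this yields
    [gclass_comm]. *)
Definition tw_class_of (s : bool) (t : 'F_5) (is1 isz : bool) : nat :=
  if s then nth 0%N [:: 7; 8; 10; 11; 9]%N t else
  nth 0%N [:: 6; 3; if is1 then 0 else 4; if isz then 1 else 5; 2]%N t.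

Lemma tw_class_table : all (fun x =>
  [&& (tw_class x < 12)%N,
      tw_class (x ** x) == class_sq (tw_class x),
      tw_class (x ** x ** x) == class_cube (tw_class x),
      tw_class (x ** x ** x ** x ** x) == class_pow5 (tw_class x),
      tw_class (genz ** x) == class_z (tw_class x),
      genz ** x == x ** genz,
      (tw_class x == 0%N) ==> (x == twmx_one),
      (tw_class x == 1%N) ==> (x == genz),
      x.1 == (tw_class x \in [:: 7; 8; 9; 10; 11]%N),
      tw_class x == tw_class_of x.1 (tw_trace x) (x == twmx_one) (x == genz),
      tw_class (twmx_inv x) == tw_class x,
      twmx_inv x ** x == twmx_one &
      twmx_inv x \in twmx_list]) twmx_list.
Proof. by vm_compute. Qed.

Lemma tw_class_size :
  all (fun k => count (fun x => tw_class x == k) twmx_list == class_size k) (iota 0 12).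
Proof. by vm_compute. Qed.

(* [find] rather than [has], as the boolean disjunction is strict in vm_compute. *)
Lemma tw_class_conj : all (fun k => let r := class_rep k in
    all (fun x => if tw_class x == k
                  then (find (fun m => x ** m == m ** r) twmx_list < 240)%N else true)
      twmx_list) (iota 0 12).
Proof. by vm_compute. Qed.

(** * Small matrices and characteristic five *)

Section SmallMatrices.
Variable R : comNzRingType.

(** Entries indexed by [nat] compute, so that the identities below become goals for [ring]. *)
Lemma matrix_nat_ex m n (A : 'M[R]_(m.+1, n.+1)) :
  exists a : nat -> nat -> R, A = \matrix_(i < m.+1, j < n.+1) a i j.
Proof.
exists (fun k l => A (inord k) (inord l)).
by apply/matrixP=> i j; rewrite mxE !inord_val.
Qed.

Lemma mxtrace_adj_inv n (A B : 'M[R]_n) : A *m B = 1%:M -> \tr (\adj A) = \det A * \tr B.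
Proof.
move=> AB; rewrite -mxtraceZ -[\adj A]mulmx1 -AB mulmxA mul_adj_mx.
by rewrite mul_scalar_mx.
Qed.

Lemma det_nat2 (a : nat -> nat -> R) :
  \det (\matrix_(i < 2, j < 2) a i j) = a 0%N 0%N * a 1%N 1%N - a 0%N 1%N * a 1%N 0%N.
Proof.
rewrite (expand_det_row _ ord0) !big_ord_recl big_ord0 /cofactor !det_mx11 !mxE /=.
ring.
Qed.

Lemma cofactor_nat3 (a : nat -> nat -> R) (i j : 'I_3) :
  cofactor (\matrix_(i < 3, j < 3) a i j) i j = (-1) ^+ (i + j) *
  (a (bump i 0) (bump j 0) * a (bump i 1) (bump j 1)
   - a (bump i 0) (bump j 1) * a (bump i 1) (bump j 0)).
Proof.
rewrite /cofactor -(det_nat2 (fun k l => a (bump i k) (bump j l))); congr (_ * \det _).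
by apply/matrixP=> k l; rewrite !mxE.
Qed.

Lemma det_nat3 (a : nat -> nat -> R) :
  \det (\matrix_(i < 3, j < 3) a i j) =
  a 0%N 0%N * (a 1%N 1%N * a 2%N 2%N - a 1%N 2%N * a 2%N 1%N)
  - a 0%N 1%N * (a 1%N 0%N * a 2%N 2%N - a 1%N 2%N * a 2%N 0%N)
  + a 0%N 2%N * (a 1%N 0%N * a 2%N 1%N - a 1%N 1%N * a 2%N 0%N).
Proof.
rewrite (expand_det_row _ ord0) !big_ord_recl big_ord0 !cofactor_nat3 !mxE /=.
rewrite /bump /=; ring.
Qed.

Lemma mxtrace_adj_nat2 (a : nat -> nat -> R) :
  \tr (\adj (\matrix_(i < 2, j < 2) a i j)) = a 0%N 0%N + a 1%N 1%N.
Proof.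
rewrite /mxtrace !big_ord_recl big_ord0 !mxE /cofactor !det_mx11 !mxE /=; ring.
Qed.

Lemma mxtrace_adj_nat3 (a : nat -> nat -> R) :
  \tr (\adj (\matrix_(i < 3, j < 3) a i j)) =
    (a 1%N 1%N * a 2%N 2%N - a 1%N 2%N * a 2%N 1%N) +
    (a 0%N 0%N * a 2%N 2%N - a 0%N 2%N * a 2%N 0%N) +
    (a 0%N 0%N * a 1%N 1%N - a 0%N 1%N * a 1%N 0%N).
Proof.
rewrite /mxtrace !big_ord_recl big_ord0 !mxE !cofactor_nat3 /= /bump /=; ring.
Qed.

Lemma mx2_trace_inv (A B : 'M[R]_2) : A *m B = 1%:M -> \det A * \tr B = \tr A.
Proof.
move/mxtrace_adj_inv <-; have [a ->] := matrix_nat_ex A; rewrite mxtrace_adj_nat2.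
by rewrite /mxtrace !big_ord_recl big_ord0 !mxE /= addr0.
Qed.

Lemma mx2_trace_sqr (A : 'M[R]_2) : \tr (A *m A) = \tr A ^+ 2 - \det A *+ 2.
Proof.
have [a ->] := matrix_nat_ex A; rewrite det_nat2 /mxtrace !big_ord_recl !big_ord0 !mxE.
rewrite !big_ord_recl !big_ord0 !mxE /=; ring.
Qed.

Lemma mx3_trace_inv (A B : 'M[R]_3) : A *m B = 1%:M ->
  (\det A * \tr B) *+ 2 = \tr A ^+ 2 - \tr (A *m A).
Proof.
move/mxtrace_adj_inv <-; have [a ->] := matrix_nat_ex A; rewrite mxtrace_adj_nat3.
rewrite /mxtrace !big_ord_recl !big_ord0 !mxE.
rewrite !big_ord_recl !big_ord0 !mxE /=; ring.
Qed.

(** Newton's identity in degree 3: the second elementary symmetric function of the eigenvalues is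
    the trace of the adjugate, that is, the determinant times the trace of the inverse. *)
Lemma mx3_trace_cube (A B : 'M[R]_3) : A *m B = 1%:M ->
  \tr (A *m A *m A) = \tr A ^+ 3 - (\tr A * (\det A * \tr B)) *+ 3 + \det A *+ 3.
Proof.
move/mxtrace_adj_inv <-; have [a ->] := matrix_nat_ex A; rewrite mxtrace_adj_nat3 det_nat3.
rewrite /mxtrace !big_ord_recl !big_ord0 !mxE.
rewrite !big_ord_recl !big_ord0 !mxE.
rewrite !big_ord_recl !big_ord0 !mxE /=; ring.
Qed.

End SmallMatrices.

Definition f25 : Type := ('F_5 * 'F_5)%type.
HB.instance Definition _ := GRing.Zmodule.on f25.

(* F_25 = F_5[r] with r^2 = 2. *)
Definition f25_mul (x y : f25) : f25 :=
  (x.1 * y.1 + 2 * (x.2 * y.2), x.1 * y.2 + x.2 * y.1).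
Definition f25_one : f25 := (1, 0).

Fact f25_mulA : associative f25_mul.
Proof. by move=> x y z; congr pair; rewrite /=; ring. Qed.
Fact f25_mulC : commutative f25_mul.
Proof. by move=> x y; congr pair; rewrite /=; ring. Qed.
Fact f25_mul1 : left_id f25_one f25_mul.
Proof. by move=> [a b]; congr pair; rewrite /=; ring. Qed.
Fact f25_mulDl : left_distributive f25_mul +%R.
Proof. by move=> x y z; congr pair; rewrite /=; ring. Qed.
Fact f25_one_neq0 : f25_one != 0. Proof. by []. Qed.

HB.instance Definition _ := GRing.Zmodule_isComNzRing.Build f25
  f25_mulA f25_mulC f25_mul1 f25_mulDl f25_one_neq0.

Lemma f25E (x : f25) (n : int) : x *~ n = (x.1 * n%:~R, x.2 * n%:~R).
Proof.
have natE (y : f25) k : y *+ k = (y.1 *+ k, y.2 *+ k).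
  by elim: k => [|k IHk]; rewrite ?mulr0n // !mulrS IHk.
have zE (a : 'F_5) (m : int) : a * m%:~R = a *~ m by rewrite mulrzr.
rewrite !zE; case: n => n; first exact: natE.
by rewrite !NegzE !mulrNz -[LHS]/(- (x *+ n.+1)) natE.
Qed.

Lemma dvdz5_F5 (m k : int) : m%:~R = k%:~R :> 'F_5 -> (5 %| m - k)%Z.
Proof.
move=> mk; rewrite (dvdz_pcharf (pchar_Fp (isT : prime 5))).
by rewrite rmorphB /= mk subrr.
Qed.

Lemma F5_cases (P : 'F_5 -> Prop) : P 0 -> P 1 -> P 2 -> P (-2) -> P (-1) -> forall a, P a.
Proof.
move=> P0 P1 P2 P3 P4 a.
have [->|] := eqVneq a 0 => //; have [->|] := eqVneq a 1 => //; have [->|] := eqVneq a 2 => //.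
have [->|] := eqVneq a (-2) => //; have [->|] := eqVneq a (-1) => //.
by case: a => [[|[|[|[|[|//]]]]] ?].
Qed.

(** For order 8 in degree 3: the square of the unit has trace -1. *)
Lemma F5_trace_sqr (t d : 'F_5) : d != 0 -> (d * t) *+ 2 = t ^+ 2 + 1 -> t = 1 \/ t = -1.
Proof.
move=> d0 /eqP; move: t d d0; apply: F5_cases; apply: F5_cases; vm_compute => //; by [left|right].
Qed.

(** For order 12 in degree 3: the square has trace 0 and the cube trace -1. The first hypothesis
    makes d equal to 1 or -1. *)
Lemma F5_trace_cube (t d : 'F_5) : d ^+ 6 = 1 -> (d * t) *+ 2 = t ^+ 2 ->
  -1 = t ^+ 3 - (t * (d * t)) *+ 3 + d *+ 3 -> t = 2.
Proof.
move=> /eqP + /eqP + /eqP; move: t d; apply: F5_cases; apply: F5_cases; by vm_compute.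
Qed.

Lemma f25_trace_sqr0 (a : 'F_5) (d : f25) : d != 0 -> d * ((0, a) : f25) = (0, a) ->
  0 = ((0, a) : f25) ^+ 2 - d *+ 2 -> a = 1 \/ a = -1.
Proof.
case: d => b c + /eqP + /eqP; move: a b c; apply: F5_cases; apply: F5_cases; apply: F5_cases;
 vm_compute => //; by [left|right].
Qed.

Lemma f25_trace_sqr1 (a : 'F_5) (d : f25) : a != 0 -> d * ((0, a) : f25) = (0, a) ->
  ((1, 0) : f25) = ((0, a) : f25) ^+ 2 - d *+ 2 -> a = 2 \/ a = -2.
Proof.
case: d => b c + /eqP + /eqP; move: a b c; apply: F5_cases; apply: F5_cases; apply: F5_cases;
 vm_compute => //; by [left|right].
Qed.

(** * Integral constraints *)

Lemma sqr_int_ge1 (x : int) : x != 0 -> 1 <= x ^+ 2.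
Proof. by move=> x0; rewrite -gtz0_ge1 lt0r sqrf_eq0 x0 sqr_ge0. Qed.

Lemma sqr_int_le0 (x : int) : x ^+ 2 <= 0 -> x = 0.
Proof.
move=> le0; apply/eqP; rewrite -[_ == 0]negbK.
by apply: contraTN le0 => /sqr_int_ge1; lia.
Qed.

Lemma linear_bound7 (q0 q1 q2 q3 q4 q5 q6 : int) :
    240 * q0 + 12 * q1 + 10 * q2 + 16 * q3 + 24 * q4 + 8 * q5 + 12 * q6 <= 240 ->
    0 <= q0 -> 0 <= q1 -> 0 <= q2 -> 0 <= q3 -> 0 <= q4 -> 0 <= q5 -> 0 <= q6 ->
    [/\ q0 <= 1, 12 * q1 <= 240, 10 * q2 <= 240 & 16 * q3 <= 240] /\
    [/\ 24 * q4 <= 240, 8 * q5 <= 240 & 12 * q6 <= 240] /\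
    (1 <= q0 -> [/\ q1 <= 0, q2 <= 0 & q3 <= 0] /\ [/\ q4 <= 0, q5 <= 0 & q6 <= 0]).
Proof.
by move=> *; split; [split; lia | split; [split; lia | move=> ?; split; split; lia]].
Qed.

Lemma linear_bound5 (q0 q1 q2 q3 q4 : int) :
    240 * q0 + 12 * q1 + 10 * q2 + 8 * q3 + 12 * q4 <= 240 ->
    0 <= q0 -> 0 <= q1 -> 0 <= q2 -> 0 <= q3 -> 0 <= q4 ->
    [/\ q0 <= 1, 12 * q1 <= 240, 10 * q2 <= 240, 8 * q3 <= 240 & 12 * q4 <= 240] /\
    (1 <= q0 -> [/\ q1 <= 0, q2 <= 0, q3 <= 0 & q4 <= 0]).
Proof. by move=> *; split; [split; lia | move=> ?; split; lia]. Qed.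

Lemma sqr_int_le_bound (c m : nat) (x : int) :
  c%:Z * x ^+ 2 <= 240 -> 240 < c%:Z * (m.+1%:Z * m.+1%:Z) -> `|x| <= m%:Z.
Proof.
move=> le_x lt_m; rewrite leNgt; apply/negP=> lt_x.
have: m.+1%:Z ^+ 2 <= x ^+ 2.
  by rewrite -(real_normK (num_real x)) ler_pXn2r ?nnegrE //; lia.
move: le_x lt_m; rewrite (expr2 m.+1%:Z); move: (x ^+ 2) (m.+1%:Z * m.+1%:Z) => y w le_y lt_w le_wy.
have : c%:Z * w <= c%:Z * y by apply: ler_wpM2l.
lia.
Qed.

(** If e0 + e1 or e0 - e1 were 0, the other would be even and non-zero, too large for its form. So
    both are non-zero, and in each form the leading term already exhausts 240. *)
Lemma quadratic_eps01 (e0 e1 e2 e3 e4 e5 e6 e7 e8 e9 e10 e11 : int) :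
  240 * (e0 + e1) ^+ 2 + 12 * (e2 + e3) ^+ 2 + 10 * (e4 + e5) ^+ 2 + 16 * e6 ^+ 2
  + 24 * e7 ^+ 2 + 8 * (e8 + e9) ^+ 2 + 12 * (e10 + e11) ^+ 2 <= 240 ->
  240 * (e0 - e1) ^+ 2 + 12 * (e2 - e3) ^+ 2 + 10 * (e4 - e5) ^+ 2
  + 8 * (e8 - e9) ^+ 2 + 12 * (e10 - e11) ^+ 2 <= 240 ->
  e0 + e1 + e2 + e3 + e4 + e5 + e6 + e7 + e8 + e9 + e10 + e11 = 1 ->
  e0 != 0 \/ e1 != 0 ->
  [/\ e2 = 0, e3 = 0, e4 = 0 & e5 = 0] /\ [/\ e6 = 0, e7 = 0, e8 = 0, e9 = 0 & e10 = 0]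
  /\ e11 = 0 /\ (e0 = 1 /\ e1 = 0 \/ e0 = 0 /\ e1 = 1).
Proof.
move=> Qp Qm S ne.
have pos (x : int) : 0 <= x ^+ 2 by rewrite sqr_ge0.
have [[p1 _ _ _] [_ Hp]] :=
  linear_bound7 Qp (pos _) (pos _) (pos _) (pos _) (pos _) (pos _) (pos _).
have [[m1 _ _ _ _] Hm] := linear_bound5 Qm (pos _) (pos _) (pos _) (pos _) (pos _).
clear Qp Qm.
have big (x : int) : x != 0 -> 4 <= (2 * x) ^+ 2.
  by move/sqr_int_ge1; rewrite exprMn; move: (x ^+ 2) => y; lia.
have s0 : e0 + e1 != 0.
  apply/eqP=> s0; have /big : e0 != 0 by case: ne => // /eqP n1; apply/eqP; lia.
  by have <- : e0 - e1 = 2 * e0; [lia | move: m1; move: (_ ^+ 2) => y; lia].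
have d0 : e0 - e1 != 0.
  apply/eqP=> d0; have /big : e0 != 0 by case: ne => // /eqP n1; apply/eqP; lia.
  by have <- : e0 + e1 = 2 * e0; [lia | move: p1; move: (_ ^+ 2) => y; lia].
have [[/sqr_int_le0 a1 /sqr_int_le0 a2 /sqr_int_le0 a3]
      [/sqr_int_le0 a4 /sqr_int_le0 a5 /sqr_int_le0 a6]] := Hp (sqr_int_ge1 s0).
have [/sqr_int_le0 b1 /sqr_int_le0 b2 /sqr_int_le0 b3 /sqr_int_le0 b4] := Hm (sqr_int_ge1 d0).
have s1 : e0 + e1 = 1 by lia.
have d1 : `|e0 - e1| <= 1.
  by rewrite -(@ler_pXn2r _ 2) // ?nnegrE // real_normK ?num_real ?expr1n.
move: {p1 m1 Hp Hm big pos s0 d0 ne} S a1 a2 a3 a4 a5 a6 b1 b2 b3 b4 s1 d1 => *.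
by split; [split; lia | split; [split; lia | split; [lia | lia]]].
Qed.

Lemma quadratic_linear_bounds (e0 e1 e2 e3 e4 e5 e6 e7 e8 e9 e10 e11 : int) :
  240 * (e0 + e1) ^+ 2 + 12 * (e2 + e3) ^+ 2 + 10 * (e4 + e5) ^+ 2 + 16 * e6 ^+ 2
  + 24 * e7 ^+ 2 + 8 * (e8 + e9) ^+ 2 + 12 * (e10 + e11) ^+ 2 <= 240 ->
  240 * (e0 - e1) ^+ 2 + 12 * (e2 - e3) ^+ 2 + 10 * (e4 - e5) ^+ 2
  + 8 * (e8 - e9) ^+ 2 + 12 * (e10 - e11) ^+ 2 <= 240 ->
  [/\ `|e2 + e3| <= 4, `|e4 + e5| <= 4, `|e7| <= 3 & `|e8 + e9| <= 5] /\
  [/\ `|e2 - e3| <= 4, `|e8 - e9| <= 5 & `|e10 - e11| <= 4].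
Proof.
move=> Qp Qm.
have pos (x : int) : 0 <= x ^+ 2 by rewrite sqr_ge0.
have [[_ p1 p2 _] [[p4 p5 p6] _]] :=
  linear_bound7 Qp (pos _) (pos _) (pos _) (pos _) (pos _) (pos _) (pos _).
have [[_ m1 _ m3 m4] _] := linear_bound5 Qm (pos _) (pos _) (pos _) (pos _) (pos _).
split; split; [apply: sqr_int_le_bound p1 _ | apply: sqr_int_le_bound p2 _
  | apply: sqr_int_le_bound p4 _ | apply: sqr_int_le_bound p5 _ | apply: sqr_int_le_bound m1 _
  | apply: sqr_int_le_bound m3 _ | apply: sqr_int_le_bound m4 _]; by [].
Qed.

Lemma odd_order_arith (a b : int) (p q r s : bool) :
  `|a + 0| <= 4 -> `|b + 0| <= 4 -> a + b = 1 ->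
  (5 %| p%:R - a)%Z -> (5 %| q%:R - b)%Z -> (3 %| r%:R - b)%Z -> (3 %| s%:R - a)%Z ->
  a = 1 \/ b = 1.
Proof. by case: p; case: q; case: r; case: s; lia. Qed.

Lemma order4_arith (b c s : int) : b + c = 1 -> s = b - c -> s = 1 \/ s = -1 ->
  b = 1 /\ c = 0 \/ b = 0 /\ c = 1.
Proof. by lia. Qed.

Lemma order8_signature_arith (b c d e s : int) : (2 %| b + c)%Z -> (2 %| 1 - (d + e))%Z ->
    b + c + d + e = 1 -> s = b - c - d - e -> s = 1 \/ s = -1 ->
  b = 1 /\ d + e = - c \/ b = 0 /\ d + e = 1 - c.
Proof. by lia. Qed.

Lemma order8_sym2_arith (b c e s1 s2 : int) : b = 1 /\ e = - c \/ b = 0 /\ e = 1 - c ->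
    `|c| <= 3 -> (2 %| b + c)%Z -> s1 = 1 \/ s1 = -1 -> s2 = 1 \/ s2 = -1 ->
    (5 %| - b - c + e - s1)%Z -> (5 %| - b + c - e - s2)%Z ->
  [/\ b = 0, c = 0 & e = 1].
Proof.
move=> be c3 bc s1E s2E h1 h2.
have : c = 0 \/ c = 1 \/ c = -1 \/ c = 2 \/ c = -2 \/ c = 3 \/ c = -3 by lia.
move: be s1E s2E c3 bc h1 h2 => [[-> ->]|[-> ->]] [] -> [] -> c3 bc h1 h2 cE.
all: by move: c3 bc h1 h2; decompose [or] cE; subst; first [by vm_compute | lia].
Qed.

Lemma order8_nat_arith (d e s : int) : d + e = 1 -> `|d - e| <= 5 -> s = 1 \/ s = -1 ->
  (5 %| d - e - s)%Z -> d = 1 /\ e = 0 \/ d = 0 /\ e = 1.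
Proof. by move=> ? ? [] ->; lia. Qed.

(** Both a + b and a - b are multiples of 6. *)
Lemma divisible6_pair (a b : int) : `|a + b| <= 5 -> `|a - b| <= 5 ->
  (2 %| - (a + b))%Z -> (3 %| - a)%Z -> (3 %| - b)%Z -> a = 0 /\ b = 0.
Proof. by lia. Qed.

(** The linear equations give b = 1 and c = -w; the congruences then say w = 1 and w = -1 modulo
    5. *)
Lemma order12_class6_arith (b c w s : int) : b + c + w = 1 -> s = b - c - w -> s = 1 ->
  (5 %| - b - c + 2 * w - 2)%Z -> (5 %| - b + c - 2 * w - 2)%Z -> False.
Proof. by lia. Qed.

(** The linear equations give b = 0 and f + g = 1 - c, and the congruence gives 5 | 3c, so c = 0.
    Then f - g is odd, at most 4 in size and 0 or plus or minus 1 modulo 5. *)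
Lemma order12_class7_arith (b c f g s : int) :
    b + c + (f + g) = 1 -> s = b - c - (f + g) -> s = -1 ->
    `|c| <= 3 -> `|f - g| <= 4 -> (5 %| - b - c + 2 * (f + g) - 2)%Z ->
    ((5 %| 2 * (f - g))%Z \/ exists2 r, r = 2 \/ r = -2 & (5 %| 2 * (f - g) - r)%Z) ->
  b = 0 /\ c = 0 /\ (f = 1 /\ g = 0 \/ f = 0 /\ g = 1).
Proof.
move=> S sE s1 c3 fg4 h1 h2; have b0 : b = 0 by lia.
have c0 : c = 0 by lia.
split=> //; split=> //; subst b c; case: h2 => [h2|[q [] -> h2]]; lia.
Qed.

(** * Conjugacy classes and partial augmentations *)

Lemma tw_trace_comm x y : tw_trace (twmx_mul x y) = tw_trace (twmx_mul y x).
Proof.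
move: x y => [s [[[a b] c] d]] [t [[[a' b'] c'] d']] /=.
by rewrite andbC; case: ifP => _; ring.
Qed.

(* The symmetric square; the factor 2 is the square of the root of 2 that is      *)
(* implicit in the odd elements.                                                 *)
Definition sym2_entry (x : twmx) (i j : nat) : 'F_5 :=
  let: (s, (a, b, c, d)) := x in (if s then 2 else 1) *
  nth 0 (nth [::] [:: [:: a * a; 2 * (a * b); b * b];
                      [:: a * c; a * d + b * c; b * d];
                      [:: c * c; 2 * (c * d); d * d]] i) j.

Definition sym2 (x : twmx) : 'M['F_5]_3 := \matrix_(i < 3, j < 3) sym2_entry x i j.
Definition sym2_sgn (x : twmx) : 'M['F_5]_3 := (-1) ^+ x.1 *: sym2 x.

(** The natural representation in degree 2; the entries of an odd element are multiples of the root
    of 2. *)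
Definition nat_entry (x : twmx) (i j : nat) : f25 :=
  let: (s, (a, b, c, d)) := x in
  let e (t : 'F_5) : f25 := if s then (0, t) else (t, 0) in
  nth 0 (nth [::] [:: [:: e a; e b]; [:: e c; e d]] i) j.

Definition nat_mx (x : twmx) : 'M[f25]_2 := \matrix_(i < 2, j < 2) nat_entry x i j.

Lemma sym2M x y : sym2 (twmx_mul x y) = sym2 x *m sym2 y.
Proof.
apply/matrixP=> i j; rewrite !mxE !big_ord_recl big_ord0 !mxE /=.
move: x y => [s [[[a b] c] d]] [t [[[a' b'] c'] d']] /=.
case: i j => [[|[|[|//]]] ?] [[|[|[|//]]] ?] /=; case: s t => [] [] /=; ring.
Qed.

Lemma nat_mxM x y : nat_mx (twmx_mul x y) = nat_mx x *m nat_mx y.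
Proof.
apply/matrixP=> i j; rewrite !mxE !big_ord_recl big_ord0 !mxE /=.
move: x y => [s [[[a b] c] d]] [t [[[a' b'] c'] d']] /=.
by case: i j => [[|[|//]] ?] [[|[|//]] ?] /=; case: s t => [] [] /=; congr pair; rewrite /=; ring.
Qed.

Lemma sym2_sgnM x y : sym2_sgn (twmx_mul x y) = sym2_sgn x *m sym2_sgn y.
Proof.
rewrite /sym2_sgn sym2M -scalemxAl -scalemxAr scalerA -signr_addb; congr (_ ^+ _ *: _).
by case: x y => [? [[[? ?] ?] ?]] [? [[[? ?] ?] ?]].
Qed.

Lemma sym2_1 : sym2 twmx_one = 1%:M.
Proof.
by apply/matrixP=> [[[|[|[|//]]] ?] [[|[|[|//]]] ?]]; rewrite !mxE /=; apply/eqP; vm_compute.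
Qed.

Lemma sym2_sgn_1 : sym2_sgn twmx_one = 1%:M.
Proof. by rewrite /sym2_sgn expr0 scale1r sym2_1. Qed.

Lemma nat_mx_1 : nat_mx twmx_one = 1%:M.
Proof.
by apply/matrixP=> [[[|[|//]] ?] [[|[|//]] ?]]; rewrite !mxE /=; apply/eqP; vm_compute.
Qed.

Lemma mxtrace_sym2 x :
  \tr (sym2 x) = sym2_entry x 0 0 + sym2_entry x 1 1 + sym2_entry x 2 2.
Proof. by rewrite /mxtrace !big_ord_recl big_ord0 !mxE /= addr0 addrA. Qed.

Lemma mxtrace_nat_mx x : \tr (nat_mx x) = nat_entry x 0 0 + nat_entry x 1 1.
Proof. by rewrite /mxtrace !big_ord_recl big_ord0 !mxE /= addr0. Qed.

(* Traces indexed by the class; those of nat_mx are nat_trace1 + nat_trace2 r.    *)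
Definition sym2_trace : nat -> int := nth 0 [:: 3; 3; 0; 0; 3; 3; -1; -1; 1; 1; 2; 2].
Definition sym2_sgn_trace : nat -> int := nth 0 [:: 3; 3; 0; 0; 3; 3; -1; 1; -1; -1; -2; -2].
Definition nat_trace1 : nat -> int := nth 0 [:: 2; -2; -1; 1; 2; -2; 0; 0; 0; 0; 0; 0].
Definition nat_trace2 : nat -> int := nth 0 [:: 0; 0; 0; 0; 0; 0; 0; 0; 1; -1; 2; -2].

Lemma trace_table : all (fun x => let k := tw_class x in
  let t := sym2_entry x 0 0 + sym2_entry x 1 1 + sym2_entry x 2 2 in
  [&& t == (sym2_trace k)%:~R, (-1) ^+ x.1 * t == (sym2_sgn_trace k)%:~R,
    (nat_entry x 0 0 + nat_entry x 1 1).1 == (nat_trace1 k)%:~R &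
    (nat_entry x 0 0 + nat_entry x 1 1).2 == (nat_trace2 k)%:~R]) twmx_list.
Proof. by vm_compute. Qed.

Section Classes.
Variables (gT : finGroupType) (code : gT -> twmx).
Hypotheses (codeM : {morph code : x y / (x * y)%g >-> twmx_mul x y}) (code_inj : injective code).
Hypotheses (code_list : forall x, code x \in twmx_list).
Hypothesis (code_onto : {in twmx_list, forall c, exists x, code x = c}).
Hypothesis (oG : #|gT| = 240%N).

Definition gclass x := tw_class (code x).
(** The elements lying over odd permutations. *)
Definition odd_elt x := (code x).1.

Lemma code1 : code 1%g = twmx_one.
Proof.
have [|e def_e] := code_onto (_ : twmx_one \in twmx_list); first by vm_compute.
suff -> : 1%g = e by [].
by apply: (mulgI e); rewrite mulg1; apply: code_inj; rewrite codeM def_e twmx_mul1.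
Qed.

Lemma exists_center : exists z : gT, code z = genz.
Proof. by apply: code_onto; vm_compute. Qed.

Lemma class_table x : let c := code x in
  [/\ [/\ (gclass x < 12)%N, gclass (x ^+ 2)%g = class_sq (gclass x),
        gclass (x ^+ 3)%g = class_cube (gclass x),
        gclass (x ^+ 5)%g = class_pow5 (gclass x) & gclass x^-1%g = gclass x],
      [/\ tw_class (genz ** c) = class_z (gclass x), genz ** c = c ** genz,
        gclass x = 0%N -> x = 1%g & gclass x = 1%N -> c = genz]
    & odd_elt x = (gclass x \in [:: 7; 8; 9; 10; 11]%N) /\
      gclass x = tw_class_of (odd_elt x) (tw_trace c) (x == 1%g) (c == genz)].
Proof.
move=> c; have /and5P[h1 /eqP h2 /eqP h3 /eqP h4] := allP tw_class_table _ (code_list x).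
case/and5P=> /eqP h5 /eqP h6 h7 h8 /and5P[/eqP h9 /eqP h10 /eqP h11 /eqP h12 h13].
rewrite /gclass !expgS expg0 mulg1 !codeM !twmx_mulA; split; split=> //.
- have [y def_y] := code_onto h13.
  suff -> : x^-1%g = y by rewrite def_y h11.
  by apply: (mulIg x); rewrite mulVg; apply: code_inj; rewrite codeM code1 def_y h12.
- by move=> c0; apply: code_inj; rewrite code1; apply/eqP; rewrite c0 in h7.
- by move=> c1; apply/eqP; rewrite c1 in h8.
- by rewrite h10 -code1 (inj_eq code_inj).
Qed.

Variable z : gT.
Hypothesis code_z : code z = genz.

Lemma z_central x : (z * x = x * z)%g.
Proof. by have [_ [_ h _ _] _] := class_table x; apply: code_inj; rewrite !codeM code_z. Qed.

Lemma z_square : (z * z = 1)%g.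
Proof. by apply: code_inj; rewrite codeM code1 code_z; apply/eqP; vm_compute. Qed.

Lemma z_neq1 : z != 1%g.
Proof. by rewrite -(inj_eq code_inj) code1 code_z; vm_compute. Qed.

Lemma gclass_z x : gclass (z * x)%g = class_z (gclass x).
Proof. by have [_ [h _ _ _] _] := class_table x; rewrite /gclass codeM code_z. Qed.

Lemma gclass_lt x : (gclass x < 12)%N. Proof. by have [[]] := class_table x. Qed.
Lemma gclass_sq x : gclass (x ^+ 2)%g = class_sq (gclass x).
Proof. by have [[]] := class_table x. Qed.
Lemma gclass_cube x : gclass (x ^+ 3)%g = class_cube (gclass x).
Proof. by have [[]] := class_table x. Qed.
Lemma gclass_pow5 x : gclass (x ^+ 5)%g = class_pow5 (gclass x).
Proof. by have [[]] := class_table x. Qed.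
Lemma gclass_inv x : gclass x^-1%g = gclass x.
Proof. by have [[]] := class_table x. Qed.
Lemma gclass_eq0 x : (gclass x == 0%N) = (x == 1%g).
Proof.
apply/eqP/eqP=> [|->]; first by have [_ []] := class_table x.
by rewrite /gclass code1.
Qed.
Lemma odd_eltE x : odd_elt x = (gclass x \in [:: 7; 8; 9; 10; 11]%N).
Proof. by have [_ _ []] := class_table x. Qed.

Lemma odd_eltM x y : odd_elt (x * y)%g = odd_elt x (+) odd_elt y.
Proof.
by rewrite /odd_elt codeM; case: (code x) (code y) => [s [[[? ?] ?] ?]] [t [[[? ?] ?] ?]].
Qed.

Lemma gclass_comm x y : gclass (x * y)%g = gclass (y * x)%g.
Proof.
have [_ _ [_ ->]] := class_table (x * y)%g; have [_ _ [_ ->]] := class_table (y * x)%g.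
rewrite !odd_eltM addbC !codeM tw_trace_comm -!codeM -code_z !(inj_eq code_inj).
have swap (a b w : gT) : (forall g, w * g = g * w)%g -> (a * b == w)%g -> (b * a == w)%g.
  move=> wC /eqP ab; apply/eqP; apply: (mulgI a); by rewrite mulgA ab wC.
by congr (tw_class_of _ _ _ _); apply/idP/idP; apply: swap => g; rewrite ?mul1g ?mulg1 ?z_central.
Qed.

Lemma gclass_class_function (F : nat -> int) : class_function (fun x => F (gclass x)).
Proof. by move=> x y; rewrite gclass_comm. Qed.

Lemma gclass_conj x y : gclass x = gclass y -> exists m, (x ^ m)%g = y.
Proof.
have rep t : exists m, code (t ^ m)%g = class_rep (gclass t).
  have lt_k : gclass t \in iota 0 12 by rewrite mem_iota gclass_lt.
  have := allP (allP tw_class_conj _ lt_k) _ (code_list t).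
  rewrite -/(gclass t) eqxx -size_twmx_list -has_find => /hasP[c /code_onto[m <-] /eqP tm].
  exists m; rewrite conjgE codeM codeM tm twmx_mulA -codeM mulVg code1 twmx_mul1 //.
move=> eq_xy; have [m xm] := rep x; have [n yn] := rep y.
exists (m * n^-1)%g; rewrite conjgM; apply: (canLR (conjgK n)); apply: code_inj.
exact: etrans xm (etrans (congr1 class_rep eq_xy) (esym yn)).
Qed.

Lemma big_code (R : Type) (idx : R) (op : Monoid.com_law idx) (F : twmx -> R) :
  \big[op/idx]_(x : gT) F (code x) = \big[op/idx]_(c <- twmx_list) F c.
Proof.
rewrite -(big_map code xpredT F); apply: perm_big.
apply: uniq_perm; rewrite ?uniq_twmx_list ?map_inj_uniq ?index_enum_uniq // => c.
apply/mapP/idP=> [[x _ ->] // | /code_onto[x <-]].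
by exists x; rewrite ?mem_index_enum.
Qed.

Lemma card_gclass k : (k < 12)%N -> #|[set x | gclass x == k]| = class_size k.
Proof.
move=> lt_k; rewrite -sum1dep_card big_mkcond /=.
rewrite (big_code _ (fun c => if tw_class c == k then 1%N else 0%N)) -big_mkcond sum1_count.
by apply/eqP; apply: (allP tw_class_size); rewrite mem_iota.
Qed.
Definition eps k (u : gring int gT) : int := gpair (fun x => (gclass x == k)%:R) u.

Lemma gpair_gclass (F : nat -> int) u :
  gpair (fun x => F (gclass x)) u = \sum_(k < 12) F k * eps k u.
Proof.
rewrite /gpair (partition_big (fun x => Ordinal (gclass_lt x)) predT) //=.
apply: eq_bigr => k _; rewrite /eps /gpair mulr_sumr [RHS](bigID (fun x => gclass x == k)) /=.
rewrite [X in _ = _ + X]big1 ?addr0 => [|x /negbTE ->]; last by rewrite !mulr0.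
apply: eq_big => [x|x /eqP <-]; first by rewrite -val_eqE.
by rewrite eqxx mulr1 mulrC.
Qed.

Lemma eps_class_function k : class_function (fun x => (gclass x == k)%:R : int).
Proof. exact: (gclass_class_function (fun j => (j == k)%:R)). Qed.

Lemma eps_gelt k x : eps k (gelt x) = (gclass x == k)%:R.
Proof. by rewrite /eps gpair_gelt. Qed.

Lemma eps_pow_mod p (pw : nat -> nat) k u :
    prime p -> (forall x, gclass (x ^+ p)%g = pw (gclass x)) ->
  (p%:Z %| eps k (u ^+ p) - \sum_(j < 12) (pw j == k)%:R * eps j u)%Z.
Proof.
move=> p_pr pwE; have := gpair_exp_prime_mod u p_pr (eps_class_function k).
rewrite -(gpair_gclass (fun j => (pw j == k)%:R)) /eps.
by congr (_ %| _ - _)%Z; apply: eq_gpair => x; rewrite pwE.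
Qed.

(** As u equals u^t for a high power t of p prime to n, its class sum over k only involves elements
    whose t-th power lies in class k. *)
Lemma eps_singular p m k u n :
    prime p -> (0 < n)%N -> coprime p n -> u ^+ n = 1 ->
    (forall x j, (m <= j)%N -> gclass (x ^+ (p ^ j))%g != k) ->
  eps k u = 0.
Proof.
move=> p_pr n_gt0 co_pn un1 pk; pose t := (p ^ (totient n * m))%N.
have ut : u ^+ t = u.
  rewrite -(expr_mod _ un1) /t expnM -modnXm Euler_exp_totient // modnXm exp1n.
  by rewrite (expr_mod _ un1) expr1.
have t_gt0 : (0 < t)%N by rewrite expn_gt0 prime_gt0.
have co_tn : coprime t n by rewrite coprimeXl.
rewrite -ut /eps (gpair_exp_coprime (eps_class_function k) n_gt0 t_gt0 co_tn un1).
rewrite /gpair big1 // => x _; rewrite (negbTE (pk _ _ _)) ?mulr0 //.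
by rewrite leq_pmull ?totient_gt0.
Qed.

Lemma class_pow_iter p (pw : nat -> nat) :
    (forall x, gclass (x ^+ p)%g = pw (gclass x)) ->
  forall x j, gclass (x ^+ (p ^ j))%g = iter j pw (gclass x).
Proof.
by move=> pwE x; elim=> [|j IHj]; rewrite ?expg1 // expnSr expgM pwE IHj.
Qed.

Lemma eps_3singular u n k : (0 < n)%N -> coprime 3 n -> u ^+ n = 1 ->
  k \in [:: 2; 3; 10; 11]%N -> eps k u = 0.
Proof.
move=> n_gt0 co un1 kin; apply: (@eps_singular 3 1 k u n) => // x [//|j] _.
rewrite (class_pow_iter gclass_cube) iterS; apply: contraTneq kin => <-.
by case: (iter _ _ _) => [|[|[|[|[|[|[|[|[|[|[|[|[|?]]]]]]]]]]]]].
Qed.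

Lemma eps_5singular u n k : (0 < n)%N -> coprime 5 n -> u ^+ n = 1 ->
  k \in [:: 4; 5]%N -> eps k u = 0.
Proof.
move=> n_gt0 co un1 kin; apply: (@eps_singular 5 1 k u n) => // x [//|j] _.
rewrite (class_pow_iter gclass_pow5) iterS; apply: contraTneq kin => <-.
by case: (iter _ _ _) => [|[|[|[|[|[|[|[|[|[|[|[|[|?]]]]]]]]]]]]].
Qed.

Lemma eps_2singular u n k : (0 < n)%N -> coprime 2 n -> u ^+ n = 1 ->
  k \notin [:: 0; 2; 4]%N -> eps k u = 0.
Proof.
(* Three squarings are needed because G has elements of order 8. *)
move=> n_gt0 co un1 kin; apply: (@eps_singular 2 3 k u n) => // x [//|[|[|j]]] // _.
rewrite (class_pow_iter gclass_sq) !iterS; apply: contraNneq kin => <-.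
by case: (iter _ _ _) => [|[|[|[|[|[|[|[|[|[|[|[|[|?]]]]]]]]]]]]].
Qed.

Lemma eps_inv k u v n : (0 < n)%N -> u ^+ n = 1 -> u * v = 1 -> eps k v = eps k u.
Proof.
move=> n_gt0 un1 uv1; rewrite /eps (gpair_inv (eps_class_function k) n_gt0 un1 uv1).
by apply: eq_gpair => x; rewrite gclass_inv.
Qed.

Lemma class_zK k : (k < 12)%N -> class_z (class_z k) = k.
Proof. by case: k => [|[|[|[|[|[|[|[|[|[|[|[|?]]]]]]]]]]]]. Qed.

Lemma eps_mulz k u : (k < 12)%N -> eps k (gelt z * u) = eps (class_z k) u.
Proof.
move=> lt_k; rewrite /eps /gpair (reindex_inj (mulgI z)) /=; apply: eq_bigr => x _.
rewrite gelt_mulE mulKg gclass_z; congr (_ * _%:R); congr nat_of_bool.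
apply/eqP/eqP=> [<-|->]; rewrite class_zK ?gclass_lt //.
Qed.

Lemma sum_eps u : \sum_(k < 12) eps k u = gpair (fun=> 1) u.
Proof.
by rewrite -[RHS]/(gpair (fun x => (fun=> 1) (gclass x)) u) gpair_gclass;
  apply: eq_bigr => k _; rewrite mul1r.
Qed.

Lemma eps0E u : eps 0 u = u 1%g.
Proof.
rewrite /eps /gpair (bigD1 1%g) //= gclass_eq0 eqxx mulr1 big1 ?addr0 // => x.
by rewrite -gclass_eq0 => /negbTE ->; rewrite mulr0.
Qed.

Definition sgn_elt x : int := (-1) ^+ odd_elt x.

Lemma gpair_lin (chi : gT -> int) u v :
  (forall x y, chi (x * y)%g = chi x * chi y) -> gpair chi (u * v) = gpair chi u * gpair chi v.
Proof.
move=> chiM; rewrite gpair_mulE mulr_suml; apply: eq_bigr => x _; rewrite mulr_sumr.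
by apply: eq_bigr => y _; rewrite chiM mulrACA.
Qed.

Lemma sgn_eltM x y : sgn_elt (x * y)%g = sgn_elt x * sgn_elt y.
Proof. by rewrite /sgn_elt odd_eltM signr_addb. Qed.

Definition centralizer_order := nth 0%N [:: 240; 240; 12; 12; 10; 10; 8; 12; 8; 8; 12; 12]%N.

Lemma sum_conj_eps (u : gring int gT) x :
  \sum_g u (x ^ g)%g = (centralizer_order (gclass x))%:Z * eps (gclass x) u.
Proof.
have conjE y : gclass y = gclass x -> \sum_g u (y ^ g)%g = \sum_g u (x ^ g)%g.
  move/esym/gclass_conj => [m <-]; rewrite [RHS](reindex_inj (mulgI m)) /=.
  by apply: eq_bigr => g _; rewrite conjgM.
have dbl : \sum_(y | gclass y == gclass x) \sum_g u (y ^ g)%g = 240 * eps (gclass x) u.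
  rewrite exchange_big /= (eq_bigr (fun=> eps (gclass x) u)) => [|g _].
    by rewrite sumr_const oG mulr_natl.
  rewrite (reindex_inj (@conjg_inj _ g^-1)%g) /eps /gpair big_mkcond /=.
  apply: eq_bigr => y _; rewrite conjgKV.
  have -> : gclass (y ^ g^-1)%g = gclass y by rewrite conjgE gclass_comm -mulgA mulgV mulg1.
  by case: eqP; rewrite ?mulr1 ?mulr0.
move: dbl; rewrite (eq_bigr (fun=> \sum_g u (x ^ g)%g)) => [|y /eqP/conjE //].
rewrite sumr_const -(eq_card (A := [set y | gclass y == gclass x])) => [|y]; last by rewrite inE.
rewrite card_gclass ?gclass_lt // -mulr_natl.
have := gclass_lt x; move: (gclass x) (\sum_g _) => k S.
by case: k => [|[|[|[|[|[|[|[|[|[|[|[|k]]]]]]]]]]]]; rewrite /class_size /centralizer_order //=;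
  move: (eps _ u) => e; lia.
Qed.

(** * Traces of units in terms of class sums *)

Lemma sum_gclass (V : zmodType) (T : nat -> V) (u : gring int gT) :
  \sum_g T (gclass g) *~ u g = \sum_(k < 12) T k *~ eps k u.
Proof.
rewrite (partition_big (fun x => Ordinal (gclass_lt x)) predT) //=.
apply: eq_bigr => k _; rewrite /eps /gpair mulrz_sumr [RHS](bigID (fun x => gclass x == k)) /=.
rewrite [X in _ = _ + X]big1 ?addr0 => [|x /negbTE ->]; last by rewrite mulr0 mulr0z.
apply: eq_big => [x|x /eqP <-]; first by rewrite -val_eqE.
by rewrite eqxx mulr1.
Qed.

Lemma mxtrace_gring_lift (R : comNzRingType) m (rho : gT -> 'M[R]_m.+1) (t : nat -> R) u :
  (forall x, \tr (rho x) = t (gclass x)) ->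
  \tr (gring_lift rho u) = \sum_(k < 12) t k *~ eps k u.
Proof.
move=> trE; rewrite /gring_lift raddf_sum /= -sum_gclass; apply: eq_bigr => g _.
by rewrite raddfMz /= trE.
Qed.

Definition wsum (t : nat -> int) u : int := \sum_(k < 12) t k * eps k u.

Lemma mxtrace_gring_lift_int (R : comNzRingType) m (rho : gT -> 'M[R]_m.+1) (t : nat -> int) u :
  (forall x, \tr (rho x) = (t (gclass x))%:~R) ->
  \tr (gring_lift rho u) = (wsum t u)%:~R.
Proof.
move/(mxtrace_gring_lift (t := fun k => (t k)%:~R)) ->.
by rewrite rmorph_sum /=; apply: eq_bigr => k _; rewrite rmorphM /= mulrzr.
Qed.

Lemma mxtrace_sym2_lift u :
  \tr (gring_lift (sym2 \o code) u) = (wsum sym2_trace u)%:~R.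
Proof.
apply: mxtrace_gring_lift_int => x /=; rewrite mxtrace_sym2.
by have /and4P[/eqP -> _ _ _] := allP trace_table _ (code_list x).
Qed.

Lemma mxtrace_sym2_sgn_lift u :
  \tr (gring_lift (sym2_sgn \o code) u) = (wsum sym2_sgn_trace u)%:~R.
Proof.
apply: mxtrace_gring_lift_int => x /=; rewrite /sym2_sgn mxtraceZ mxtrace_sym2.
by have /and4P[_ /eqP <- _ _] := allP trace_table _ (code_list x).
Qed.

Lemma mxtrace_nat_lift u :
  \tr (gring_lift (nat_mx \o code) u) =
  ((wsum nat_trace1 u)%:~R, (wsum nat_trace2 u)%:~R) :> f25.
Proof.
have trE x : \tr ((nat_mx \o code) x) =
    (((nat_trace1 (gclass x))%:~R, (nat_trace2 (gclass x))%:~R) : f25).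
  rewrite /= mxtrace_nat_mx.
  have /and4P[_ _ /eqP <- /eqP <-] := allP trace_table _ (code_list x).
  by case: (_ + _).
rewrite (mxtrace_gring_lift (t := fun k => ((nat_trace1 k)%:~R, (nat_trace2 k)%:~R)) u trE).
rewrite /wsum !rmorph_sum /=.
have pair_sum (I : Type) (r : seq I) (F G : I -> 'F_5) :
    \sum_(i <- r) ((F i, G i) : f25) = (\sum_(i <- r) F i, \sum_(i <- r) G i).
  by elim: r => [|i r IHr]; rewrite ?big_nil // !big_cons IHr.
by rewrite -pair_sum; apply: eq_bigr => k _; rewrite f25E !rmorphM.
Qed.

Definition weps k u : int := (centralizer_order k)%:Z * eps k u.

Lemma conj_quadratic_bound (s : int) u v n :
    s * s = 1 -> (0 < n)%N -> u ^+ n = 1 -> u * v = 1 -> v * u = 1 ->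
  \sum_(k < 12) weps k u * eps k u + s * (\sum_(k < 12) weps (class_z k) u * eps k u) <= 240.
Proof.
move=> ss n_gt0 un1 uv1 vu1.
have := conjugation_trace_bound z_central z_square z_neq1 ss n_gt0 un1 uv1 vu1.
rewrite oG natz; congr (is_true (_ + _ * _ <= _)).
  by rewrite -(gpair_gclass (weps^~ u)); apply: eq_bigr => x _; rewrite sum_conj_eps.
rewrite -(gpair_gclass (fun k => weps (class_z k) u)); apply: eq_bigr => x _.
by rewrite sum_conj_eps gclass_z.
Qed.

Lemma order4_eps8 u k : u ^+ 4 = 1 -> k \in [:: 8; 9]%N -> eps k u = 0.
Proof.
move=> u4 kin.
have [x xk] : exists x, gclass x = k.
  have : has (fun c => tw_class c == k) twmx_list.
    by move: kin; rewrite !inE => /orP[]/eqP->; vm_compute.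
  by case/hasP=> c /code_onto[x <-] /eqP; exists x.
have xx j : gclass (x ^+ (2 ^ j))%g = iter j class_sq k.
  by rewrite (class_pow_iter gclass_sq) xk.
have x4 : (x ^+ 4)%g != 1%g.
  by rewrite -gclass_eq0 (xx 2%N); move: kin; rewrite !inE => /orP[]/eqP->.
have x8 : (x ^+ 8)%g = 1%g.
  by apply/eqP; rewrite -gclass_eq0 (xx 3%N); move: kin; rewrite !inE => /orP[]/eqP->.
have := order4_unit_conj_count oG x4 x8 u4.
have c0 : conj_count x x != 0.
  rewrite /conj_count pnatr_eq0 -lt0n; apply/card_gt0P; exists 1%g.
  by rewrite inE conjg1.
have -> : gpair (conj_count x) u = conj_count x x * eps k u.
  rewrite /eps /gpair mulr_sumr; apply: eq_bigr => y _; rewrite mulrCA; congr (_ * _).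
  have [ky|ky] := eqVneq (gclass y) k.
    have [m <-] : exists m, (x ^ m)%g = y by apply: gclass_conj; rewrite xk.
    by rewrite mulr1 class_functionJ //; apply: conj_count_class_function.
  rewrite mulr0 /conj_count eq_card0 // => g; rewrite !inE; apply: contraNF ky => /eqP yg.
  by rewrite -xk -yg conjgE gclass_comm -mulgA mulgV mulg1.
by move/eqP; rewrite mulf_eq0 (negbTE c0) => /eqP.
Qed.

Lemma eps0_eq1 u n : (0 < n)%N -> u ^+ n = 1 -> eps 0 u = 1 -> u = 1.
Proof. by rewrite eps0E; apply: gring_finite_order_eq1. Qed.

Lemma gelt_z2 : gelt z * gelt z = 1 :> gring int gT.
Proof. by rewrite -geltM z_square gelt1. Qed.

Lemma gelt_zC (u : gring int gT) : gelt z * u = u * gelt z.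
Proof. exact/gelt_central/z_central. Qed.

Lemma eps1_eq1 u n : (0 < n)%N -> u ^+ n = 1 -> eps 1 u = 1 -> u = gelt z.
Proof.
move=> n_gt0 un1 u1; rewrite -[u]mul1r -gelt_z2 -mulrA.
rewrite (@eps0_eq1 (gelt z * u) (n * 2)) ?mulr1 ?eps_mulz ?muln_gt0 ?n_gt0 //.
rewrite exprMn_comm; last exact: gelt_zC.
by rewrite [u ^+ _]exprM un1 expr1n mulr1 mulnC exprM expr2 gelt_z2 expr1n.
Qed.
Lemma sum12 (V : zmodType) (F : nat -> V) : \sum_(k < 12) F k =
  F 0%N + F 1%N + F 2%N + F 3%N + F 4%N + F 5%N + F 6%N + F 7%N + F 8%N + F 9%N + F 10%N + F 11%N.
Proof. by rewrite !big_ord_recl big_ord0 /= addr0 !addrA. Qed.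

(** The class sums of u are those of the group element x. *)
Definition trivial_at u x := forall k, eps k u = (gclass x == k)%:R.

Lemma eps_large k u : (12 <= k)%N -> eps k u = 0.
Proof.
move=> le_k; rewrite /eps /gpair big1 // => x _.
by rewrite (_ : (gclass x == k) = false) ?mulr0 //; have := gclass_lt x; lia.
Qed.

Lemma gclass_onto k : (k < 12)%N -> exists x, gclass x = k.
Proof.
move=> lt_k; have : has (fun c => tw_class c == k) twmx_list.
  by move: k lt_k => [|[|[|[|[|[|[|[|[|[|[|[|//]]]]]]]]]]]] _; vm_compute.
by case/hasP=> c /code_onto[x <-] /eqP; exists x.
Qed.

Lemma trivial_gpair f u x : class_function f -> trivial_at u x -> gpair f u = f x.
Proof.
move=> fC ux.
pose F k := if [pick y | gclass y == k] is Some y then f y else 0.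
have FE y : f y = F (gclass y).
  rewrite /F; case: pickP => [y' /eqP yy'|/(_ y)]; last by rewrite eqxx.
  by have [m <-] := gclass_conj yy'; rewrite class_functionJ.
rewrite (eq_gpair _ FE) gpair_gclass FE (bigD1 (Ordinal (gclass_lt x))) //=.
rewrite ux eqxx mulr1 big1 ?addr0 // => k /negbTE; rewrite -val_eqE /= => kx.
by rewrite ux eq_sym kx mulr0.
Qed.

(** One prime factor p of the exponent at a time: both class sum vectors are indicators of one class
    and agree modulo p, so the classes agree. *)
Lemma trivial_pow u x : trivial_at u x -> (forall t, exists y, trivial_at (u ^+ t) y) ->
  forall t, trivial_at (u ^+ t) (x ^+ t)%g.
Proof.
move=> ux triv t; elim: {t}_.+1 {-2}t (ltnSn t) => // m IHm t le_tm.
case: t le_tm => [|[|t]] le_tm.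
- by move=> k; rewrite expr0 expg0 -gelt1 eps_gelt.
- by rewrite expr1 expg1.
have p_pr := pdiv_prime (isT : (1 < t.+2)%N); have p_dv := pdiv_dvd t.+2.
move: p_pr p_dv; set p := pdiv _ => p_pr /dvdnP[s def_t].
have s_gt0 : (0 < s)%N by case: s def_t.
have us : trivial_at (u ^+ s) (x ^+ s)%g.
  by apply: IHm; apply: leq_trans (_ : (s < t.+2)%N) le_tm; rewrite def_t ltn_Pmulr ?prime_gt1.
have [y uy] := triv t.+2.
have -> : (x ^+ t.+2 = (x ^+ s) ^+ p)%g by rewrite -expgM -def_t.
suff xy : gclass ((x ^+ s) ^+ p)%g = gclass y by move=> k; rewrite uy xy.
have := gpair_exp_prime_mod (u ^+ s) p_pr (eps_class_function (gclass y)).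
rewrite -exprM -def_t (trivial_gpair (class_function_expg p (eps_class_function _)) us).
rewrite -/(eps _ _) uy eqxx; case: eqP => // _; rewrite subr0.
by rewrite dvdz1 /= => /eqP p1; rewrite p1 in p_pr.
Qed.

Lemma eps_bounds_inv u v n : (0 < n)%N -> u ^+ n = 1 -> u * v = 1 -> v * u = 1 ->
    gpair (fun=> 1) u = 1 ->
    [/\ 240 * (eps 0 u + eps 1 u) ^+ 2 + 12 * (eps 2 u + eps 3 u) ^+ 2
         + 10 * (eps 4 u + eps 5 u) ^+ 2 + 16 * eps 6 u ^+ 2 + 24 * eps 7 u ^+ 2
         + 8 * (eps 8 u + eps 9 u) ^+ 2 + 12 * (eps 10 u + eps 11 u) ^+ 2 <= 240,
        240 * (eps 0 u - eps 1 u) ^+ 2 + 12 * (eps 2 u - eps 3 u) ^+ 2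
         + 10 * (eps 4 u - eps 5 u) ^+ 2
         + 8 * (eps 8 u - eps 9 u) ^+ 2 + 12 * (eps 10 u - eps 11 u) ^+ 2 <= 240
      & eps 0 u + eps 1 u + eps 2 u + eps 3 u + eps 4 u + eps 5 u + eps 6 u + eps 7 u
         + eps 8 u + eps 9 u + eps 10 u + eps 11 u = 1].
Proof.
move=> n_gt0 un1 uv1 vu1 aug.
have := conj_quadratic_bound (s := 1) erefl n_gt0 un1 uv1 vu1.
have := conj_quadratic_bound (s := -1) erefl n_gt0 un1 uv1 vu1.
have := sum_eps u; rewrite aug.
rewrite !(sum12 (fun k => eps k u)) !(sum12 (fun k => weps k u * eps k u)).
rewrite !(sum12 (fun k => weps (class_z k) u * eps k u)) /weps /class_z /centralizer_order /=.
move: (eps 0 u) (eps 1 u) (eps 2 u) (eps 3 u) (eps 4 u) (eps 5 u) => e0 e1 e2 e3 e4 e5.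
move: (eps 6 u) (eps 7 u) (eps 8 u) (eps 9 u) (eps 10 u) (eps 11 u) => e6 e7 e8 e9 e10 e11.
by move=> -> Qm Qp; split=> //; [apply: le_trans Qp | apply: le_trans Qm];
  rewrite le_eqVlt; apply/orP; left; apply/eqP; ring.
Qed.
Definition trivial u := exists x, trivial_at u x.

Lemma eps_bounds u n : (0 < n)%N -> u ^+ n = 1 -> gpair (fun=> 1) u = 1 ->
    [/\ 240 * (eps 0 u + eps 1 u) ^+ 2 + 12 * (eps 2 u + eps 3 u) ^+ 2
         + 10 * (eps 4 u + eps 5 u) ^+ 2 + 16 * eps 6 u ^+ 2 + 24 * eps 7 u ^+ 2
         + 8 * (eps 8 u + eps 9 u) ^+ 2 + 12 * (eps 10 u + eps 11 u) ^+ 2 <= 240,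
        240 * (eps 0 u - eps 1 u) ^+ 2 + 12 * (eps 2 u - eps 3 u) ^+ 2
         + 10 * (eps 4 u - eps 5 u) ^+ 2
         + 8 * (eps 8 u - eps 9 u) ^+ 2 + 12 * (eps 10 u - eps 11 u) ^+ 2 <= 240
      & eps 0 u + eps 1 u + eps 2 u + eps 3 u + eps 4 u + eps 5 u + eps 6 u + eps 7 u
         + eps 8 u + eps 9 u + eps 10 u + eps 11 u = 1].
Proof.
move=> n_gt0 un1; apply: (@eps_bounds_inv u (u ^+ n.-1) n) => //.
  by rewrite -exprS prednK.
by rewrite -exprSr prednK.
Qed.

Lemma eps_linear_bounds u n : (0 < n)%N -> u ^+ n = 1 -> gpair (fun=> 1) u = 1 ->
  [/\ `|eps 2 u + eps 3 u| <= 4, `|eps 4 u + eps 5 u| <= 4, `|eps 7 u| <= 3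
    & `|eps 8 u + eps 9 u| <= 5]
  /\ [/\ `|eps 2 u - eps 3 u| <= 4, `|eps 8 u - eps 9 u| <= 5 & `|eps 10 u - eps 11 u| <= 4].
Proof.
by move=> n_gt0 un1 aug; have [Qp Qm _] := eps_bounds n_gt0 un1 aug;
  apply: quadratic_linear_bounds Qp Qm.
Qed.

(** * Units by order *)

Lemma eps01_dichotomy u n : (0 < n)%N -> u ^+ n = 1 -> gpair (fun=> 1) u = 1 ->
  [\/ u = 1, u = gelt z | eps 0 u = 0 /\ eps 1 u = 0].
Proof.
move=> n_gt0 un1 aug; have [Qp Qm S] := eps_bounds n_gt0 un1 aug.
have [e0|e0] := eqVneq (eps 0 u) 0.
  have [e1|e1] := eqVneq (eps 1 u) 0; first by constructor 3.
  have [_ [_ [_ [[e0' _]|[_ e1']]]]] := quadratic_eps01 Qp Qm S (or_intror e1).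
    by rewrite e0' in e0.
  by constructor 2; apply: (eps1_eq1 n_gt0).
have [_ [_ [_ [[e0' _]|[e0' _]]]]] := quadratic_eps01 Qp Qm S (or_introl e0).
  by constructor 1; apply: (eps0_eq1 n_gt0).
by rewrite e0' eqxx in e0.
Qed.

Lemma trivial_gelt x : trivial (gelt x).
Proof. by exists x => k; rewrite eps_gelt. Qed.

Lemma trivial_1 : trivial 1.
Proof. by rewrite -gelt1; apply: trivial_gelt. Qed.

Lemma trivial_mulz u : trivial (gelt z * u) -> trivial u.
Proof.
case=> x ux; exists (z * x)%g => k.
have -> : u = gelt z * (gelt z * u) by rewrite mulrA gelt_z2 mul1r.
have [lt_k|le_k] := ltnP k 12; last first.
  rewrite eps_large //; case: eqP => // def_k.
  by move: le_k; rewrite -def_k leqNgt gclass_lt.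
rewrite eps_mulz // ux gclass_z; congr (_%:R); congr nat_of_bool.
by apply/eqP/eqP=> [->|<-]; rewrite class_zK ?gclass_lt.
Qed.

Lemma trivial_delta_class u k : (k < 12)%N ->
    [seq eps j u | j <- iota 0 12] = [seq (k == j)%:R | j <- iota 0 12] ->
  exists2 x, trivial_at u x & gclass x = k.
Proof.
move=> lt_k eqs; have [x xk] := gclass_onto lt_k; exists x => // j; rewrite xk.
have [lt_j|le_j] := ltnP j 12; last first.
  by rewrite eps_large //; case: eqP => // kj; move: lt_k; rewrite kj ltnNge le_j.
by have := congr1 (fun s => nth 0 s j) eqs; rewrite !(nth_map 0%N) ?size_iota // nth_iota.
Qed.

Lemma trivial_delta u k : (k < 12)%N ->
  [seq eps j u | j <- iota 0 12] = [seq (k == j)%:R | j <- iota 0 12] -> trivial u.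
Proof. by move=> lt_k /(trivial_delta_class lt_k)[x ux _]; exists x. Qed.

Lemma eps_pow_mod_expanded p (pw : nat -> nat) k u :
    prime p -> (forall x, gclass (x ^+ p)%g = pw (gclass x)) ->
  (p%:Z %| eps k (u ^+ p)%R - (let c j : int := (pw j == k)%:R * eps j u in
     c 0%N + c 1%N + c 2%N + c 3%N + c 4%N + c 5%N + c 6%N + c 7%N
     + c 8%N + c 9%N + c 10%N + c 11%N))%Z.
Proof.
move=> p_pr pwE; have := eps_pow_mod k u p_pr pwE.
by rewrite (sum12 (fun j => (pw j == k)%:R * eps j u)).
Qed.

(** Apart from 1 and z, only the classes of elements of order 3 and 5 remain. One of them disappears
    when 3 or 5 does not divide n; otherwise the congruences from u^3 and u^5 combine with the size
    bounds. *)
Lemma odd_trivial u n : odd n -> u ^+ n = 1 -> gpair (fun=> 1) u = 1 ->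
  (3 %| n -> trivial (u ^+ 3))%N -> (5 %| n -> trivial (u ^+ 5))%N -> trivial u.
Proof.
move=> odd_n un1 aug triv3 triv5; have n_gt0 : (0 < n)%N by case: n odd_n {un1 triv3 triv5}.
have [->|->|[e0 e1]] := eps01_dichotomy n_gt0 un1 aug; [exact: trivial_1 | exact: trivial_gelt |].
have co2 : coprime 2 n by rewrite coprime2n.
have z2 k : k \notin [:: 0; 2; 4]%N -> eps k u = 0 := eps_2singular n_gt0 co2 un1.
have zs := (z2 1%N isT, z2 3%N isT, z2 5%N isT, z2 6%N isT, z2 7%N isT, z2 8%N isT, z2 9%N isT,
            z2 10%N isT, z2 11%N isT).
have [Qp _] := eps_bounds n_gt0 un1 aug.
rewrite e0 e1 !zs !addr0 !add0r => S.
have tr2 : eps 2 u = 1 -> trivial u.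
  move=> e2; have e4 : eps 4 u = 0 by apply: (addrI (eps 2 u)); rewrite addr0 S e2.
  apply: (@trivial_delta u 2) => //=.
  by rewrite e0 e1 e2 e4 !zs.
have tr4 : eps 4 u = 1 -> trivial u.
  move=> e4; have e2 : eps 2 u = 0 by apply: (addIr (eps 4 u)); rewrite add0r S e4.
  apply: (@trivial_delta u 4) => //=.
  by rewrite e0 e1 e2 e4 !zs.
have [/triv3[x ux]|n3] := boolP (3 %| n)%N; last first.
  apply: tr4; have e2 : eps 2 u = 0 by apply: (eps_3singular n_gt0 _ un1); rewrite // prime_coprime.
  by move: S; rewrite e2 add0r.
have [/triv5[y uy]|n5] := boolP (5 %| n)%N; last first.
  apply: tr2; have e4 : eps 4 u = 0 by apply: (eps_5singular n_gt0 _ un1); rewrite // prime_coprime.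
  by move: S; rewrite e4 addr0.
have := eps_pow_mod_expanded 0 u (isT : prime 3) gclass_cube.
have := eps_pow_mod_expanded 4 u (isT : prime 3) gclass_cube.
have := eps_pow_mod_expanded 0 u (isT : prime 5) gclass_pow5.
have := eps_pow_mod_expanded 2 u (isT : prime 5) gclass_pow5.
rewrite !ux !uy /= e0 e1 !zs.
have [[b2 b4 _ _] _] := eps_linear_bounds n_gt0 un1 aug.
move: b2 b4; rewrite !(z2 3%N, z2 5%N) // !(mul0r, mul1r, addr0, add0r) => b2 b4 *.
by case: (@odd_order_arith (eps 2 u) (eps 4 u) (gclass y == 2)%N (gclass y == 0)%N
  (gclass x == 4)%N (gclass x == 0)%N); rewrite ?addr0.
Qed.

Lemma augX (u : gring int gT) k : gpair (fun=> 1) u = 1 -> gpair (fun=> 1) (u ^+ k) = 1.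
Proof.
move=> aug; elim: k => [|k IHk]; first by rewrite expr0 -gelt1 gpair_gelt.
by rewrite exprS (gpair_lin _ _ (fun _ _ => esym (mulr1 1))) aug IHk.
Qed.

Lemma aug_mulz (u : gring int gT) : gpair (fun=> 1) u = 1 -> gpair (fun=> 1) (gelt z * u) = 1.
Proof. by move=> aug; rewrite (gpair_lin _ _ (fun _ _ => esym (mulr1 1))) gpair_gelt aug. Qed.

(** The congruence modulo 2 for w = u^m at the identity makes [eps 0 w + eps 1 w] odd, so w is 1 or
    z. In the second case z u has m-th power 1. *)
Lemma trivial_order2m u m : m \in [:: 1; 3; 5]%N -> u ^+ (2 * m) = 1 -> gpair (fun=> 1) u = 1 ->
  trivial u.
Proof.
move=> m_in u2m aug.
have odd_m : odd m by move: m_in; rewrite !inE => /or3P[] /eqP ->.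
have m_gt0 : (0 < m)%N by case: m odd_m {m_in u2m}.
have small v : v ^+ m = 1 -> gpair (fun=> 1) v = 1 -> trivial v.
  move=> vm aug_v; apply: (odd_trivial odd_m vm aug_v) => dv.
    by suff m3 : m = 3%N; [rewrite m3 in vm; rewrite vm; apply: trivial_1
      | move: m_in dv; rewrite !inE => /or3P[] /eqP ->].
  by suff m5 : m = 5%N; [rewrite m5 in vm; rewrite vm; apply: trivial_1
    | move: m_in dv; rewrite !inE => /or3P[] /eqP ->].
have w2 : (u ^+ m) ^+ 2 = 1 by rewrite -exprM mulnC.
have [wE|wE|[w0 w1]] := eps01_dichotomy (isT : 0 < 2)%N w2 (augX m aug); first exact: small.
  apply: trivial_mulz; apply: small.
    rewrite exprMn_comm; last exact: gelt_zC.
    rewrite wE -exprSr; have [k ->] : exists k, m.+1 = (2 * k)%N.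
      by exists m.+1./2; rewrite mul2n -[LHS]odd_double_half /= odd_m.
    by rewrite exprM expr2 gelt_z2 expr1n.
  exact: aug_mulz.
have := eps_pow_mod_expanded 0 (u ^+ m) (isT : prime 2) gclass_sq.
rewrite w2 -gelt1 eps_gelt (eqP (_ : gclass 1%g == 0%N)) ?gclass_eq0 //= w0 w1.
by rewrite !mul0r !addr0.
Qed.

Lemma gpair_sgnE u : gpair sgn_elt u =
  eps 0 u + eps 1 u + eps 2 u + eps 3 u + eps 4 u + eps 5 u + eps 6 u
  - eps 7 u - eps 8 u - eps 9 u - eps 10 u - eps 11 u.
Proof.
pose F k : int := (-1) ^+ (k \in [:: 7; 8; 9; 10; 11]%N).
transitivity (gpair (fun x => F (gclass x)) u).
  by apply: eq_gpair => x; rewrite /sgn_elt odd_eltE.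
rewrite gpair_gclass (sum12 (fun k => F k * eps k u)) /F /=.
by rewrite !expr0 !expr1 !mul1r !mulN1r.
Qed.

Lemma gpair_sgnX u k : gpair sgn_elt (u ^+ k) = gpair sgn_elt u ^+ k.
Proof.
elim: k => [|k IHk]; last by rewrite !exprS (gpair_lin _ _ sgn_eltM) IHk.
by rewrite !expr0 -gelt1 gpair_gelt /sgn_elt /odd_elt code1.
Qed.

Lemma gpair_sgn_pm1 u n : (0 < n)%N -> u ^+ n = 1 -> gpair sgn_elt u = 1 \/ gpair sgn_elt u = -1.
Proof.
move=> n_gt0 un1; have: gpair sgn_elt u ^+ n == 1.
  by rewrite -gpair_sgnX un1 -(expr0 u) gpair_sgnX expr0.
move=> /eqP /(congr1 Num.norm); rewrite normrX normr1 => /eqP.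
rewrite pexpr_eq1 ?normr_ge0 // => /eqP; lia.
Qed.

(** Once the classes of order 8 are excluded by [order4_eps8], only classes 6 and 7 remain, of
    opposite sign; augmentation and sign decide between them. *)
Lemma trivial_order4 u : u ^+ 2 = gelt z -> gpair (fun=> 1) u = 1 ->
  exists2 x, trivial_at u x & gclass x \in [:: 6; 7]%N.
Proof.
move=> u2 aug; have u4 : u ^+ 4 = 1 by rewrite (exprM u 2 2) u2 expr2 gelt_z2.
have nz : eps 0 (gelt z) = 0 by rewrite eps_gelt gclass_eq0 (negbTE z_neq1).
have [u1|uz|[e0 e1]] := eps01_dichotomy (isT : 0 < 4)%N u4 aug.
- by move: nz; rewrite -u2 u1 expr1n -gelt1 eps_gelt gclass_eq0 eqxx.
- by move: nz; rewrite -u2 uz expr2 gelt_z2 -gelt1 eps_gelt gclass_eq0 eqxx.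
have e3s k : k \in [:: 2; 3; 10; 11]%N -> eps k u = 0 := eps_3singular (isT : 0 < 4)%N isT u4.
have e5s k : k \in [:: 4; 5]%N -> eps k u = 0 := eps_5singular (isT : 0 < 4)%N isT u4.
have e8s k : k \in [:: 8; 9]%N -> eps k u = 0 by apply: order4_eps8.
have [_ _] := eps_bounds (isT : 0 < 4)%N u4 aug; have := gpair_sgnE u.
have s := gpair_sgn_pm1 (isT : 0 < 4)%N u4.
rewrite e0 e1 (e3s 2%N) // (e3s 3%N) // (e5s 4%N) // (e5s 5%N) // (e8s 8%N) // (e8s 9%N) //.
rewrite (e3s 10%N) // (e3s 11%N) // !(subr0, addr0, add0r) => sE S.
have tr k : k \in [:: 6; 7]%N -> eps 6 u = (k == 6)%:R -> eps 7 u = (k == 7)%:R ->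
    exists2 x, trivial_at u x & gclass x \in [:: 6; 7]%N.
  move=> k_in e6 e7; have [||x ux xk] := @trivial_delta_class u k; last by exists x; rewrite ?xk.
  - by move: k_in; rewrite !inE => /orP[] /eqP ->.
  rewrite /= e6 e7 e0 e1 (e3s 2%N) // (e3s 3%N) // (e5s 4%N) // (e5s 5%N) //.
  rewrite (e8s 8%N) // (e8s 9%N) // (e3s 10%N) // (e3s 11%N) //.
  by move: k_in {e6 e7}; rewrite !inE => /orP[] /eqP ->.
by have [[e6 e7]|[e6 e7]] := order4_arith S sE s; [apply: (tr 6%N) | apply: (tr 7%N)].
Qed.

Lemma wsum_inv t u v n : (0 < n)%N -> u ^+ n = 1 -> u * v = 1 -> wsum t v = wsum t u.
Proof.
by move=> n_gt0 un1 uv1; apply: eq_bigr => k _; rewrite (eps_inv k n_gt0 un1 uv1).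
Qed.

(** Here d is the determinant of the image of u. Since u and its inverse have the same class sums,
    the trace of the inverse in Newton's identities is again [T u]. *)
Lemma lift_mx3_trace (rho : gT -> 'M['F_5]_3) (t : nat -> int) u n
    (T := fun v => (wsum t v)%:~R : 'F_5) :
    rho 1%g = 1 -> {morph rho : x y / (x * y)%g >-> x * y} ->
    (forall v, \tr (gring_lift rho v) = T v) -> (0 < n)%N -> u ^+ n = 1 ->
  exists2 d : 'F_5,
    [/\ d != 0, (d * T u) *+ 2 = T u ^+ 2 - T (u ^+ 2)
      & T (u ^+ 3) = T u ^+ 3 - (T u * (d * T u)) *+ 3 + d *+ 3]
    & forall m x, u ^+ m = gelt x -> rho x = 1 -> d ^+ m = 1.
Proof.
move=> rho1 rhoM trE n_gt0 un1; set v := u ^+ n.-1.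
have uv1 : u * v = 1 by rewrite -exprS prednK.
have AB : gring_lift rho u *m gring_lift rho v = 1%:M.
  by rewrite -[LHS](gring_liftM rhoM) uv1 gring_lift1.
have Tv : T v = T u by rewrite /T (wsum_inv t n_gt0 un1 uv1).
exists (\det (gring_lift rho u)) => [|m x um rx]; last first.
  rewrite -(det1 _ 3) -[1%:M]rx -(gring_lift_gelt rho x) -um gring_liftX //.
  by elim: m {um} => [|m IHm]; rewrite ?expr0 ?det1 // !exprS det_mulmx IHm.
split.
- by apply/eqP=> d0; have := congr1 determinant AB; rewrite det_mulmx d0 mul0r det1 => /eqP.
- by rewrite -{1}Tv -!trE (mx3_trace_inv AB) expr2 gring_liftM.
by rewrite -{3}Tv -!trE -(mx3_trace_cube AB) !exprS expr0 mulr1 !gring_liftM // mulrA.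
Qed.

Lemma lift_mx2_trace (R : comNzRingType) (rho : gT -> 'M[R]_2) u n
    (T := fun v => \tr (gring_lift rho v)) :
    rho 1%g = 1 -> {morph rho : x y / (x * y)%g >-> x * y} ->
    (forall v, u * v = 1 -> T v = T u) -> (0 < n)%N -> u ^+ n = 1 ->
  exists d : R, [/\ d != 0, d * T u = T u & T (u ^+ 2) = T u ^+ 2 - d *+ 2].
Proof.
move=> rho1 rhoM TV n_gt0 un1; set v := u ^+ n.-1.
have uv1 : u * v = 1 by rewrite -exprS prednK.
have AB : gring_lift rho u *m gring_lift rho v = 1%:M.
  by rewrite -[LHS](gring_liftM rhoM) uv1 gring_lift1.
exists (\det (gring_lift rho u)); split.
- apply/eqP=> d0; have := congr1 determinant AB; rewrite det_mulmx d0 mul0r det1.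
  by move/esym/eqP; rewrite oner_eq0.
- by have := mx2_trace_inv AB; rewrite -/(T v) TV.
by rewrite -mx2_trace_sqr expr2 /T gring_liftM.
Qed.

Lemma wsumE t u : wsum t u = t 0%N * eps 0 u + t 1%N * eps 1 u + t 2%N * eps 2 u + t 3%N * eps 3 u
  + t 4%N * eps 4 u + t 5%N * eps 5 u + t 6%N * eps 6 u + t 7%N * eps 7 u + t 8%N * eps 8 u
  + t 9%N * eps 9 u + t 10%N * eps 10 u + t 11%N * eps 11 u.
Proof. exact: (sum12 (fun k => t k * eps k u)). Qed.

Lemma wsum_trivial t u k : (k < 12)%N -> (forall j, eps j u = (k == j)%:R) -> wsum t u = t k.
Proof.
move=> lt_k uk; rewrite /wsum (bigD1 (Ordinal lt_k)) //= uk eqxx mulr1 big1 ?addr0 // => j.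
by rewrite -val_eqE uk eq_sym => /negbTE ->; rewrite mulr0.
Qed.

Lemma sym2_lift_trace u n (T := fun v => (wsum sym2_trace v)%:~R : 'F_5) :
    (0 < n)%N -> u ^+ n = 1 ->
  exists2 d : 'F_5,
    [/\ d != 0, (d * T u) *+ 2 = T u ^+ 2 - T (u ^+ 2)
      & T (u ^+ 3) = T u ^+ 3 - (T u * (d * T u)) *+ 3 + d *+ 3]
    & forall m, u ^+ m = gelt z -> d ^+ m = 1.
Proof.
move=> n_gt0 un1.
have [|x y|v|d eqs dm] := @lift_mx3_trace (sym2 \o code) sym2_trace u n _ _ _ n_gt0 un1.
- by rewrite /= code1 sym2_1.
- by rewrite /= codeM sym2M.
- exact: mxtrace_sym2_lift.
exists d => // m um; apply: (dm m z um); rewrite /= code_z.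
by apply/matrixP=> [[[|[|[|//]]] ?] [[|[|[|//]]] ?]]; rewrite !mxE /=; apply/eqP; vm_compute.
Qed.

Lemma sym2_sgn_lift_trace u n (T := fun v => (wsum sym2_sgn_trace v)%:~R : 'F_5) :
    (0 < n)%N -> u ^+ n = 1 ->
  exists2 d : 'F_5,
    [/\ d != 0, (d * T u) *+ 2 = T u ^+ 2 - T (u ^+ 2)
      & T (u ^+ 3) = T u ^+ 3 - (T u * (d * T u)) *+ 3 + d *+ 3]
    & forall m, u ^+ m = gelt z -> d ^+ m = 1.
Proof.
move=> n_gt0 un1.
have [|x y|v|d eqs dm] := @lift_mx3_trace (sym2_sgn \o code) sym2_sgn_trace u n _ _ _ n_gt0 un1.
- by rewrite /= code1 sym2_sgn_1.
- by rewrite /= codeM sym2_sgnM.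
- exact: mxtrace_sym2_sgn_lift.
exists d => // m um; apply: (dm m z um); rewrite /= code_z /sym2_sgn /= expr0 scale1r.
by apply/matrixP=> [[[|[|[|//]]] ?] [[|[|[|//]]] ?]]; rewrite !mxE /=; apply/eqP; vm_compute.
Qed.

Lemma nat_lift_trace u n
    (T := fun v => ((wsum nat_trace1 v)%:~R, (wsum nat_trace2 v)%:~R) : f25) :
    (0 < n)%N -> u ^+ n = 1 ->
  exists d : f25, [/\ d != 0, d * T u = T u & T (u ^+ 2) = T u ^+ 2 - d *+ 2].
Proof.
move=> n_gt0 un1; have [|x y|v uv1|d] := @lift_mx2_trace _ (nat_mx \o code) u n _ _ _ n_gt0 un1.
- by rewrite /= code1 nat_mx_1.
- by rewrite /= codeM nat_mxM.
- by rewrite !mxtrace_nat_lift !(wsum_inv _ n_gt0 un1 uv1).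
by rewrite !mxtrace_nat_lift => eqs; exists d.
Qed.

(** Only classes 6 to 9 remain. The symmetric square and its sign twist eliminate 6 and 7; the
    natural representation, whose traces differ in sign on 8 and 9, separates these two. *)
Lemma trivial_order8 u : u ^+ 4 = gelt z -> (forall k, eps k (u ^+ 2) = (6 == k)%:R) ->
  gpair (fun=> 1) u = 1 -> trivial u.
Proof.
move=> u4 u2 aug; have u8 : u ^+ 8 = 1 by rewrite (exprM u 4 2) u4 expr2 gelt_z2.
have [->|->|[e0 e1]] := eps01_dichotomy (isT : 0 < 8)%N u8 aug.
- exact: trivial_1.
- exact: trivial_gelt.
have e3s k : k \in [:: 2; 3; 10; 11]%N -> eps k u = 0 := eps_3singular (isT : 0 < 8)%N isT u8.
have e5s k : k \in [:: 4; 5]%N -> eps k u = 0 := eps_5singular (isT : 0 < 8)%N isT u8.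
have zs := (e3s 2%N isT, e3s 3%N isT, e5s 4%N isT, e5s 5%N isT, e3s 10%N isT, e3s 11%N isT).
have [[_ _ b7 _] [_ b89 _]] := eps_linear_bounds (isT : 0 < 8)%N u8 aug.
have [_ _ S] := eps_bounds (isT : 0 < 8)%N u8 aug.
have sE := gpair_sgnE u; have s := gpair_sgn_pm1 (isT : 0 < 8)%N u8.
have m1 := eps_pow_mod_expanded 1 u (isT : prime 2) gclass_sq.
have m6 := eps_pow_mod_expanded 6 u (isT : prime 2) gclass_sq.
have [d [d0 d1 _] _] := sym2_lift_trace (isT : 0 < 8)%N u8.
have [d' [d0' d1' _] _] := sym2_sgn_lift_trace (isT : 0 < 8)%N u8.
have [t [t0 t1 t2]] := nat_lift_trace (isT : 0 < 8)%N u8.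
move: S sE m1 m6 d1 d1' t1 t2; rewrite !(wsum_trivial _ (isT : 6 < 12)%N u2) !u2 !wsumE.
rewrite e0 e1 (e3s 2%N) // (e3s 3%N) // (e5s 4%N) // (e5s 5%N) // (e3s 10%N) // (e3s 11%N) //.
rewrite /= !(subr0, addr0, add0r, mulr0, mul0r, mul1r, mulN1r, opprK, mulr1n).
move=> S sE m1 m6 d1 d1' t1 t2.
have m1' : (2 %| eps 6%N u + eps 7%N u)%Z by move: m1; lia.
have be := order8_signature_arith m1' m6 S sE s.
have s1 : exists2 s1 : int, s1 = 1 \/ s1 = -1 &
    (5 %| - eps 6%N u - eps 7%N u + (eps 8%N u + eps 9%N u) - s1)%Z.
  have [E|E] := F5_trace_sqr d0 d1; [exists 1 | exists (-1)]; rewrite ?addrA; try by [left|right];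
  by apply: dvdz5_F5; rewrite E.
have s2 : exists2 s2 : int, s2 = 1 \/ s2 = -1 &
    (5 %| - eps 6%N u + eps 7%N u - (eps 8%N u + eps 9%N u) - s2)%Z.
  have [E|E] := F5_trace_sqr d0' d1'; [exists 1 | exists (-1)];
  rewrite ?opprD ?addrA; try by [left|right]; by apply: dvdz5_F5; rewrite E.
have {s1 s2} [e6 e7 e89] : [/\ eps 6 u = 0, eps 7 u = 0 & eps 8 u + eps 9 u = 1].
  by case: s1 s2 => [s1 s1E h1] [s2 s2E h2]; apply: order8_sym2_arith be b7 m1' s1E s2E h1 h2.
have [s3 s3E h3] : exists2 s3 : int, s3 = 1 \/ s3 = -1 & (5 %| eps 8%N u - eps 9%N u - s3)%Z.
  by have [E|E] := f25_trace_sqr0 t0 t1 t2; [exists 1 | exists (-1)]; try by [left|right];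
    apply: dvdz5_F5; rewrite E.
have [[e8 e9]|[e8 e9]] := order8_nat_arith e89 b89 s3E h3.
  apply: (@trivial_delta u 8) => //=.
  by rewrite e0 e1 e6 e7 e8 e9 !zs.
apply: (@trivial_delta u 9) => //=.
by rewrite e0 e1 e6 e7 e8 e9 !zs.
Qed.

(** The congruences from u^2 and u^3 remove classes 2, 3, 8 and 9. The cube of u lies over class 6
    or 7: class 6 contradicts the two degree 3 representations taken together, class 7 leaves 10 or
    11. *)
Lemma trivial_order12 u : u ^+ 6 = gelt z -> (forall k, eps k (u ^+ 2) = (3 == k)%:R) ->
  gpair (fun=> 1) u = 1 -> trivial u.
Proof.
move=> u6 u2 aug; have u12 : u ^+ 12 = 1 by rewrite (exprM u 6 2) u6 expr2 gelt_z2.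
have [->|->|[e0 e1]] := eps01_dichotomy (isT : 0 < 12)%N u12 aug.
- exact: trivial_1.
- exact: trivial_gelt.
have w2 : (u ^+ 3) ^+ 2 = gelt z by rewrite -exprM.
have [x u3 x_in] := trivial_order4 w2 (augX 3 aug).
have e5s k : k \in [:: 4; 5]%N -> eps k u = 0 := eps_5singular (isT : 0 < 12)%N isT u12.
have [[b23 _ b7 b89] [b23' b89' b1011]] := eps_linear_bounds (isT : 0 < 12)%N u12 aug.
have [_ _ S] := eps_bounds (isT : 0 < 12)%N u12 aug.
have sE := gpair_sgnE u; have s := gpair_sgn_pm1 (isT : 0 < 12)%N u12.
(* The sign of u equals that of its cube. *)
have s3 : gpair sgn_elt u ^+ 3 = (-1) ^+ (gclass x == 7).
  rewrite -gpair_sgnX gpair_sgnE !u3; move: x_in; rewrite !inE => /orP[] /eqP ->; by [].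
have m2 := eps_pow_mod_expanded 2 u (isT : prime 2) gclass_sq.
have m6 := eps_pow_mod_expanded 6 u (isT : prime 2) gclass_sq.
have n0 := eps_pow_mod_expanded 0 u (isT : prime 3) gclass_cube.
have n1 := eps_pow_mod_expanded 1 u (isT : prime 3) gclass_cube.
have n8 := eps_pow_mod_expanded 8 u (isT : prime 3) gclass_cube.
have n9 := eps_pow_mod_expanded 9 u (isT : prime 3) gclass_cube.
have [d [_ d1 d2] d3] := sym2_lift_trace (isT : 0 < 12)%N u12.
have [d' [_ d1' d2'] d3'] := sym2_sgn_lift_trace (isT : 0 < 12)%N u12.
have [t [_ t1 t2]] := nat_lift_trace (isT : 0 < 12)%N u12.
have {}d3 := d3 6%N u6; have {}d3' := d3' 6%N u6.
move: m2 m6 n0 n1 n8 n9; rewrite /= !u2 !u3.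
have -> : (gclass x == 0)%N = false by move: x_in; rewrite !inE => /orP[] /eqP ->.
have -> : (gclass x == 1)%N = false by move: x_in; rewrite !inE => /orP[] /eqP ->.
have -> : (gclass x == 8)%N = false by move: x_in; rewrite !inE => /orP[] /eqP ->.
have -> : (gclass x == 9)%N = false by move: x_in; rewrite !inE => /orP[] /eqP ->.
rewrite e0 e1 (e5s 4%N) // (e5s 5%N) //.
rewrite /= !(subr0, sub0r, addr0, add0r, mulr0, mul0r, mul1r, mulN1r, opprK, mulr1n).
move=> m2 m8 n2 n3 n9 n8.
have {m2 n2 n3} [e2 e3] : eps 2 u = 0 /\ eps 3 u = 0.
  have le45 : (4 : int) <= 5 by [].
  exact: (divisible6_pair (le_trans b23 le45) (le_trans b23' le45) m2 n2 n3).
have {m8 n8 n9} [e8 e9] : eps 8 u = 0 /\ eps 9 u = 0.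
  exact: divisible6_pair b89 b89' m8 n8 n9.
move: S sE d1 d2 d1' d2' t1 t2; rewrite !(wsum_trivial _ (isT : 3 < 12)%N u2).
rewrite !(wsum_trivial _ (gclass_lt x) u3) !wsumE e0 e1 e2 e3 (e5s 4%N) // (e5s 5%N) // e8 e9.
rewrite /= !(subr0, sub0r, addr0, add0r, mulr0, mul0r, mul1r, mulN1r, opprK, mulr1n, oppr0).
move=> S sE d1 d2 d1' d2' t1 t2.
have x67 : gclass x = 6%N \/ gclass x = 7%N.
  by move: x_in; rewrite !inE => /orP[] /eqP; [left | right].
have h1 : (5 %| - eps 6%N u - eps 7%N u + 2 * (eps 10%N u + eps 11%N u) - 2)%Z.
  have E := F5_trace_cube d3 d1; rewrite mulrDr addrA; apply: dvdz5_F5.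
  by rewrite E // -d2; case: x67 => ->.
have [x6|x7] := x67.
  have h2 : (5 %| - eps 6%N u + eps 7%N u - 2 * (eps 10%N u + eps 11%N u) - 2)%Z.
    have E := F5_trace_cube d3' d1'; rewrite mulrDr opprD addrA -!mulNr; apply: dvdz5_F5.
    by rewrite E // -d2' x6.
  case: (@order12_class6_arith (eps 6 u) (eps 7 u) (eps 10 u + eps 11 u) (gpair sgn_elt u)) => //.
  - by rewrite addrA.
  - by rewrite opprD addrA.
  by move: s3; rewrite x6 expr0; case: s => ->.
have h2 : (5 %| 2 * (eps 10%N u - eps 11%N u))%Z \/
    exists2 r : int, r = 2 \/ r = -2 & (5 %| 2 * (eps 10%N u - eps 11%N u) - r)%Z.
  have E := f25_trace_sqr1 _ t1 t2.
  have [a0|a0] := eqVneq ((2 * eps 10 u + -2 * eps 11 u)%:~R : 'F_5) 0.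
    by left; rewrite mulrBr -mulNr -[X in (_ %| X)%Z]subr0; apply: dvdz5_F5.
  right; rewrite mulrBr -mulNr.
  by have [{}E|{}E] := E a0; [exists 2 | exists (-2)]; try by [left|right];
    apply: dvdz5_F5; rewrite E.
have s7 : gpair sgn_elt u = -1 by move: s3; rewrite x7 expr1; case: s => ->.
have S' : eps 6 u + eps 7 u + (eps 10 u + eps 11 u) = 1 by rewrite addrA.
have sE' : gpair sgn_elt u = eps 6 u - eps 7 u - (eps 10 u + eps 11 u) by rewrite opprD addrA.
have [e6 [e7 [[e10 e11]|[e10 e11]]]] := order12_class7_arith S' sE' s7 b7 b1011 h1 h2.
  apply: (@trivial_delta u 10) => //=.
  by rewrite e0 e1 e2 e3 e6 e7 e8 e9 e10 e11 (e5s 4%N) // (e5s 5%N).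
apply: (@trivial_delta u 11) => //=.
by rewrite e0 e1 e2 e3 e6 e7 e8 e9 e10 e11 (e5s 4%N) // (e5s 5%N).
Qed.

Lemma torsion_trivial u n : (0 < n)%N -> u ^+ n = 1 -> gpair (fun=> 1) u = 1 -> trivial u.
Proof.
elim: {n}_.+1 {-2}n (ltnSn n) u => // N IHN n le_nN u n_gt0 un1 aug.
have IH d v : (d < n)%N -> (0 < d)%N -> v ^+ d = 1 -> gpair (fun=> 1) v = 1 -> trivial v.
  by move=> lt_dn; apply: IHN; apply: leq_trans lt_dn le_nN.
have [odd_n|even_n] := boolP (odd n).
  have pow p : (1 < p)%N -> (p %| n)%N -> trivial (u ^+ p).
    move=> p_gt1 dv; have p_gt0 := ltnW p_gt1.
    have lt_d := ltn_Pdiv p_gt1 n_gt0.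
    have d_gt0 : (0 < n %/ p)%N by rewrite divn_gt0 // dvdn_leq.
    have ud : (u ^+ p) ^+ (n %/ p) = 1 by rewrite -exprM mulnC divnK.
    exact: (IH _ _ lt_d d_gt0 ud (augX p aug)).
  by apply: (odd_trivial odd_n un1 aug); apply: pow.
pose m := n./2; have def_n : n = (2 * m)%N by rewrite mul2n -[LHS]odd_double_half (negbTE even_n).
have m_gt0 : (0 < m)%N by move: n_gt0; rewrite def_n muln_gt0.
have lt_mn : (m < n)%N by rewrite def_n ltn_Pmull.
have u2m t : (u ^+ 2) ^+ t ^+ m = 1 by rewrite -!exprM mulnCA -def_n mulnC exprM un1 expr1n.
have tr t : trivial ((u ^+ 2) ^+ t) := (IH _ _ lt_mn m_gt0 (u2m t) (augX t (augX 2 aug))).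
have [x ux] : trivial (u ^+ 2) by have := tr 1%N; rewrite expr1.
have uxt := trivial_pow ux tr.
have pow1 t : gclass (x ^+ t)%g = 0%N -> u ^+ (2 * t) = 1.
  by move=> xt; rewrite exprM; apply: (eps0_eq1 m_gt0 (u2m t)); rewrite uxt xt.
have powz t : gclass (x ^+ t)%g = 1%N -> u ^+ (2 * t) = gelt z.
  by move=> xt; rewrite exprM; apply: (eps1_eq1 m_gt0 (u2m t)); rewrite uxt xt.
(* The class sums of u over the classes squaring to that of x add up to an odd number, so x lies in
   one of the six classes of squares. *)
have sq := eps_pow_mod_expanded (gclass x) u (isT : prime 2) gclass_sq.
have x2 := gclass_sq x; have x3 := gclass_cube x; have x5 := gclass_pow5 x.
have xE k : eps k (u ^+ 2) = (gclass x == k)%:R := ux k.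
have lt_x := gclass_lt x.
rewrite xE eqxx in sq.
have x1 y : y = x -> gclass y = gclass x by move=> ->.
move: (gclass x) x1 xE lt_x sq x2 x3 x5.
case=> [|[|[|[|[|[|[|[|[|[|[|[|//]]]]]]]]]]]] x1 xE _ sq x2 x3 x5;
  rewrite /= !mul0r !addr0 ?dvdz1 // in sq.
- exact: (@trivial_order2m u 1 isT (pow1 1%N (x1 _ (expg1 x))) aug).
- by have [y uy _] := @trivial_order4 u (powz 1%N (x1 _ (expg1 x))) aug; exists y.
- exact: (@trivial_order2m u 3 isT (pow1 _ x3) aug).
- exact: trivial_order12 (powz _ x3) xE aug.
- exact: (@trivial_order2m u 5 isT (pow1 _ x5) aug).
exact: trivial_order8 (powz _ x2) xE aug.
Qed.

Lemma geltX x t : (gelt x : gring int gT) ^+ t = gelt (x ^+ t)%g.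
Proof. by elim: t => [|t IHt]; rewrite ?expr0 ?expg0 -?gelt1 // exprS IHt -geltM expgS. Qed.

Lemma torsion_conjugate u n : (0 < n)%N -> u ^+ n = 1 -> gpair (fun=> 1) u = 1 ->
  exists (x : gring rat gT) (g : gT),
    x \is a GRing.unit /\ x^-1 * gring_ZtoQ u * x = gelt g.
Proof.
move=> n_gt0 un1 aug.
have trX t : trivial (u ^+ t).
  by apply: (torsion_trivial n_gt0 _ (augX t aug)); rewrite exprAC un1 expr1n.
have [g ug] : trivial u by have := trX 1%N; rewrite expr1.
have ugX := trivial_pow ug trX.
have gn1 : gelt g ^+ n = 1 :> gring int gT.
  rewrite geltX -gelt1; congr gelt; apply/eqP; rewrite -gclass_eq0.
  have := ugX n 0%N; rewrite un1 -gelt1 eps_gelt (eqP (_ : gclass 1%g == 0%N)) ?gclass_eq0 ?eqxx //.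
  by case: (_ == 1%g).
have [|x Ux xu] := rational_conjugacy n_gt0 un1 gn1.
  by move=> t f fC; rewrite geltX gpair_gelt; apply: trivial_gpair (ugX t).
by exists x, g; rewrite xu gring_ZtoQ_gelt.
Qed.

End Classes.

Theorem mainTheorem1 (gT : finGroupType) (gT_S5 : is_cover_S5 gT)
    (u : gring int gT) (u_tors : torsion_unit u) :
  exists (x : gring rat gT) (g : gT),
    x \is a GRing.unit /\
    (x^-1 * gring_ZtoQ u * x = gelt g \/ x^-1 * gring_ZtoQ u * x = - gelt g).
Proof.
have [code [codeM code_inj code_in code_onto oG]] := cover_model gT_S5.
have [z code_z] : exists z, code z = genz by apply: exists_center.
have conj := torsion_conjugate codeM code_inj code_in code_onto oG code_z.
have [_ [n n_gt0 un1]] := u_tors.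
pose aug (w : gring int gT) : int := gpair (fun=> 1) w.
have augM w1 w2 : aug (w1 * w2) = aug w1 * aug w2 by apply: gpair_lin.
have : aug u ^+ n == 1.
  rewrite -(gpair_gelt (fun=> 1 : int) (1%g : gT)) -/(aug _) gelt1 -un1.
  apply/eqP; elim: (n) => [|k IHk]; last by rewrite !exprS augM IHk.
  by rewrite !expr0 /aug -gelt1 gpair_gelt.
move=> /eqP/(congr1 Num.norm)/eqP; rewrite normrX normr1 pexpr_eq1 ?normr_ge0 //.
rewrite eqr_norml => /andP[/orP[] /eqP aug_u _].
  by have [x [g [Ux xu]]] := conj u n n_gt0 un1 aug_u; exists x, g; split=> //; left.
(* Augmentation -1: pass to -u, whose order divides 2n. *)
have [|||x [g [Ux xu]]] := conj (- u) (2 * n)%N.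
- by rewrite muln_gt0.
- by rewrite exprM sqrrN -exprM mulnC exprM un1 expr1n.
- by rewrite raddfN /= -/(aug u) aug_u opprK.
by exists x, g; split=> //; right; rewrite -xu raddfN /= mulrN mulNr opprK.
Qed.
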